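(* Let $U\subset\mathbb{C}$ be a simply connected domain and $\Phi=\sum_{i=1}^rA_i\chi_i$ a piecewise analytic function on $U$ with canonical data $(M_i,A_i)_{i=1}^r$, and assume $\Phi\in\Sigma(U)$. Choose analytic $f_i$ on $U$ with $f_i'=A_i$. Assume: (i) for all $j<k<l$, the one-dimensional Hausdorff measure of $\partial M_j\cap\partial M_k\cap\partial M_l$ is $0$; (ii) for every $p\in U$ with $i(p)>1$ and every $k\in I(p)$, one has $0\notin V_k(p)$. Then for every $p\in U$ there is a neighborhood of $p$ in which $\Phi=2\,\partial_z\phi_p$ a.e., where $\phi_p(z)=\max_{j\in I(p)}\Re\big(f_j(z)-f_j(p)\big)$.
   Context: A function $\Phi\in L^1_{loc}(U)$ is piecewise analytic with canonical data $(M_i,A_i)_{i=1}^r$ if $A_1,\dots,A_r$ are pairwise distinct analytic functions on $U$, $M_i=U\setminus\operatorname{supp}(\Phi-A_i)$ (supports in the distribution sense), $U\setminus\bigcup_iM_i$ has Lebesgue measure zero, $\chi_i$ is the characteristic function of $M_i$. $\Sigma(U)$ is the set of distributions $f$ on $U$ with $\partial f/\partial\bar z\ge0$ (a positive measure). For $p\in U$, $I(p)=\{j: p\in\overline{M_j}\}$ and $i(p)=|I(p)|$. For $k\in I(p)$ with $i(p)>1$, $V_k(p)=\big\{\sum_{j\in I(p)\setminus\{k\}}\theta_j(f_k'(p)-f_j'(p)) : \theta_j\ge0,\ \sum_j\theta_j>0\big\}$. $\partial_z=\frac12(\partial_x-i\partial_y)$ in the distribution sense. *)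

(* Defs.v *)
(* The complex plane C is modelled as R * R
   (R : realType), with its product (= Euclidean) topology and the
   product Lebesgue measure lam2 = lebesgue_measure \x lebesgue_measure.
   Complex values are pairs (real part, imaginary part). *)
From mathcomp Require Import all_boot all_order all_algebra.
From mathcomp Require Import all_classical all_reals all_analysis.
Import Order.TTheory GRing.Theory Num.Theory.
Import numFieldNormedType.Exports.

Set Implicit Arguments.
Unset Strict Implicit.
Unset Printing Implicit Defensive.

Local Open Scope classical_set_scope.
Local Open Scope ring_scope.

Section Defs.
Context {R : realType}.

Definition lam2 := ((@lebesgue_measure R) \x (@lebesgue_measure R))%E.

Definition cmul (z w : R * R) : R * R :=
  (z.1 * w.1 - z.2 * w.2, z.1 * w.2 + z.2 * w.1).
Definition cabs (z : R * R) : R := Num.sqrt (z.1 ^+ 2 + z.2 ^+ 2).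

Definition holo_at (f : R * R -> R * R) (z l : R * R) : Prop :=
  forall e : R, 0 < e ->
    \forall w \near z, cabs (f w - f z - cmul l (w - z)) <= e * cabs (w - z).

Definition analytic_on (U : set (R * R)) (f : R * R -> R * R) : Prop :=
  open U /\ forall z, U z -> exists l, holo_at f z l.

Definition domain (U : set (R * R)) : Prop :=
  open U /\ connected U /\ U !=set0.

Definition unit_square : set (R * R) :=
  [set st | 0 <= st.1 <= 1 /\ 0 <= st.2 <= 1].

Definition simply_connected (U : set (R * R)) : Prop :=
  forall g : R -> R * R,
    {within `[0, 1]%classic, continuous g} ->
    (forall s, 0 <= s <= 1 -> U (g s)) -> g 0 = g 1 ->
    exists H : R * R -> R * R,
      {within unit_square, continuous H} /\
      (forall st, unit_square st -> U (H st)) /\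
      (forall s, 0 <= s <= 1 -> H (s, 0) = g s /\ H (s, 1) = g 0) /\
      (forall t, 0 <= t <= 1 -> H (0, t) = g 0 /\ H (1, t) = g 0).

Definition e1 : R * R := (1, 0).
Definition e2 : R * R := (0, 1).

Fixpoint smooth_k (n : nat) (f : R * R -> R) : Prop :=
  match n with
  | 0 => continuous f
  | n'.+1 => (forall x, derivable f x e1 /\ derivable f x e2) /\
             smooth_k n' ('D_e1 f) /\ smooth_k n' ('D_e2 f)
  end.

Definition smooth (f : R * R -> R) : Prop := forall n, smooth_k n f.

Definition fsupport (f : R * R -> R) : set (R * R) :=
  closure [set x | f x != 0].

Definition test_on (N : set (R * R)) (psi : R * R -> R) : Prop :=
  smooth psi /\ compact (fsupport psi) /\ fsupport psi `<=` N.

Definition cint (h : R * R -> R * R) : R * R :=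
  (Rintegral lam2 setT (fun x => (h x).1), Rintegral lam2 setT (fun x => (h x).2)).

Definition pairing (g : R * R -> R * R) (psi : R * R -> R) : R * R :=
  cint (fun x => psi x *: g x).

Definition dz (psi : R * R -> R) (x : R * R) : R * R :=
  (2^-1 * 'D_e1 psi x, - (2^-1 * 'D_e2 psi x)).
Definition dzbar (psi : R * R -> R) (x : R * R) : R * R :=
  (2^-1 * 'D_e1 psi x, 2^-1 * 'D_e2 psi x).

Definition L1loc (U : set (R * R)) (g : R * R -> R * R) : Prop :=
  forall K, compact K -> K `<=` U ->
    lam2.-integrable K (fun x => ((g x).1)%:E) /\
    lam2.-integrable K (fun x => ((g x).2)%:E).

Definition dsupp (U : set (R * R)) (g : R * R -> R * R) : set (R * R) :=
  [set x | U x /\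
     ~ (exists N, open N /\ N x /\ N `<=` U /\
          forall psi, test_on N psi -> pairing g psi = 0)].

(** Sigma(U): d Phi / d zbar is a positive distribution (measure):
    <dPhi/dzbar, psi> = - <Phi, dpsi/dzbar> is real and >= 0 for psi >= 0 *)
Definition in_Sigma (U : set (R * R)) (Phi : R * R -> R * R) : Prop :=
  L1loc U Phi /\
  forall psi, test_on U psi -> (forall x, 0 <= psi x) ->
    let v := - cint (fun x => cmul (Phi x) (dzbar psi x)) in
    v.2 = 0 /\ 0 <= v.1.

Definition piecewise_analytic (U : set (R * R)) (r : nat)
    (Phi : R * R -> R * R) (A : 'I_r -> R * R -> R * R)
    (M : 'I_r -> set (R * R)) : Prop :=
  L1loc U Phi /\
  (forall i, analytic_on U (A i)) /\
  (forall i j, i != j -> exists z, U z /\ A i z != A j z) /\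
  (forall i, M i = U `\` dsupp U (fun z => Phi z - A i z)) /\
  lam2.-negligible (U `\` \bigcup_i M i).

Definition bdry_in (U M : set (R * R)) : set (R * R) :=
  U `&` (closure M `\` interior M).

Definition diam (E : set (R * R)) : \bar R :=
  ereal_sup ([set 0%E] `|` [set (cabs (xy.1 - xy.2))%:E | xy in E `*` E]).

Definition H1_null (S : set (R * R)) : Prop :=
  forall delta eps : R, 0 < delta -> 0 < eps ->
    exists E : nat -> set (R * R),
      S `<=` \bigcup_n E n /\
      (forall n, (diam (E n) <= delta%:E)%E) /\
      (\sum_(n <oo) diam (E n) <= eps%:E)%E.

Definition Iset (r : nat) (M : 'I_r -> set (R * R)) (p : R * R) : {set 'I_r} :=
  [set j : 'I_r | `[< closure (M j) p >] ].

(** V_k(p), where D j = f_j' *)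
Definition Vset (r : nat) (D : 'I_r -> R * R -> R * R)
    (M : 'I_r -> set (R * R)) (k : 'I_r) (p : R * R) : set (R * R) :=
  [set v | exists theta : 'I_r -> R,
     (forall j, 0 <= theta j) /\
     0 < \sum_(j in Iset M p :\ k) theta j /\
     v = \sum_(j in Iset M p :\ k) theta j *: (D k p - D j p)].

Definition phi_p (r : nat) (M : 'I_r -> set (R * R))
    (f : 'I_r -> R * R -> R * R) (p z : R * R) : R :=
  fine (\big[maxe/-oo%E]_(j in Iset M p) (((f j z - f j p).1)%:E)).

End Defs.

(* Main.v *)
(* Near [p] the vector field (Re Phi, - Im Phi) is bounded and, the imaginary part of
   dPhi/dzbar being zero, curl free: it has a Lipschitz potential [phi], obtained as a
   limit of line integrals of mollifications. The real part says that [phi] is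
   subharmonic, so each [u_k = phi - Re f_k] obeys the maximum principle. By Gordan's
   alternative, hypothesis (ii) yields a direction [e_k] along which every [f_j] with
   [j != k] grows faster than [f_k]; hence [u_k] increases along a cone around [e_k]
   while being locally constant on [M_k]. Translating a disc backwards from a point of
   [M_k] along this cone, the maximum principle shows that [u_k] takes there the same
   value as at [p - T e_k], which the cone property makes the minimum of [u_k] near
   [p]. So [phi - phi p >= Re (f_k - f_k p)] with equality on [M_k], and the union of
   the [M_k] is dense. *)
From HB Require Import structures.
Require Import Defs.
From mathcomp Require Import all_boot all_order all_algebra.
From mathcomp Require Import all_classical all_reals all_analysis.
From mathcomp Require Import measurable_realfun ring lra.
Import Order.TTheory GRing.Theory Num.Theory.
Import numFieldNormedType.Exports.
Set Implicit Arguments.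
Unset Strict Implicit.
Unset Printing Implicit Defensive.
Local Open Scope classical_set_scope.
Local Open Scope ring_scope.

(** * Planar Lebesgue measure: open sets and integrability criteria *)

Section plane_measure.
Context {R : realType}.
Local Notation T2 := (measurableTypeR R * measurableTypeR R)%type.

(** Subharmonicity therefore stays a statement about test functions, and the maximum principle comes
    from testing against a radial bump that is strictly subharmonic off a small disc. [in_Sigma]
    speaks of nonnegative test functions only; this is why the mollifier is a product of
    one-variable bumps. Products of differences of shifted primitives are then nonnegative test
    functions, and the curl identity for them says that the mollified field has no circulation
    around rectangles. Its line integrals are never formed: they are absorbed in the kernel of a
    planar integral. A single inequality survives the limit, stated for arbitrary squares: if
    [e.1 * g1 + e.2 * g2 >= b] almost everywhere on a square containing [z] and [z + e], then
    [phi (z + e) - phi z >= b]. The Lipschitz bound, the equality with [Re f_k] up to a constant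
    near points of [M_k], and the growth along cones all follow from it. *)

Lemma ball2E (p : R * R) (r : R) :
  ball p r = (ball p.1 r) `*` (ball p.2 r).
Proof. by []. Qed.

Lemma ball2P (p z : R * R) (r : R) :
  ball p r z <-> `|z.1 - p.1| < r /\ `|z.2 - p.2| < r.
Proof.
rewrite ball2E /= -!ball_normE /=; split=> -[h1 h2].
  by rewrite distrC h1 distrC h2.
by split; rewrite distrC.
Qed.

(** Squares with rational centres and radii [1 / (k + 1)]. They make open sets countable unions of
    measurable rectangles, and later turn local negligibility into global negligibility. *)
Lemma countable_ball_base : exists (c : nat -> R * R) (e : nat -> R),
  (forall n, 0 < e n) /\
  forall (O : set (R * R)) x, open O -> O x ->
    exists n, ball (c n) (e n) x /\ ball (c n) (e n) `<=` O.
Proof.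
(* Codes of no triple get the default [(0, 0, 0)], which only repeats a member of the family. *)
pose d n : rat * rat * nat := odflt (0, 0, 0%N) (unpickle n).
exists (fun n => (ratr (d n).1.1, ratr (d n).1.2)), (fun n => (d n).2.+1%:R^-1).
split=> [n|O x oO Ox]; first by rewrite invr_gt0.
have /nbhs_ballP[r /= r0 rO] : nbhs x O by exact: open_nbhs_nbhs.
have [k _ kr] : \forall k \near \oo, k.+1%:R^-1 < r / 2.
  have := @near_infty_natSinv_lt R (PosNum (divr_gt0 r0 (ltr0Sn R 1))).
  exact.
have {}kr := kr k (leqnn k).
have k0 : 0 < k.+1%:R^-1 :> R by rewrite invr_gt0.
have [a' [/= ax [a _ aE]]] := @dense_rat R (ball x.1 k.+1%:R^-1)
  (ex_intro _ x.1 (ballxx _ k0)) (ball_open _ _).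
have [b' [/= bx [b _ bE]]] := @dense_rat R (ball x.2 k.+1%:R^-1)
  (ex_intro _ x.2 (ballxx _ k0)) (ball_open _ _).
exists (pickle ((a, b), k)); rewrite /d pickleK /= aE bE; split.
  by split; apply: ball_sym.
move=> y [/= y1 y2]; apply: rO; apply: (@le_ball _ _ _ (k.+1%:R^-1 + k.+1%:R^-1)).
  by rewrite [leRHS]splitr lerD// ltW.
by split => /=; [apply: ball_triangle ax _ | apply: ball_triangle bx _].
Qed.

Lemma measurable_ball2 (p : R * R) r : measurable (ball p r : set T2).
Proof. by rewrite ball2E; apply: measurableX; exact: measurable_ball. Qed.

Lemma open_measurable2 (O : set (R * R)) : open O -> measurable (O : set T2).
Proof.
move=> oO; have [c [e [e0 ce]]] := countable_ball_base.
rewrite (_ : O = \bigcup_(n in [set n | ball (c n) (e n) `<=` O]) ball (c n) (e n)).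
  by apply: bigcup_measurable => n _; exact: measurable_ball2.
apply/seteqP; split=> x; last by move=> [n /= h /h].
by move=> Ox; have [n [h1 h2]] := ce _ _ oO Ox; exists n.
Qed.

Lemma closed_measurable2 (A : set (R * R)) : closed A -> measurable (A : set T2).
Proof.
by move/closed_openC/open_measurable2 => h; rewrite -(setCK A); exact: measurableC.
Qed.

Lemma compact_closed2 (K : set (R * R)) : compact K -> closed K.
Proof. by apply: compact_closed; exact: norm_hausdorff. Qed.

Lemma continuous_measurable2 (f : R * R -> R) : continuous f ->
  measurable_fun (setT : set T2) f.
Proof.
move=> /continuousP cf; apply: (measurability _ (RGenOpens.measurableE R)).
move=> _ [_ [a [b ->] <-]]; rewrite setTI.
apply: open_measurable2; exact/cf/interval_open.
Qed.

Lemma lam2_ball (p : R * R) r : 0 <= r -> lam2 (ball p r) = ((r *+ 2) * (r *+ 2))%:E.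
Proof.
move=> r0; rewrite ball2E /lam2 product_measure1E; try exact: measurable_ball.
rewrite EFinM; congr (_ * _)%E; exact: lebesgue_measure_ball.
Qed.

Lemma bounded_support_integrable (g : R * R -> R) (p : R * R) (r C : R) :
  0 <= r -> measurable_fun (setT : set T2) g -> (forall x, `|g x| <= C) ->
  (forall x, ~ ball p r x -> g x = 0) -> lam2.-integrable setT (EFin \o g).
Proof.
move=> r0 mg gC g0.
have -> : EFin \o g = (EFin \o g) \_ (ball p r).
  apply/funext => x /=; rewrite patchE; case: ifPn => //.
  by rewrite notin_setE => /g0 ->.
apply: (@integrable_mkcond _ T2 R lam2 (ball p r) (EFin \o g) (measurable_ball2 p r)).1.
apply: measurable_bounded_integrable; first exact: measurable_ball2.
- exact: (eq_ind_r (fun x => (x < +oo)%E) (ltry _) (lam2_ball p r0)).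
- exact: measurable_funTS.
- exists C; split; first exact: num_real.
  by move=> M CM x _; apply: (le_trans (gC x)); exact: ltW.
Qed.

Lemma integrableM_bounded (g k : R * R -> R) (C : R) :
  lam2.-integrable setT (EFin \o g) -> measurable_fun (setT : set T2) k ->
  (forall x, `|k x| <= C) ->
  lam2.-integrable setT (EFin \o (fun x => g x * k x)).
Proof.
move=> ig mk kC.
have h : lam2.-integrable setT (fun x => C%:E * (EFin \o g) x)%E by exact: integrableZl.
apply: le_integrable h => //.
  apply/measurable_EFinP; apply: measurable_funM => //.
  by apply/measurable_EFinP; exact: measurable_int ig.
move=> x _ /=; rewrite lee_fin !normrM mulrC ler_wpM2r//.
exact: le_trans (kC x) (ler_norm _).
Qed.

End plane_measure.

(** * Translation invariance of the planar integral *)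

Section translation.
Context {R : realType}.
Local Notation T1 := (measurableTypeR R).
Local Notation T2 := (T1 * T1)%type.

Lemma measurable_shift (a : R) : @measurable_fun _ _ T1 T1 setT (fun x : T1 => x + a).
Proof. by apply: (@continuous_measurable_fun R) => x; apply: cvgD => //; exact: cvg_cst. Qed.

(** The push-forward under the translation agrees with Lebesgue measure on half-open intervals,
    which determine it. The planar case is the same argument on rectangles. *)
Lemma lebesgue_measure_shift (a : R) (A : set T1) : measurable A ->
  lebesgue_measure ((fun x : T1 => x + a) @^-1` A) = lebesgue_measure A.
Proof.
move=> mA.
pose f : {mfun T1 >-> T1} := HB.pack (fun x : T1 => x + a)
  (isMeasurableFun.Build _ _ _ _ _ (measurable_shift a)).
rewrite [RHS](@lebesgue_measure_unique _ (pushforward lebesgue_measure f))//.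
move=> X [[u v] _ <-] /=; rewrite /pushforward.
rewrite (_ : f @^-1` _ = `]u - a, v - a]%classic).
  by rewrite !lebesgue_measure_itv /= !lte_fin ltrD2r -!EFinD; case: ifP => // _; congr EFin; lra.
by apply/seteqP; split=> x /=; rewrite !in_itv /=; lra.
Qed.

Lemma lam2_shift (a : R * R) (A : set T2) : measurable A ->
  lam2 ((fun x : T2 => x + a : T2) @^-1` A) = lam2 A.
Proof.
move=> mA.
have ms : measurable_fun (setT : set T2) (fun x : T2 => (x.1 + a.1, x.2 + a.2) : T2).
  apply: measurable_fun_pair.
    by apply: measurableT_comp (measurable_shift a.1) _; exact: measurable_fst.
  by apply: measurableT_comp (measurable_shift a.2) _; exact: measurable_snd.
pose f : {mfun T2 >-> T2} := HB.pack (fun x : T2 => (x.1 + a.1, x.2 + a.2) : T2)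
  (isMeasurableFun.Build _ _ _ _ _ ms).
rewrite [RHS](@product_measure_unique _ _ _ _ _ lebesgue_measure lebesgue_measure (pushforward lam2 f))//.
move=> X Y mX mY /=; rewrite /pushforward.
rewrite (_ : f @^-1` _ = ((fun x : T1 => x + a.1) @^-1` X) `*` ((fun x : T1 => x + a.2) @^-1` Y))//.
have h b (Z : set T1) : measurable Z -> measurable ((fun x : T1 => x + b) @^-1` Z).
  by move=> mZ; rewrite -[X in measurable X]setTI; exact: measurable_shift.
rewrite /lam2 product_measure1E; [|exact: h|exact: h].
by congr (_ * _)%E; exact: lebesgue_measure_shift.
Qed.

Lemma integral_shift (a : R * R) (g : R * R -> R) :
  lam2.-integrable setT (EFin \o g) ->
  lam2.-integrable setT (EFin \o (fun x => g (x + a))) /\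
  Rintegral lam2 setT (fun x => g (x + a)) = Rintegral lam2 setT g.
Proof.
move=> ig.
have ms : measurable_fun (setT : set T2) (fun x : T2 => x + a : T2).
  apply: (@measurable_fun_pair _ _ _ T2 T1 T1 (fun x => x.1 + a.1) (fun x => x.2 + a.2)).
    by apply: measurableT_comp (measurable_shift a.1) _; exact: measurable_fst.
  by apply: measurableT_comp (measurable_shift a.2) _; exact: measurable_snd.
have mg : measurable_fun (setT : set T2) (EFin \o g) by exact: measurable_int ig.
have eqm (h : T2 -> \bar R) : measurable_fun (setT : set T2) h -> (forall x, 0 <= h x)%E ->
    (\int[lam2]_x h (x + a)%R = \int[lam2]_x h x)%E.
  move=> mh h0.
  have E := @ge0_integral_pushforward _ _ T2 T2 R _ ms lam2 setT h measurableT mh (fun y _ => h0 y).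
  etransitivity; first by symmetry; exact: E.
  by apply: eq_measure_integral => A mA _; exact: lam2_shift.
have im : lam2.-integrable setT (EFin \o (fun x => g (x + a))).
  apply/integrableP; split; first exact: measurableT_comp mg ms.
  rewrite (eqm (fun x => `|(EFin \o g) x|%E))//; first by case/integrableP: ig.
  exact: measurableT_comp.
split; first exact: im.
rewrite /Rintegral; congr fine; rewrite [LHS]integralE [RHS]integralE.
congr (_ - _)%E.
  etransitivity; last by apply: (eqm (EFin \o g)^\+%E (measurable_funepos mg)) => x; exact: funepos_ge0.
  by apply: eq_integral => x _; rewrite !funeposE.
etransitivity; last by apply: (eqm (EFin \o g)^\-%E (measurable_funeneg mg)) => x; exact: funeneg_ge0.
by apply: eq_integral => x _; rewrite !funenegE.
Qed.

End translation.

(** * Directional derivatives and smooth functions on the plane *)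

Section plane_smooth.
Context {R : realType}.
Implicit Types (f g : R * R -> R).

(** Both sides are limits of the same difference quotient. This carries the one-variable chain rule
    and mean value theorem over to directional derivatives. *)
Lemma is_derive_lineP (V : normedModType R) (f : V -> R) x v d :
  is_derive x v f d <-> is_derive (0 : R) 1 (fun h : R => f (h *: v + x)) d.
Proof.
have E : (fun h : R => h^-1 *: ((f \o shift x) (h *: v) - f x)) =
   (fun h : R => h^-1 *: (((fun h : R => f (h *: v + x)) \o shift 0) (h *: 1) -
      (fun h : R => f (h *: v + x)) 0)).
  by rewrite funeqE => h /=; rewrite addr0 scale0r add0r [_%:A]mulr1.
split=> -[]; rewrite /derivable /derive => h1 h2; split.
- by move: h1; rewrite E.
- by move: h2; rewrite E.
- by rewrite /derivable E.
- by rewrite /derive E.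
Qed.

Lemma is_derive_comp1 (V : normedModType R) (q : V -> R) (F : R -> R) x v dq dF :
  is_derive x v q dq -> is_derive (q x) 1 F dF ->
  is_derive x v (fun y => F (q y)) (dF * dq).
Proof.
move=> /is_derive_lineP hq hF; apply/is_derive_lineP.
have hF' : is_derive ((fun h : R => q (h *: v + x)) 0) 1 F dF by rewrite scale0r add0r.
by have := @is_derive1_comp _ F (fun h : R => q (h *: v + x)) 0 dF dq hF' hq.
Qed.

Lemma smooth_kS n f d1 d2 :
  (forall x, is_derive x e1 f (d1 x)) -> (forall x, is_derive x e2 f (d2 x)) ->
  smooth_k n d1 -> smooth_k n d2 -> smooth_k n.+1 f.
Proof.
move=> h1 h2 s1 s2; split; first by move=> x; split; [case: (h1 x)|case: (h2 x)].
have -> : 'D_e1 f = d1 by apply/funext => x; case: (h1 x).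
by have -> : 'D_e2 f = d2 by apply/funext => x; case: (h2 x).
Qed.

Lemma smooth_k_derive n f : smooth_k n.+1 f ->
  (forall x, is_derive x e1 f ('D_e1 f x)) /\ (forall x, is_derive x e2 f ('D_e2 f x)).
Proof. by move=> [h _]; split=> x; apply: derivableP; case: (h x). Qed.

Lemma smooth_kD n f g : smooth_k n f -> smooth_k n g ->
  smooth_k n (fun x => f x + g x).
Proof.
elim: n f g => [|n IH] f g; first by move=> cf cg x; apply: cvgD; [exact: cf|exact: cg].
move=> sf sg; have [f1 f2] := smooth_k_derive sf; have [g1 g2] := smooth_k_derive sg.
case: sf => _ [sf1 sf2]; case: sg => _ [sg1 sg2].
have h1 x : is_derive x e1 (fun x => f x + g x) ('D_e1 f x + 'D_e1 g x).
  exact: is_deriveD.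
have h2 x : is_derive x e2 (fun x => f x + g x) ('D_e2 f x + 'D_e2 g x).
  exact: is_deriveD.
by apply: (smooth_kS h1 h2); exact: IH.
Qed.

(** [smooth_k n.+1] does not literally contain [smooth_k n], and the product rule brings back the
    undifferentiated factors at order [n]; hence the assumption on all orders up to [n]. *)
Lemma smooth_kM n f g : (forall m, (m <= n)%N -> smooth_k m f) ->
  (forall m, (m <= n)%N -> smooth_k m g) -> smooth_k n (fun x => f x * g x).
Proof.
elim: n f g => [|n IH] f g sf sg.
  by move=> x; apply: cvgM; [exact: (sf 0)|exact: (sg 0)].
have [f1 f2] := smooth_k_derive (sf n.+1 (leqnn _)).
have [g1 g2] := smooth_k_derive (sg n.+1 (leqnn _)).
have sf' m : (m <= n)%N -> smooth_k m ('D_e1 f) /\ smooth_k m ('D_e2 f).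
  by move=> mn; case: (sf m.+1 mn).
have sg' m : (m <= n)%N -> smooth_k m ('D_e1 g) /\ smooth_k m ('D_e2 g).
  by move=> mn; case: (sg m.+1 mn).
have h1 x : is_derive x e1 (fun x => f x * g x) (f x * 'D_e1 g x + g x * 'D_e1 f x).
  exact: is_deriveM.
have h2 x : is_derive x e2 (fun x => f x * g x) (f x * 'D_e2 g x + g x * 'D_e2 f x).
  exact: is_deriveM.
apply: (smooth_kS h1 h2).
- apply: smooth_kD; apply: IH => m mn; [exact: (sf m (leqW mn))|by case: (sg' m mn)|
    exact: (sg m (leqW mn))|by case: (sf' m mn)].
- apply: smooth_kD; apply: IH => m mn; [exact: (sf m (leqW mn))|by case: (sg' m mn)|
    exact: (sg m (leqW mn))|by case: (sf' m mn)].
Qed.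

Lemma smoothD f g : smooth f -> smooth g -> smooth (fun x => f x + g x).
Proof. by move=> sf sg n; apply: smooth_kD. Qed.

Lemma smoothM f g : smooth f -> smooth g -> smooth (fun x => f x * g x).
Proof. by move=> sf sg n; apply: smooth_kM => m _. Qed.

Lemma smooth_cst (c : R) : smooth (fun=> c).
Proof.
move=> n; elim: n c => [|n IH] c; first by move=> x; exact: cvg_cst.
have h v (x : R * R) : is_derive x v (fun=> c) 0 by exact: is_derive_cst.
by apply: (smooth_kS (h e1) (h e2)); exact: IH.
Qed.

Lemma is_derive_fst (x v : R * R) : is_derive x v (fst : R * R -> R) v.1.
Proof.
apply/is_derive_lineP => /=.
rewrite (_ : (fun h : R => _) = (fun h : R => v.1 *: h + x.1)); last first.
  by apply/funext => h; rewrite /GRing.scale /= mulrC.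
have h : is_derive (0 : R) 1 (fun h : R => v.1 *: h + x.1) (v.1 *: 1 + 0).
  exact: is_deriveD.
by apply: is_derive_eq h _; rewrite addr0 /GRing.scale /= mulr1.
Qed.

Lemma is_derive_snd (x v : R * R) : is_derive x v (snd : R * R -> R) v.2.
Proof.
apply/is_derive_lineP => /=.
rewrite (_ : (fun h : R => _) = (fun h : R => v.2 *: h + x.2)); last first.
  by apply/funext => h; rewrite /GRing.scale /= mulrC.
have h : is_derive (0 : R) 1 (fun h : R => v.2 *: h + x.2) (v.2 *: 1 + 0).
  exact: is_deriveD.
by apply: is_derive_eq h _; rewrite addr0 /GRing.scale /= mulr1.
Qed.

Lemma smooth_fst : smooth (fst : R * R -> R).
Proof.
case=> [|n]; first by move=> x; exact: cvg_fst.
by apply: (smooth_kS (fun x => is_derive_fst x e1) (fun x => is_derive_fst x e2));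
  exact: smooth_cst.
Qed.

Lemma smooth_snd : smooth (snd : R * R -> R).
Proof.
case=> [|n]; first by move=> x; exact: cvg_snd.
by apply: (smooth_kS (fun x => is_derive_snd x e1) (fun x => is_derive_snd x e2));
  exact: smooth_cst.
Qed.

Lemma smooth_derive1 f : smooth f -> smooth ('D_e1 f).
Proof. by move=> sf n; case: (sf n.+1) => _ []. Qed.

Lemma smooth_derive2 f : smooth f -> smooth ('D_e2 f).
Proof. by move=> sf n; case: (sf n.+1) => _ []. Qed.

Lemma smooth_is_derive f x : smooth f ->
  is_derive x e1 f ('D_e1 f x) /\ is_derive x e2 f ('D_e2 f x).
Proof. by move=> /(_ 1%N)/smooth_k_derive[]. Qed.

(* [F] is the sequence of successive derivatives of [F 0]. *)
Lemma smooth_comp (F : nat -> R -> R) (q : R * R -> R) :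
  (forall k (t : R), is_derive t 1 (F k) (F k.+1 t)) -> smooth q ->
  forall k, smooth (fun x => F k (q x)).
Proof.
move=> dF sq k n.
suff : forall m, (m <= n)%N -> forall k, smooth_k m (fun x => F k (q x)) by exact.
elim: n => [|n IH] m.
  rewrite leqn0 => /eqP -> {}k /= x; apply: continuous_comp; first exact: (sq 0).
  by apply/differentiable_continuous/derivable1_diffP; case: (dF k (q x)).
rewrite leq_eqVlt => /predU1P[-> {}k|]; last by move=> ?; apply: IH.
have h v x dq : is_derive x v q dq ->
    is_derive x v (fun x => F k (q x)) (F k.+1 (q x) * dq).
  by move=> hq; apply: is_derive_comp1.
have h1 x := h _ _ _ (smooth_is_derive x sq).1.
have h2 x := h _ _ _ (smooth_is_derive x sq).2.
apply: (smooth_kS h1 h2).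
- by apply: smooth_kM => j jn; [exact: IH|exact: smooth_derive1].
- by apply: smooth_kM => j jn; [exact: IH|exact: smooth_derive2].
Qed.

End plane_smooth.

(** * Functions flat at the origin, and the basic bump *)

Section flat_function.
Context {R : realType}.

(** [expR x] is the [n]-th power of [expR (x / n)], and the latter exceeds [x / n]. *)
Lemma expr_le_expR n : exists2 C : R, 0 <= C & forall x : R, 0 < x -> x ^+ n <= C * expR x.
Proof.
case: n => [|n].
  exists 1 => // x x0; rewrite expr0 mul1r.
  by have := expR_ge1Dx x; lra.
exists (n.+1%:R ^+ n.+1) => [|x x0]; first by rewrite exprn_ge0.
have -> : expR x = (expR (x / n.+1%:R)) ^+ n.+1.
  by rewrite -expRM_natl -mulr_natl mulrCA mulfV ?mulr1// pnatr_eq0.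
rewrite -exprMn ler_pXn2r ?nnegrE ?mulr_ge0 ?expR_ge0 ?(ltW x0)//.
have := expR_ge1Dx (x / n.+1%:R).
set y := x / n.+1%:R => hy.
have -> : x = n.+1%:R * y by rewrite /y mulrC divfK// pnatr_eq0.
by rewrite ler_wpM2l//; apply: le_trans hy; rewrite lerDr.
Qed.

Lemma horner_le_expR (P : {poly R}) n : exists2 C : R, 0 <= C &
  forall x : R, 0 < x -> `|P.[x]| * x ^+ n <= C * expR x.
Proof.
elim/poly_ind: P n => [|P c IH] n.
  by exists 0 => // x x0; rewrite horner0 normr0 !mul0r.
have [C C0 HC] := IH n.+1; have [D D0 HD] := expr_le_expR n.
exists (C + `|c| * D) => [|x x0]; first by rewrite addr_ge0 ?mulr_ge0.
rewrite hornerMXaddC mulrDl -mulrA.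
apply: le_trans (lerD (HC x x0) (ler_wpM2l (normr_ge0 c) (HD x x0))).
rewrite exprS mulrA -mulrDl ler_wpM2r ?exprn_ge0 ?(ltW x0)//.
by apply: (le_trans (ler_normD _ _)); rewrite normrM (gtr0_norm x0).
Qed.

(** Allowing a polynomial in [t^-1] closes the family under differentiation, so that all derivatives
    of [exp (- 1 / t)] are treated at once. *)
Definition flat (P : {poly R}) (t : R) : R :=
  if 0 < t then P.[t^-1] * expR (- t^-1) else 0.

(** The exponential dominates every polynomial in [t^-1]. The quadratic bound gives the derivative 0
    at the origin, the one point that the formulas on either side leave open. *)
Lemma flat_le_sqr P : exists2 C : R, 0 <= C & forall t, `|flat P t| <= C * t ^+ 2.
Proof.
have [C C0 HC] := horner_le_expR P 2; exists C => // t.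
rewrite /flat; case: ifPn => t0; last by rewrite normr0 mulr_ge0 ?sqr_ge0.
have ti0 : 0 < t^-1 by rewrite invr_gt0.
have := HC _ ti0; rewrite normrM (gtr0_norm (expR_gt0 _)) expRN => h.
rewrite ler_pdivrMr ?expR_gt0// -(ler_pM2r (exprn_gt0 2 ti0)).
apply: (le_trans h); rewrite le_eqVlt; apply/orP; left; apply/eqP.
by field; rewrite gt_eqF.
Qed.

Lemma is_derive_le_sqr (f : R -> R) x C :
  (forall h, `|f (h + x) - f x| <= C * h ^+ 2) -> is_derive x 1 f 0.
Proof.
move=> H.
have L : (fun h : R => h^-1 *: ((f \o shift x) (h *: 1) - f x)) @ 0^' --> (0 : R).
  apply/cvgr0Pnorm_le => e e0; near=> h.
  have h0 : h != 0 by near: h; exact: nbhs_dnbhs_neq.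
  rewrite /= [_%:A]mulr1 normrZ normfV ler_pdivrMl ?normr_gt0//.
  apply: (le_trans (H h)); rewrite -[h ^+ 2]ger0_norm ?sqr_ge0// normrX expr2 mulrA.
  rewrite mulrC ler_wpM2l//.
  have hs : `|h| <= e / (`|C| + 1).
    by near: h; apply: dnbhs0_le; rewrite divr_gt0// ltr_wpDl.
  have := ler_wpM2l (ltW (ltr_wpDl (normr_ge0 C) ltr01)) hs.
  rewrite mulrCA mulfV ?mulr1; last by rewrite gt_eqF// ltr_wpDl.
  by apply: le_trans; rewrite ler_wpM2r// (le_trans (ler_norm C))// lerDl.
by split; [apply/cvg_ex; exists 0|exact/cvg_lim].
Unshelve. all: by end_near. Qed.

Lemma is_derive_flat (P : {poly R}) (t : R) : is_derive t 1 (flat P) (flat ('X^2 * (P - P^`())) t).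
Proof.
have [t0|t0|->] := ltgtP t 0.
- have E : {near t, cst 0 =1 flat P}.
    near=> s; rewrite /= /flat ifF//; apply/negbTE; rewrite -leNgt ltW//.
    by near: s; exact: lt_nbhsl.
  rewrite {2}/flat ifF; last by apply/negbTE; rewrite -leNgt ltW.
  by apply: (near_eq_is_derive E).
- have E : {near t, (fun s => P.[s^-1] * expR (- s^-1)) =1 flat P}.
    near=> s; rewrite /flat ifT//.
    by near: s; exact: lt_nbhsr.
  apply: (near_eq_is_derive E).
  rewrite /flat t0.
  have dv : is_derive t 1 (fun s : R => s^-1) (- t ^- 2).
    have := @is_deriveV _ id t 1 1 (lt0r_neq0 t0) (is_derive_id _ _).
    by move=> h; apply: (is_derive_eq h); rewrite /GRing.scale /= mulr1.
  have dP : is_derive (t^-1) 1 (horner P) P^`().[t^-1].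
    have /derivableP := @derivable_horner R P t^-1.
    by rewrite -derive1E -derivE.
  have d1 := @is_derive1_comp _ _ _ _ _ _ dP dv.
  have dv' : is_derive t 1 (fun s : R => - s^-1) (- - t ^- 2) by exact: is_deriveN.
  have d2 := @is_derive1_comp _ (@expR R) (fun s : R => - s^-1) t _ _ (is_derive_expR (- t^-1)) dv'.
  apply: (is_derive_eq (is_deriveM d1 d2)).
  rewrite !hornerE /GRing.scale /=.
  by rewrite exprVn; ring.
- rewrite {2}/flat ltxx; have [C C0 HC] := flat_le_sqr P.
  apply: (@is_derive_le_sqr _ _ C) => h; rewrite addr0 {2}/flat ltxx subr0.
  exact: HC.
Unshelve. all: by end_near. Qed.

Fixpoint flat_jet (P : {poly R}) (k : nat) : {poly R} :=
  if k is k'.+1 then 'X^2 * (flat_jet P k' - (flat_jet P k')^`()) else P.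

Lemma smooth_flat P (q : R * R -> R) : smooth q -> smooth (fun x => flat P (q x)).
Proof.
move=> sq; apply: (@smooth_comp _ (fun k => flat (flat_jet P k)) q _ sq 0).
by move=> k t; exact: is_derive_flat.
Qed.

Definition bump0 : R -> R := flat 1.

Lemma bump0_ge0 t : 0 <= bump0 t.
Proof. by rewrite /bump0 /flat; case: ifP => // _; rewrite hornerC mul1r expR_ge0. Qed.

Lemma bump0_le1 t : bump0 t <= 1.
Proof.
rewrite /bump0 /flat; case: ifP => // t0; rewrite hornerC mul1r.
by rewrite -expR0 ler_expR oppr_le0 invr_ge0 ltW.
Qed.

Lemma bump0_gt0 t : 0 < t -> 0 < bump0 t.
Proof. by move=> t0; rewrite /bump0 /flat t0 hornerC mul1r expR_gt0. Qed.

Lemma bump0_le0 t : t <= 0 -> bump0 t = 0.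
Proof. by move=> t0; rewrite /bump0 /flat ltNge t0. Qed.

Lemma continuous_flat P : continuous (flat P).
Proof.
move=> t; apply/differentiable_continuous/derivable1_diffP.
by case: (is_derive_flat P t).
Qed.

End flat_function.

(** * Negligible sets of the plane *)

Section null_sets.
Context {R : realType}.
Local Notation T2 := (measurableTypeR R * measurableTypeR R)%type.

Lemma null2S (A B : set (R * R)) : A `<=` B -> lam2.-negligible (B : set T2) ->
  lam2.-negligible (A : set T2).
Proof. exact: (@negligibleS _ T2 R lam2). Qed.

Lemma null2_empty (A : set (R * R)) : (forall x, ~ A x) -> lam2.-negligible (A : set T2).
Proof. by move=> h; apply: (@null2S _ set0) => //; exact: (@negligible_set0 _ T2 R lam2). Qed.

Lemma null2U (A B : set (R * R)) : lam2.-negligible (A : set T2) ->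
  lam2.-negligible (B : set T2) -> lam2.-negligible (A `|` B : set T2).
Proof. exact: (@negligibleU _ T2 R lam2). Qed.

Lemma null2_bigcup (F : nat -> set (R * R)) :
  (forall k, lam2.-negligible (F k : set T2)) -> lam2.-negligible (\bigcup_k F k : set T2).
Proof. exact: (@negligible_bigcup _ T2 R lam2). Qed.

Lemma null2_fin (I : finType) (F : I -> set (R * R)) :
  (forall k, lam2.-negligible (F k : set T2)) ->
  lam2.-negligible ([set x | exists k, F k x] : set T2).
Proof.
move=> h; pose G n : set (R * R) := if insub n is Some k then F (enum_val (k : 'I_#|I|)) else set0.
apply: (@null2S _ (\bigcup_n G n)).
  move=> x [k Fk]; exists (enum_rank k) => //.
  by rewrite /G valK enum_rankK.
apply: null2_bigcup => n; rewrite /G; by case: insubP => [k _ _|_]; [exact: h|apply: null2_empty => x []].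
Qed.

End null_sets.

(** * Test functions: support, bounds, derivatives *)

Section test_functions.
Context {R : realType}.
Local Notation T2 := (measurableTypeR R * measurableTypeR R)%type.

Lemma test_onW (N A : set (R * R)) (psi : R * R -> R) : smooth psi ->
  compact A -> A `<=` N -> (forall x, psi x != 0 -> A x) -> test_on N psi.
Proof.
move=> sp cA AN h; have sA : fsupport psi `<=` A.
  rewrite (closure_id A).1; last exact: compact_closed2.
  exact: closureS.
split=> //; split; last exact: subset_trans sA AN.
by apply: subclosed_compact sA => //; exact: closed_closure.
Qed.

Lemma test_on_sub (N N' : set (R * R)) psi : N `<=` N' -> test_on N psi -> test_on N' psi.
Proof. by move=> NN' [? [? ?]]; split=> //; split=> //; exact: subset_trans NN'. Qed.

Lemma test_out (N : set (R * R)) psi x : test_on N psi -> ~ N x ->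
  \forall y \near x, psi y = 0.
Proof.
move=> [_ [_ sN]] Nx; have : (~` fsupport psi) x by move/sN.
move=> sx; have := open_nbhs_nbhs (conj (closed_openC (@closed_closure _ [set x | psi x != 0])) sx).
apply: filterS => y /= ns; apply/eqP; apply: contrapT => /negP p0; apply: ns.
exact: subset_closure.
Qed.

Lemma test_out0 (N : set (R * R)) psi x : test_on N psi -> ~ N x -> psi x = 0.
Proof. by move=> tp Nx; have := test_out tp Nx; exact: nbhs_singleton. Qed.

Lemma test_continuous (N : set (R * R)) psi : test_on N psi -> continuous psi.
Proof. by case=> /(_ 0%N). Qed.

Lemma test_bounded (N : set (R * R)) psi : test_on N psi ->
  exists2 C : R, 0 <= C & forall x, `|psi x| <= C.
Proof.
move=> tp; have [sp [cp _]] := tp.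
have : compact (psi @` fsupport psi).
  apply: continuous_compact cp; apply: continuous_subspaceT; exact: (sp 0%N).
move/compact_bounded => [M [_ HM]].
exists (`|M| + 1) => [|x]; first by rewrite addr_ge0.
have [sx|sx] := pselect (fsupport psi x).
  by apply: HM; [rewrite ltr_pwDr// ler_norm|exists x].
rewrite (_ : psi x = 0) ?normr0 ?addr_ge0//.
by apply/eqP; apply: contrapT => /negP p0; apply: sx; exact: subset_closure.
Qed.

Lemma test_support (N : set (R * R)) psi : test_on N psi ->
  exists2 r : R, 0 <= r & forall x, ~ ball (0 : R * R) r x -> psi x = 0.
Proof.
move=> [sp [cp _]]; have [M [_ HM]] := compact_bounded cp.
exists (`|M| + 2) => [|x]; first by rewrite addr_ge0.
move=> nb; apply/eqP; apply: contrapT => /negP p0; apply: nb.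
have sx : fsupport psi x by exact: subset_closure.
have := HM (`|M| + 1) _ x sx.
rewrite ltr_pwDr ?ler_norm// => /(_ isT) xM.
rewrite -ball_normE /ball_ /= sub0r normrN; apply: (le_lt_trans xM).
by rewrite ltrD2l ltr1n.
Qed.

Lemma test_derive (N : set (R * R)) psi : test_on N psi ->
  test_on N ('D_e1 psi) /\ test_on N ('D_e2 psi).
Proof.
move=> [sp [cp sN]].
have h v x : 'D_v psi x != 0 -> fsupport psi x.
  move=> d0; apply: contrapT => nx.
  have : \forall y \near x, psi y = cst 0 y.
    have := open_nbhs_nbhs (conj (closed_openC (@closed_closure _ [set x | psi x != 0])) nx).
    apply: filterS => y /= ns; apply/eqP; apply: contrapT => /negP p0; apply: ns.
    exact: subset_closure.
  by move/(near_eq_derive v); rewrite derive_cst => /eqP; apply/negP.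
by split; apply: (test_onW _ cp) => //; [exact: smooth_derive1|exact: h|
  exact: smooth_derive2|exact: h].
Qed.

(* Outside the compact support the product vanishes, whatever [g] is there. *)
Lemma test_mul_integrable (N : set (R * R)) psi (g : R * R -> R) : test_on N psi ->
  (forall K, compact K -> K `<=` N -> lam2.-integrable K (EFin \o g)) ->
  lam2.-integrable setT (EFin \o (fun x => g x * psi x)).
Proof.
move=> tp ig; have [sp [cp sN]] := tp; have [C C0 HC] := test_bounded tp.
have mK : measurable (fsupport psi : set T2).
  by apply: closed_measurable2; exact: compact_closed2.
have := ig _ cp sN.
move/(integrable_mkcond (T := T2) (EFin \o g) mK) => ig'.
pose g' (x : R * R) : R := g x * (x \in fsupport psi)%:R.
have E : (EFin \o g) \_ (fsupport psi) = EFin \o g'.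
  apply/funext => x /=; rewrite patchE /g'; case: ifPn; rewrite /= ?mulr1 ?mulr0//.
rewrite E in ig'.
have := integrableM_bounded ig' (continuous_measurable2 (test_continuous tp)) HC.
apply: eq_integrable => // x _ /=; rewrite /g'; congr EFin.
have [p0|p0] := eqVneq (psi x) 0; first by rewrite p0 !mulr0.
by rewrite mem_set ?mulr1//; exact: subset_closure.
Qed.

End test_functions.

(** * Fundamental lemma of the calculus of variations *)

Section fundamental_lemma.
Context {R : realType}.
Local Notation T1 := (measurableTypeR R).
Local Notation T2 := (T1 * T1)%type.

(** The sets [X] over whose preimage in [S] the integral vanishes form a Dynkin system. With a
    coordinate projection for [h], vanishing is extended in one variable at a time. *)
Lemma dynkin_integral0 d (T : measurableType d) (h : T2 -> T) (S : set T2)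
    (G : set (set T)) (g : R * R -> R) :
  lam2.-integrable setT (EFin \o g) -> measurable S ->
  @measurable_fun _ _ T2 T setT h ->
  @measurable _ T = <<s G >> -> setI_closed G ->
  (\int[lam2]_(x in S) (g x)%:E = 0)%E ->
  (forall X, G X -> \int[lam2]_(x in S `&` h @^-1` X) (g x)%:E = 0)%E ->
  forall X, measurable X -> (\int[lam2]_(x in S `&` h @^-1` X) (g x)%:E = 0)%E.
Proof.
move=> ig mS mh GE GI gS gG X mX.
have mSX (Y : set T) : measurable Y -> measurable (S `&` h @^-1` Y).
  by move=> mY; apply: measurableI => //; rewrite -[X in measurable X]setTI; exact: mh.
have igE E : measurable E -> lam2.-integrable E (EFin \o g).
  by move=> mE; apply: integrableS ig.
apply: (dynkin_induction (P := fun X => \int[lam2]_(x in S `&` h @^-1` X) (g x)%:E = 0)%E GE GI).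
- by rewrite preimage_setT setIT.
- by move=> Y /gG.
- move=> Y mY gY.
  have : (\int[lam2]_(x in S `&` h @^-1` Y `|` S `&` h @^-1` (~` Y)) (g x)%:E = 0)%E.
    by rewrite -setIUr -preimage_setU setUv preimage_setT setIT.
  have mSY := mSX _ mY; have mSCY := mSX _ (measurableC mY).
  rewrite integral_setU_EFin//.
  + by rewrite [X in (X + _)%E](_ : _ = 0%E)// add0e.
  + by apply/measurable_EFinP; exact: measurable_int (igE _ (measurableU _ _ mSY mSCY)).
  + apply/disj_setPS => x [[_ h1] [_ h2]]; exact: h2.
- move=> F mF tF gF.
  rewrite preimage_bigcup setI_bigcupr integral_bigcup.
  + by apply: eseries0 => n _ _; exact: gF.
  + apply/trivIsetP => i j _ _ ij; apply/seteqP; split=> // x [[_ h1] [_ h2]].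
    have E : F i `&` F j = set0 by move/trivIsetP : tF; exact.
    by have : (F i `&` F j) (h x) by []; rewrite E.
  + by move=> k; exact: mSX.
  + by apply: igE; apply: bigcupT_measurable => k; exact: mSX.
- by rewrite -GE.
Qed.

(** Three Dynkin arguments: each coordinate separately, then from rectangles to all measurable sets.
    Each also needs the integral over a whole strip to vanish; since [g] is supported in [ball p r],
    the strip can be cut down to a bounded rectangle. *)
Lemma integral0_of_boxes (g : R * R -> R) (p : R * R) (r : R) :
  lam2.-integrable setT (EFin \o g) ->
  (forall x, ~ ball p r x -> g x = 0) ->
  (forall a b c d, (\int[lam2]_(x in `]a, b[%classic `*` `]c, d[%classic) (g x)%:E = 0)%E) ->
  forall X : set T2, measurable X -> (\int[lam2]_(x in X) (g x)%:E = 0)%E.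
Proof.
move=> ig g0 gb.
have GE : @measurable _ T1 = <<s @RGenOpens.G R >> := RGenOpens.measurableE R.
have GI : setI_closed (@RGenOpens.G R).
  move=> _ _ [a [b ->]] [c [d ->]]; exists (Num.max a c), (Num.min b d).
  apply/seteqP; split=> x /=; rewrite !in_itv /= gt_max lt_min.
    by move=> [/andP[-> ->] /andP[-> ->]].
  by move=> /andP[/andP[-> ->] /andP[-> ->]].
have mI (I J : set T1) : measurable I -> measurable J -> measurable (I `*` J : set T2).
  by move=> *; exact: measurableX.
have strip (S : set T2) : measurable S ->
    (\int[lam2]_(x in S `&` ball p r) (g x)%:E = 0)%E -> (\int[lam2]_(x in S) (g x)%:E = 0)%E.
  move=> mS h; rewrite -[RHS]h [LHS]integral_mkcond [RHS]integral_mkcond.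
  apply: eq_integral => x _; rewrite !patchE.
  have [Sx|Sx] := boolP (x \in S); last by rewrite ifF// in_setI (negbTE Sx).
  rewrite in_setI Sx /=; case: ifPn => //.
  by rewrite notin_setE => /g0 ->.
have mfst : @measurable_fun _ _ T2 T1 setT fst by exact: measurable_fst.
have msnd : @measurable_fun _ _ T2 T1 setT snd by exact: measurable_snd.
have A (J I : set T1) : @RGenOpens.G R J -> measurable I ->
    (\int[lam2]_(x in I `*` J) (g x)%:E = 0)%E.
  move=> [c [d JE]] mI'.
  have mJ : measurable J by rewrite JE; exact: measurable_itv.
  have := @dynkin_integral0 _ T1 fst (setT `*` J) _ g ig (mI _ _ measurableT mJ) mfst GE GI.
  rewrite (_ : I `*` J = setT `*` J `&` fst @^-1` I); last first.
    by apply/seteqP; split=> x /=; [move=> [? ?]; split|move=> [[? ?] ?]; split].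
  apply=> //.
  + apply: strip; first exact: mI.
    rewrite ball2E (_ : _ `&` _ = ball p.1 r `*` (J `&` ball p.2 r)); last first.
      by apply/seteqP; split=> x /=; [move=> [[? ?] [? ?]]; split|move=> [? [? ?]]; split].
    have [e [f ->]] : @RGenOpens.G R (J `&` ball p.2 r).
      by apply: GI; [exists c, d|exists (p.2 - r), (p.2 + r); rewrite ball_itv].
    rewrite ball_itv; exact: gb.
  + move=> _ [a [b ->]].
    rewrite (_ : _ `&` _ = `]a, b[%classic `*` J); last first.
      by apply/seteqP; split=> x /=; [move=> [[? ?] ?]; split|move=> [? ?]; split].
    rewrite JE; exact: gb.
have B (J I : set T1) : measurable J -> measurable I ->
    (\int[lam2]_(x in I `*` J) (g x)%:E = 0)%E.
  move=> mJ mI'.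
  have := @dynkin_integral0 _ T1 snd (I `*` setT) _ g ig (mI _ _ mI' measurableT) msnd GE GI.
  rewrite (_ : I `*` J = I `*` setT `&` snd @^-1` J); last first.
    by apply/seteqP; split=> x /=; [move=> [? ?]; split|move=> [[? ?] ?]; split].
  apply=> //.
  + apply: strip; first exact: mI.
    rewrite ball2E (_ : _ `&` _ = (I `&` ball p.1 r) `*` ball p.2 r); last first.
      by apply/seteqP; split=> x /=; [move=> [[? ?] [? ?]]; split|move=> [[? ?] ?]; split].
    apply: A; first by exists (p.2 - r), (p.2 + r); rewrite ball_itv.
    by apply: measurableI => //; exact: measurable_ball.
  + move=> X GX.
    rewrite (_ : _ `&` _ = I `*` X); last first.
      by apply/seteqP; split=> x /=; [move=> [[? ?] ?]; split|move=> [? ?]; split].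
    exact: A.
move=> X mX.
have := @dynkin_integral0 _ T2 idfun setT [set A `*` B | A in @measurable _ T1 & B in @measurable _ T1]
  g ig measurableT (@measurable_id _ T2 setT) (measurable_prod_measurableType _ _).
rewrite (_ : X = setT `&` idfun @^-1` X); last by rewrite setTI.
apply=> //.
- move=> _ _ [A1 mA1 [B1 mB1 <-]] [A2 mA2 [B2 mB2 <-]].
  exists (A1 `&` A2); first exact: measurableI.
  by exists (B1 `&` B2); [exact: measurableI|rewrite setXI].
- by rewrite -setXTT; exact: B.
- by move=> _ [A1 mA1 [B1 mB1 <-]]; rewrite setTI; exact: B.
Qed.

Lemma Rintegral0_dominated (f_ : nat -> R * R -> R) (f h : R * R -> R) :
  (forall n, measurable_fun (setT : set T2) (f_ n)) ->
  measurable_fun (setT : set T2) f ->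
  lam2.-negligible [set x | ~ (f_ n x @[n --> \oo] --> f x)] ->
  lam2.-integrable setT (EFin \o h) -> (forall n x, `|f_ n x| <= h x) ->
  (forall n, Rintegral lam2 setT (f_ n) = 0) -> Rintegral lam2 setT f = 0.
Proof.
move=> mf_ mf cf ih fh f0.
have if_ n : lam2.-integrable setT (EFin \o f_ n).
  apply: le_integrable ih => //; first exact/measurable_EFinP.
  by move=> x _ /=; rewrite lee_fin (le_trans (fh n x))// ler_norm.
have mf_' n : measurable_fun (setT : set T2) (EFin \o f_ n) by exact/measurable_EFinP.
have mf' : measurable_fun (setT : set T2) (EFin \o f) by exact/measurable_EFinP.
have cf' : {ae lam2, forall x : T2, setT x ->
    (fun n => (EFin \o f_ n) x) n @[n --> \oo] --> (EFin \o f) x}.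
  apply: null2S cf => x /= nx H; apply: nx => _.
  by apply: cvg_EFin => //; exact: nearW.
have fh' : {ae lam2, forall (x : T2) n, setT x -> (`|(EFin \o f_ n) x| <= (EFin \o h) x)%E}.
  by apply: aeW => x n _; rewrite /= lee_fin.
have [_ _] := @dominated_convergence _ T2 R lam2 setT measurableT _ _ _ mf_' mf' cf' ih fh'.
rewrite (_ : [sequence _]_n = cst 0%E); last first.
  apply/funext => n /=; rewrite -[LHS]fineK; last exact: (integrable_fin_num measurableT (if_ n)).
  by have := f0 n; rewrite /Rintegral => ->.
move=> H; rewrite /Rintegral; have := cvg_unique _ H (cvg_cst 0%E).
by move=> ->.
Qed.

Lemma bump0_cvg1 (t : R) : 0 < t -> bump0 (n.+1%:R * t) @[n --> \oo] --> (1 : R).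
Proof.
move=> t0; apply/cvgrPdist_le => e e0.
have et : 0 < e * t by rewrite mulr_gt0.
have := @near_infty_natSinv_lt R (PosNum et); apply: filterS => n /= hn.
have nt0 : 0 < n.+1%:R * t by rewrite mulr_gt0.
rewrite ger0_norm; last by rewrite subr_ge0 bump0_le1.
rewrite /bump0 /flat nt0 hornerC mul1r.
have := expR_ge1Dx (- (n.+1%:R * t)^-1).
have h1 : (n.+1%:R * t)^-1 <= e by rewrite invfM ler_pdivrMr// ltW.
by move=> h2; rewrite lerBlDr; apply: (le_trans _ (lerD h1 h2)); rewrite addrCA subrr addr0.
Qed.

(** Smooth approximation of the indicator of an open box: [bump0 (n * t)] tends to 1 for [t > 0] and
    is 0 for [t <= 0]. *)
Definition box_bump (a b c d : R) (n : nat) (x : R * R) : R :=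
  bump0 (n.+1%:R * (x.1 - a)) * bump0 (n.+1%:R * (b - x.1)) *
  (bump0 (n.+1%:R * (x.2 - c)) * bump0 (n.+1%:R * (d - x.2))).

Lemma box_bump_neq0 a b c d n (x : R * R) : box_bump a b c d n x != 0 ->
  (`]a, b[%classic `*` `]c, d[%classic) x.
Proof.
have z t : bump0 (n.+1%:R * t) != 0 -> 0 < t.
  apply: contraR; rewrite -leNgt => t0; apply/eqP; apply: bump0_le0.
  by rewrite pmulr_rle0.
rewrite !mulf_eq0 !negb_or => /andP[/andP[/z h1 /z h2] /andP[/z h3 /z h4]].
by rewrite /= !in_itv /=; split; apply/andP; split; rewrite -subr_gt0.
Qed.

Lemma smooth_affine1 (k a : R) : smooth (fun x : R * R => k * (x.1 + a)).
Proof. by apply: smoothM; [exact: smooth_cst|apply: smoothD; [exact: smooth_fst|exact: smooth_cst]]. Qed.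

Lemma smooth_affine2 (k a : R) : smooth (fun x : R * R => k * (x.2 + a)).
Proof. by apply: smoothM; [exact: smooth_cst|apply: smoothD; [exact: smooth_snd|exact: smooth_cst]]. Qed.

Lemma box_bump_test (N : set (R * R)) a b c d n :
  `[a, b]%classic `*` `[c, d]%classic `<=` N -> test_on N (box_bump a b c d n).
Proof.
move=> h; apply: (test_onW _ _ h).
- have h1 k e : smooth (fun x : R * R => bump0 (k * (e - x.1))).
    apply: smooth_flat; rewrite (_ : (fun x => _) = (fun x : R * R => (- k) * (x.1 + (- e)))).
      exact: smooth_affine1.
    by apply/funext => x; ring.
  have h2 k e : smooth (fun x : R * R => bump0 (k * (e - x.2))).
    apply: smooth_flat; rewrite (_ : (fun x => _) = (fun x : R * R => (- k) * (x.2 + (- e)))).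
      exact: smooth_affine2.
    by apply/funext => x; ring.
  apply: smoothM; apply: smoothM => //.
    by apply: smooth_flat; exact: smooth_affine1.
  by apply: smooth_flat; exact: smooth_affine2.
- by apply: compact_setX; exact: segment_compact.
- by move=> x /box_bump_neq0[]; rewrite /= !in_itv /=; lra.
Qed.

Lemma box_bump_cvg a b c d (x : R * R) :
  box_bump a b c d n x @[n --> \oo] --> ((x \in `]a, b[%classic `*` `]c, d[%classic)%:R : R).
Proof.
have [xin|xout] := boolP (x \in _).
  move: xin; rewrite inE /= !in_itv /= => -[/andP[h1 h2] /andP[h3 h4]].
  rewrite (_ : true%:R = 1 * 1 * (1 * 1) :> R); last by rewrite !mulr1.
  by apply: cvgM; apply: cvgM; apply: bump0_cvg1; rewrite subr_gt0.
rewrite (_ : (fun n => _) = cst 0); first exact: cvg_cst.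
apply/funext => n /=; apply/eqP; apply: contraNT xout.
by move/box_bump_neq0; rewrite inE.
Qed.

Lemma box_bump_le1 a b c d n x : `|box_bump a b c d n x| <= 1.
Proof.
have h t : `|bump0 t| <= 1 :> R by rewrite ger0_norm ?bump0_ge0 ?bump0_le1.
by rewrite /box_bump !normrM !mulr_ile1// ?mulr_ge0// ?mulr_ile1.
Qed.

Lemma box_integral0 (g : R * R -> R) a b c d :
  lam2.-integrable setT (EFin \o g) ->
  (forall n, Rintegral lam2 setT (fun x => g x * box_bump a b c d n x) = 0) ->
  (\int[lam2]_(x in `]a, b[%classic `*` `]c, d[%classic) (g x)%:E = 0)%E.
Proof.
move=> ig gt0; set B := (_ `*` _).
have mB : measurable (B : set T2) by apply: measurableX; exact: measurable_itv.
have tb n : test_on setT (box_bump a b c d n) by exact: box_bump_test.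
have mb n : measurable_fun (setT : set T2) (box_bump a b c d n).
  exact: continuous_measurable2 (test_continuous (tb n)).
have ib n := integrableM_bounded ig (mb n) (@box_bump_le1 a b c d n).
have mg : measurable_fun (setT : set T2) g by apply/measurable_EFinP; exact: measurable_int ig.
have iB : lam2.-integrable setT (EFin \o (fun x => g x * (x \in B)%:R)).
  apply: (integrableM_bounded (C := 1) ig).
    exact: (measurable_indic (R := R) mB).
  by move=> x; case: (_ \in _); rewrite ?normr1 ?normr0.
have int0 : Rintegral lam2 setT (fun x => g x * (x \in B)%:R) = 0.
  have := @Rintegral0_dominated (fun n x => g x * box_bump a b c d n x) (fun x => g x * (x \in B)%:R) (fun x => `|g x|).
  apply.
  - by move=> n; apply: measurable_funM.
  - by apply/measurable_EFinP; exact: measurable_int iB.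
  - apply: null2_empty => x /=; apply.
    by apply: cvgMl_tmp; exact: box_bump_cvg.
  - exact: integrable_norm.
  - by move=> n x; rewrite normrM ler_piMr// box_bump_le1.
  - exact: gt0.
transitivity (integral lam2 setT (EFin \o (fun x => g x * (x \in B)%:R))); last first.
  rewrite -[LHS]fineK; first by rewrite [X in X%:E]int0.
  exact: (integrable_fin_num measurableT iB).
rewrite integral_mkcond; apply: eq_integral => x _; rewrite patchE /=.
by case: ifPn; rewrite ?mulr1 ?mulr0.
Qed.

Lemma fundamental_lemma_ball (N : set (R * R)) (g : R * R -> R) (p : R * R) r :
  0 < r ->
  (forall K, compact K -> K `<=` N -> lam2.-integrable K (EFin \o g)) ->
  (forall psi, test_on N psi -> Rintegral lam2 setT (fun x => g x * psi x) = 0) ->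
  `[p.1 - r, p.1 + r]%classic `*` `[p.2 - r, p.2 + r]%classic `<=` N ->
  lam2.-negligible (ball p r `&` [set x | g x != 0]).
Proof.
move=> r0 ig gt KN; set K := (_ `*` _) in KN.
have cK : compact K by apply: compact_setX; exact: segment_compact.
have mB : measurable (ball p r : set T2) := measurable_ball2 p r.
have BK : ball p r `<=` K.
  by move=> x /ball2P; rewrite !ltr_norml /K /= !in_itv /=; lra.
have iB : lam2.-integrable (ball p r) (EFin \o g).
  apply: integrableS (ig _ cK KN) => //; apply: closed_measurable2; exact: compact_closed2.
pose g' (x : R * R) : R := g x * (x \in (ball p r : set (R * R)))%:R.
have E : (EFin \o g) \_ (ball p r) = EFin \o g'.
  by apply/funext => x /=; rewrite patchE /g'; case: ifPn; rewrite /= ?mulr1 ?mulr0.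
have ig' : lam2.-integrable setT (EFin \o g').
  by rewrite -E; apply: (@integrable_mkcond _ T2 R lam2 (ball p r) (EFin \o g) mB).1.
have g'0 x : ~ ball p r x -> g' x = 0.
  by move=> nb; rewrite /g' memNset ?mulr0.
have boxes a b c d : (\int[lam2]_(x in `]a, b[%classic `*` `]c, d[%classic) (g' x)%:E = 0)%E.
  (* Since [g'] vanishes off the ball, the box may be clipped to it. The closed clipped box lies in
     [N], so its bumps are admissible test functions. *)
  pose a' := Num.max a (p.1 - r); pose b' := Num.min b (p.1 + r).
  pose c' := Num.max c (p.2 - r); pose d' := Num.min d (p.2 + r).
  have -> : (\int[lam2]_(x in `]a, b[%classic `*` `]c, d[%classic) (g' x)%:E =
     \int[lam2]_(x in `]a', b'[%classic `*` `]c', d'[%classic) (g' x)%:E)%E.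
    rewrite [LHS]integral_mkcond [RHS]integral_mkcond.
    apply: eq_integral => x _; rewrite !patchE.
    have [xb|xb] := pselect (ball p r x); last by rewrite g'0//; case: ifP; case: ifP.
    congr (if _ then _ else _); apply/idP/idP; rewrite !inE /= !in_itv /=;
    move/ball2P: xb; rewrite !ltr_norml !gt_max !lt_min; lra.
  apply: box_integral0 => // n; rewrite -[RHS](gt (box_bump a' b' c' d' n)); last first.
    apply: box_bump_test; apply: subset_trans KN => x; rewrite /K /= !in_itv /=.
    rewrite !ge_max !le_min; lra.
  apply: eq_Rintegral => x _; rewrite /g'.
  have [->|] := eqVneq (box_bump a' b' c' d' n x) 0; first by rewrite !mulr0.
  move/box_bump_neq0 => [h1 h2]; rewrite mem_set ?mulr1//; apply/ball2P.
  by rewrite !ltr_norml; move: h1 h2; rewrite /= !in_itv /= !gt_max !lt_min; lra.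
have r10 : 0 <= r by exact: ltW.
have z := integral0_of_boxes ig' g'0 boxes.
have : ae_eq lam2 (setT : set T2) (EFin \o g') (cst 0%E).
  apply: integral_ae_eq => //.
  by move=> X _ mX; rewrite [LHS]z// integral0.
apply: null2S => x [xb /= gx0] h; have := h I; rewrite /= /g' mem_set// mulr1.
by move=> -[g0]; rewrite g0 eqxx in gx0.
Qed.

Lemma fundamental_lemma (N : set (R * R)) (g : R * R -> R) : open N ->
  (forall K, compact K -> K `<=` N -> lam2.-integrable K (EFin \o g)) ->
  (forall psi, test_on N psi -> Rintegral lam2 setT (fun x => g x * psi x) = 0) ->
  lam2.-negligible (N `&` [set x | g x != 0]).
Proof.
move=> oN ig gt; have [c [e [e0 ce]]] := @countable_ball_base R.
pose K n := `[(c n).1 - e n, (c n).1 + e n]%classic `*` `[(c n).2 - e n, (c n).2 + e n]%classic.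
pose F n : set (R * R) := [set x | K n `<=` N /\ ball (c n) (e n) x /\ g x != 0].
apply: (@null2S _ _ (\bigcup_n F n)).
  move=> x [Nx gx].
  have /nbhs_ballP[r /= r0 rN] : nbhs x N by exact: open_nbhs_nbhs.
  have r30 : 0 < r / 3 by rewrite divr_gt0.
  have [n [xn nr]] := ce _ x (ball_open x (r / 3)) (ballxx _ r30).
  exists n => //; split => // y; rewrite /K /= !in_itv /= => hy; apply: rN.
  have /nr/ball2P hc := ballxx (c n) (e0 n).
  (* A point [y] of the closed square is twice this midpoint minus the centre. Midpoint and centre
     are both within [r / 3] of [x], so [y] is within [r]. *)
  have /nr/ball2P hm : ball (c n) (e n) (((c n).1 + y.1) / 2, ((c n).2 + y.2) / 2).
    apply/ball2P => /=; rewrite !ltr_norml; have := e0 n; lra.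
  apply/ball2P; move: hc hm; rewrite /= !ltr_norml; lra.
apply: null2_bigcup => n; have [KN|KN] := pselect (K n `<=` N); last first.
  by apply: null2_empty => x [].
apply: null2S (fundamental_lemma_ball (e0 n) ig gt KN).
by move=> x [_ []].
Qed.


End fundamental_lemma.

(** * Integration by parts for Lipschitz functions *)

Section integration_by_parts.
Context {R : realType}.
Local Notation T2 := (measurableTypeR R * measurableTypeR R)%type.

Lemma Rint2Z (k : R) (f : R * R -> R) : lam2.-integrable setT (EFin \o f) ->
  Rintegral lam2 setT (fun x => k * f x) = k * Rintegral lam2 setT f.
Proof. by move=> h; exact: (RintegralZl k (@measurableT _ T2) h). Qed.

Lemma Rint2D (f g : R * R -> R) : lam2.-integrable setT (EFin \o f) ->
  lam2.-integrable setT (EFin \o g) -> Rintegral lam2 setT (fun x => f x + g x) =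
  Rintegral lam2 setT f + Rintegral lam2 setT g.
Proof. by move=> h1 h2; exact: (RintegralD (@measurableT _ T2) h1 h2). Qed.

Lemma Rint2B (f g : R * R -> R) : lam2.-integrable setT (EFin \o f) ->
  lam2.-integrable setT (EFin \o g) -> Rintegral lam2 setT (fun x => f x - g x) =
  Rintegral lam2 setT f - Rintegral lam2 setT g.
Proof. by move=> h1 h2; exact: (RintegralB (@measurableT _ T2) h1 h2). Qed.

Lemma norm2_ge (z : R * R) : `|z.1| <= `|z| /\ `|z.2| <= `|z|.
Proof. by split; rewrite prod_normE le_max lexx ?orbT. Qed.

Lemma norm2_le (z : R * R) (c : R) : `|z.1| <= c -> `|z.2| <= c -> `|z| <= c.
Proof. by move=> h1 h2; rewrite prod_normE ge_max h1 h2. Qed.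

Lemma is_derive_line (f : R * R -> R) (df : R * R -> R) (v : R * R) :
  (forall x, is_derive x v f (df x)) -> forall x (t : R),
  is_derive t 1 (fun t => f (x + t *: v)) (df (x + t *: v)).
Proof.
move=> h x t; apply/is_derive_lineP; have /is_derive_lineP := h (x + t *: v).
congr (is_derive _ _ _ _); apply/funext => s; congr f.
by rewrite [s *: 1]mulr1 scalerDl addrCA.
Qed.

Lemma directional_lipschitz (f : R * R -> R) (df : R * R -> R) (v : R * R) C :
  (forall x, is_derive x v f (df x)) -> (forall x, `|df x| <= C) ->
  forall x (t : R), 0 <= t -> `|f (x + t *: v) - f x| <= C * t.
Proof.
move=> h dC x t t0.
have cl : {within `[0, t], continuous (fun t => f (x + t *: v))}.
  apply: continuous_subspaceT => s; apply/differentiable_continuous/derivable1_diffP.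
  by case: (is_derive_line h x s).
have [c _] := MVT_segment t0 (fun s _ => is_derive_line h x s) cl.
rewrite scale0r addr0 subr0 => ->.
by rewrite normrM (ger0_norm t0) ler_wpM2r.
Qed.

Lemma is_derive_seq (V : normedModType R) (f : V -> R) x v d : is_derive x v f d ->
  n.+1%:R * (f (x + n.+1%:R^-1 *: v) - f x) @[n --> \oo] --> d.
Proof.
move=> [h1 h2].
have H : (fun h : R => h^-1 *: ((f \o shift x) (h *: v) - f x)) @ 0^' --> d.
  by rewrite -h2; exact: h1.
have L : (n.+1%:R^-1 : R) @[n --> \oo] --> (0 : R)^'.
  move=> A /= [e /= e0 eA]; have := @near_infty_natSinv_lt R (PosNum e0).
  apply: filterS => n /= hn; apply: eA; last by rewrite gt_eqF// invr_gt0.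
  by rewrite /= sub0r normrN ger0_norm// invr_ge0.
have := cvg_comp _ _ L H.
apply: cvg_trans; apply: near_eq_cvg; apply: nearW => n /=.
by rewrite invrK [_ *: v + x]addrC.
Qed.

(* The difference quotients of [phi * chi] all have integral zero, by
   translation invariance, and dominated convergence passes to the limit. *)
Lemma integration_by_parts (N : set (R * R)) (phi g chi dchi : R * R -> R)
    (v : R * R) (B L : R) : open N ->
  (forall x, N x -> `|phi x| <= B) ->
  (forall x y, N x -> N y -> `|phi x - phi y| <= L * `|x - y|) ->
  lam2.-negligible (N `&` [set x | ~ is_derive x v phi (g x)]) ->
  test_on N chi -> test_on N dchi -> (forall x, is_derive x v chi (dchi x)) ->
  lam2.-integrable setT (EFin \o (fun x => g x * chi x)) ->
  lam2.-integrable setT (EFin \o (fun x => phi x * dchi x)) /\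
  Rintegral lam2 setT (fun x => g x * chi x) =
  - Rintegral lam2 setT (fun x => phi x * dchi x).
Proof.
move=> oN phiB phiL nphi tc td dc igc.
have phic x : N x -> {for x, continuous phi}.
  move=> Nx; apply/cvgrPdist_le => e e0.
  have /nbhs_ballP[d /= d0 dN] : nbhs x N by exact: open_nbhs_nbhs.
  have L1 : 0 < `|L| + 1 by rewrite ltr_wpDl.
  suff : nbhs x [set y | `|phi x - phi y| <= e] by [].
  apply/nbhs_ballP; exists (Num.min d (e / (`|L| + 1))) => /=.
    by rewrite lt_min d0 divr_gt0.
  move=> y yb; have Ny : N y by apply: dN; apply: le_ball yb; rewrite ge_min lexx.
  apply: (le_trans (phiL _ _ Nx Ny)).
  have h : `|x - y| <= e / (`|L| + 1).
    move: yb; rewrite -ball_normE /ball_ /= lt_min => /andP[_ h]; exact: ltW.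
  have := ler_wpM2l (ltW L1) h; rewrite mulrCA mulfV ?mulr1 ?gt_eqF//.
  by apply: le_trans; rewrite ler_wpM2r// (le_trans (ler_norm L))// lerDl.
have cphi th : test_on N th -> continuous (fun x => phi x * th x).
  move=> tt x; have [Nx|Nx] := pselect (N x).
    by apply: cvgM; [exact: phic|exact: (test_continuous tt)].
  rewrite /continuous_at (test_out0 tt Nx) mulr0.
  have := test_out tt Nx => h; apply: cvg_near_cst.
  by move: h; apply: filterS => y ->; rewrite mulr0.
have bphi th : test_on N th -> exists2 C, 0 <= C & forall x, `|phi x * th x| <= C.
  move=> tt; have [C C0 HC] := test_bounded tt; exists (`|B| * C); first by rewrite mulr_ge0.
  move=> x; have [Nx|Nx] := pselect (N x).
    by rewrite normrM ler_pM// (le_trans (phiB _ Nx))// ler_norm.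
  by rewrite (test_out0 tt Nx) mulr0 normr0 mulr_ge0.
have iphi th : test_on N th -> lam2.-integrable setT (EFin \o (fun x => phi x * th x)).
  move=> tt; have [C C0 HC] := bphi _ tt; have [r r0 Hr] := test_support tt.
  apply: (bounded_support_integrable r0 _ HC); first exact: continuous_measurable2 (cphi _ tt).
  by move=> x /Hr ->; rewrite mulr0.
pose F x := phi x * chi x.
pose q n x := n.+1%:R * (F (x + n.+1%:R^-1 *: v) - F x).
have iF : lam2.-integrable setT (EFin \o F) by exact: iphi.
have iFs n := integral_shift (n.+1%:R^-1 *: v) iF.
have mF : measurable_fun (setT : set T2) F by exact: continuous_measurable2 (cphi _ tc).
have iq n : lam2.-integrable setT (EFin \o (fun x => F (x + n.+1%:R^-1 *: v) - F x)).
  have := integrableB measurableT (iFs n).1 iF.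
  by apply: eq_integrable => // x _.
have [Cc Cc0 HCc] := test_bounded tc; have [Cd Cd0 HCd] := test_bounded td.
have [r r0 Hr] := test_support tc.
have chiL x (t : R) : 0 <= t -> `|chi (x + t *: v) - chi x| <= Cd * t.
  exact: directional_lipschitz dc HCd x t.
(* Lipschitz constant of [phi * chi] in the direction [v], with one term for the variation of each
   factor. *)
pose C := `|B| * Cd + `|L| * `|v| * Cc.
have C0 : 0 <= C by rewrite addr_ge0 ?mulr_ge0.
have FL x (t : R) : 0 <= t -> `|F (x + t *: v) - F x| <= C * t.
  move=> t0; have := chiL x t t0; set y := x + t *: v => cl.
  have yx : `|y - x| = t * `|v| by rewrite /y addrAC subrr add0r normrZ ger0_norm.
  (* Nothing is known of [phi] outside [N], but [chi] vanishes there and its own Lipschitz bound is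
     enough. *)
  have [Ny|Ny] := pselect (N y); last first.
    rewrite /F (test_out0 tc Ny) mulr0 sub0r normrN normrM.
    have [Nx|Nx] := pselect (N x); last first.
      by rewrite (test_out0 tc Nx) normr0 mulr0 mulr_ge0.
    rewrite (test_out0 tc Ny) sub0r normrN in cl.
    apply: (@le_trans _ _ (`|B| * (Cd * t))).
      by rewrite ler_pM// (le_trans (phiB _ Nx))// ler_norm.
    by rewrite mulrA ler_wpM2r// lerDl !mulr_ge0.
  have E : F y - F x = phi y * (chi y - chi x) + (phi y - phi x) * chi x.
    by rewrite /F; ring.
  have -> : C * t = `|B| * (Cd * t) + `|L| * (t * `|v|) * Cc by rewrite /C; ring.
  rewrite E; apply: (le_trans (ler_normD _ _)); apply: lerD.
    by rewrite normrM; apply: ler_pM => //; rewrite (le_trans (phiB _ Ny))// ler_norm.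
  have [Nx|Nx] := pselect (N x); last first.
    by rewrite (test_out0 tc Nx) mulr0 normr0 !mulr_ge0.
  rewrite normrM; apply: ler_pM => //; rewrite -yx.
  by rewrite (le_trans (phiL _ _ Ny Nx))// ler_wpM2r// ler_norm.
have nn0 n : 0 <= n.+1%:R^-1 :> R by rewrite invr_ge0.
(* Dominating function: a step [v / n.+1] moves the support of [chi] by at most the norm of [v]. *)
pose h (x : R * R) : R := C * \1_(ball (0 : R * R) (r + `|v|)) x.
have rv0 : 0 <= r + `|v| by rewrite addr_ge0.
have mh : measurable_fun (setT : set T2) h.
  apply: measurable_funM => //; apply: measurable_indic; exact: measurable_ball2.
have ih : lam2.-integrable setT (EFin \o h).
  apply: (@bounded_support_integrable _ h 0 (r + `|v|) C rv0 mh) => x.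
    by rewrite /h normrM ger0_norm// ler_piMr// indicE; case: (_ \in _); rewrite ?normr1 ?normr0.
  by move=> nb; rewrite /h indicE memNset ?mulr0.
have qh n x : `|q n x| <= h x.
  have [xb|xb] := pselect (ball (0 : R * R) (r + `|v|) x).
    rewrite /h indicE mem_set// mulr1 /q normrM ger0_norm//.
    apply: (le_trans (ler_wpM2l (ler0n R n.+1) (FL x _ (nn0 n)))).
    by rewrite mulrCA mulfV ?mulr1// pnatr_eq0.
  have z y : ~ ball (0 : R * R) r y -> F y = 0 by move=> /Hr cy; rewrite /F cy mulr0.
  rewrite /q !z ?subrr ?mulr0 ?normr0.
  - by rewrite /h mulr_ge0// indicE.
  - by move=> xb'; apply: xb; apply: le_ball xb'; rewrite lerDl.
  - rewrite -ball_normE /ball_ /= sub0r normrN => xb'; apply: xb.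
    rewrite -ball_normE /ball_ /= sub0r normrN.
    have -> : x = (x + n.+1%:R^-1 *: v) - n.+1%:R^-1 *: v by rewrite addrK.
    apply: (le_lt_trans (ler_normB _ _)); rewrite ltr_leD//.
    rewrite normrZ ger0_norm// ler_piMl// invf_le1// ler1n//.
have z : Rintegral lam2 setT (fun x => g x * chi x + phi x * dchi x) = 0.
  have := @Rintegral0_dominated R q (fun x => g x * chi x + phi x * dchi x) h.
  apply=> //.
  - move=> n; apply: measurable_funM => //.
    by apply/measurable_EFinP; exact: measurable_int (iq n).
  - apply: measurable_funD; apply/measurable_EFinP.
      exact: measurable_int igc.
    exact: measurable_int (iphi _ td).
  - apply: null2S nphi => x /= nx; apply: contrapT => nn; apply: nx.
    have [Nx|Nx] := pselect (N x).
      have dphi : is_derive x v phi (g x) by apply: contrapT => ?; apply: nn.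
      have := is_derive_seq (is_deriveM dphi (dc x)).
      have -> : g x * chi x + phi x * dchi x = phi x *: dchi x + chi x *: g x.
        by rewrite /GRing.scale /= addrC [chi x * _]mulrC.
      exact.
    rewrite (test_out0 tc Nx) (test_out0 td Nx) !mulr0 addr0.
    have dF : is_derive x v F 0.
      have dcst : is_derive x v (cst 0 : R * R -> R) 0 by exact: is_derive_cst.
      apply: near_eq_is_derive dcst; have := test_out tc Nx.
      by apply: filterS => y cy; rewrite /F cy mulr0.
    exact: is_derive_seq dF.
  - move=> n; rewrite [LHS](Rint2Z _ (iq n)) [X in _ * X](Rint2B (iFs n).1 iF).
    by rewrite (iFs n).2 subrr mulr0.
split; first exact: iphi.
apply/eqP; rewrite -addr_eq0; apply/eqP.
by rewrite -[RHS]z [RHS](Rint2D igc (iphi _ td)).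
Qed.

End integration_by_parts.

(** * One-variable mollifier and its primitive *)

Section mollifier.
Context {R : realType}.

Lemma flat_bounded (P : {poly R}) : exists2 C : R, 0 <= C & forall t, `|flat P t| <= C.
Proof.
have [C C0 HC] := horner_le_expR P 0; exists C => // t.
rewrite /flat; case: ifPn => t0; last by rewrite normr0.
have ti0 : 0 < t^-1 by rewrite invr_gt0.
have := HC _ ti0; rewrite expr0 mulr1 normrM (gtr0_norm (expR_gt0 _)) expRN => h.
by rewrite ler_pdivrMr ?expR_gt0.
Qed.

Lemma lipschitz_of_derive (f df : R -> R) (C : R) : (forall t : R, is_derive t 1 f (df t)) ->
  (forall t, `|df t| <= C) -> forall s t, `|f s - f t| <= C * `|s - t|.
Proof.
move=> h dC; have cf : continuous f.
  by move=> s; apply/differentiable_continuous/derivable1_diffP; case: (h s).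
suff H s t : s <= t -> `|f s - f t| <= C * `|s - t|.
  move=> s t; have [st|/ltW ts] := leP s t; first exact: H.
  by rewrite distrC [`|s - t|]distrC; exact: H.
move=> st; have [c _] := MVT_segment st (fun x _ => h x) (continuous_subspaceT cf).
by move=> E; rewrite distrC E normrM [`|s - t|]distrC ler_wpM2r.
Qed.

Lemma bump0_lipschitz : exists2 L : R, 0 <= L &
  forall s t, `|bump0 s - bump0 t| <= L * `|s - t|.
Proof.
have [C C0 HC] := flat_bounded ('X^2 * (1 - (1 : {poly R})^`())); exists C => //.
by apply: lipschitz_of_derive HC => t; exact: is_derive_flat.
Qed.

(** Supported between 0 and [h] and not normalised; the planar mass [moll_mass] is divided out in
    [potential_exists]. *)
Definition rho (h t : R) : R := bump0 t * bump0 (h - t).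

Lemma rho_ge0 h t : 0 <= rho h t.
Proof. by rewrite mulr_ge0 ?bump0_ge0. Qed.

Lemma rho_le1 h t : rho h t <= 1.
Proof. by rewrite mulr_ile1 ?bump0_ge0 ?bump0_le1. Qed.

Lemma rho_norm_le1 h t : `|rho h t| <= 1.
Proof. by rewrite ger0_norm ?rho_ge0 ?rho_le1. Qed.

Lemma rho_le0 h t : t <= 0 -> rho h t = 0.
Proof. by move=> t0; rewrite /rho bump0_le0 ?mul0r. Qed.

Lemma rho_ge h t : h <= t -> rho h t = 0.
Proof. by move=> t0; rewrite /rho (bump0_le0 (t := h - t)) ?mulr0 ?subr_le0. Qed.

Lemma rho_neq0 h t : rho h t != 0 -> 0 < t < h.
Proof.
move=> r0; rewrite !ltNge; apply/andP; split; apply: contra r0 => H; apply/eqP.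
  exact: rho_le0.
exact: rho_ge.
Qed.

Lemma rho_lipschitz h : exists2 L : R, 0 <= L &
  forall s t, `|rho h s - rho h t| <= L * `|s - t|.
Proof.
have [L L0 HL] := bump0_lipschitz; exists (L + L); first by rewrite addr_ge0.
move=> s t; have -> : rho h s - rho h t =
    (bump0 s - bump0 t) * bump0 (h - s) + bump0 t * (bump0 (h - s) - bump0 (h - t)).
  by rewrite /rho; ring.
apply: (le_trans (ler_normD _ _)); rewrite [leRHS]mulrDl; apply: lerD; rewrite normrM.
  apply: (le_trans _ (HL s t)); rewrite ler_piMr// ger0_norm ?bump0_ge0 ?bump0_le1//.
have -> : `|s - t| = `|(h - s) - (h - t)|.
  by rewrite distrC; congr `|_|; ring.
apply: (le_trans _ (HL _ _)); rewrite ler_piMl// ger0_norm ?bump0_ge0 ?bump0_le1//.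
Qed.

Lemma continuous_rho h : continuous (rho h).
Proof.
move=> t; apply: cvgM; first exact: continuous_flat.
apply: (@continuous_comp _ _ _ (fun t => h - t) bump0).
  by apply: cvgB; [exact: cvg_cst|].
exact: continuous_flat.
Qed.

Lemma rho_integrable h : lebesgue_measure.-integrable setT (EFin \o rho h).
Proof.
have mr : measurable_fun setT (rho h) := continuous_measurable_fun (continuous_rho (h := h)).
have -> : EFin \o rho h = (EFin \o rho h) \_ `[0, `|h|].
  apply/funext => x /=; rewrite patchE; case: ifPn => //.
  rewrite notin_setE /= in_itv /= => xh; congr EFin; apply/eqP; apply: contrapT => /negP/rho_neq0.
  move=> /andP[x0 /ltW xh']; apply: xh; rewrite (ltW x0) /=; apply: (le_trans xh'); exact: ler_norm.
apply: (@integrable_mkcond _ (measurableTypeR R) R lebesgue_measure `[0, `|h|]%classic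
  (EFin \o rho h) (measurable_itv _)).1.
apply: measurable_bounded_integrable; first exact: measurable_itv.
- refine (eq_ind_r (fun x => (x < +oo)%E) _ (lebesgue_measure_itv `[0, `|h|])).
  by rewrite /=; case: ifP => _; rewrite -?EFinB ltry.
- exact: measurable_funTS.
- exists 1; split; first exact: num_real.
  by move=> M M1 x _ /=; apply: (le_trans (rho_norm_le1 _ _)); exact: ltW.
Qed.

(** It vanishes up to 0, is nondecreasing, and is constant from [h] on. The difference of two
    ordered translates is thus a nonnegative function of compact support, from which the curl test
    functions are built. *)
Definition rho_prim (h x : R) : R := Rintegral lebesgue_measure `]-oo, x] (rho h).

Lemma is_derive_rho_prim h (t : R) : is_derive t 1 (rho_prim h) (rho h t).
Proof.
have := @continuous_FTC1 R (rho h) -oo%O t (t + 1) _ _ _ _.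
move=> /(_ _ _ _ _)[||||d1 d2].
- by rewrite ltrDl.
- by apply: integrableS (rho_integrable h).
- exact: ltNyr.
- exact: continuous_rho.
- split; first exact: d1.
  by rewrite -derive1E d2.
Qed.

Lemma rho_prim_le0 h t : t <= 0 -> rho_prim h t = 0.
Proof.
move=> t0; rewrite /rho_prim; have -> : 0 = Rintegral lebesgue_measure `]-oo, t] (cst (0 : R)).
  by rewrite Rintegral_cst// mul0r.
apply: eq_Rintegral => x; rewrite inE /= in_itv /= => xt.
exact: (rho_le0 h (le_trans xt t0)).
Qed.

Lemma rho_prim_ge h t : h <= t -> rho_prim h t = rho_prim h h.
Proof.
move=> ht; have cP : continuous (rho_prim h).
  by move=> s; apply/differentiable_continuous/derivable1_diffP; case: (is_derive_rho_prim h s).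
have [c] := MVT_segment ht (fun x _ => is_derive_rho_prim h x) (continuous_subspaceT cP).
rewrite in_itv /= => /andP[hc _]; rewrite rho_ge// mul0r => /eqP.
by rewrite subr_eq0 => /eqP.
Qed.

Lemma continuous_rho_prim h : continuous (rho_prim h).
Proof.
by move=> s; apply/differentiable_continuous/derivable1_diffP; case: (is_derive_rho_prim h s).
Qed.

Lemma rho_prim_ndecr h s t : s <= t -> rho_prim h s <= rho_prim h t.
Proof.
move=> st; have [c _ E] := MVT_segment st (fun x _ => is_derive_rho_prim h x)
  (continuous_subspaceT (continuous_rho_prim (h := h))).
by rewrite -subr_ge0 E mulr_ge0 ?rho_ge0 ?subr_ge0.
Qed.

Lemma rho_prim_bounded h : exists2 C : R, 0 <= C & forall t, `|rho_prim h t| <= C.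
Proof.
exists (rho_prim h `|h|) => [|t].
  by rewrite -(rho_prim_le0 h (lexx 0)) rho_prim_ndecr.
have P0 : 0 <= rho_prim h t.
  have [t0|t0] := leP t 0; first by rewrite rho_prim_le0.
  by rewrite -(rho_prim_le0 h (lexx 0)) rho_prim_ndecr// ltW.
rewrite ger0_norm//; have [th|th] := leP t `|h|; first exact: rho_prim_ndecr.
have ht : h <= t by apply: (le_trans (ler_norm h)); exact: ltW.
by rewrite (rho_prim_ge ht) (rho_prim_ge (ler_norm h)).
Qed.

(** Mean value theorem for the primitive and Lipschitz bound for [rho]. The constant does not depend
    on the point, which makes the expansion of the mollified potential uniform. *)
Lemma rho_prim_taylor h : exists2 L : R, 0 <= L &
  forall a t, `|rho_prim h a - rho_prim h (a - t) - t * rho h a| <= L * t ^+ 2.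
Proof.
have [L L0 HL] := rho_lipschitz h; exists L => // a t.
have cP := continuous_subspaceT (continuous_rho_prim (h := h)).
have H c : `|c - a| <= `|t| -> `|rho h c * t - t * rho h a| <= L * t ^+ 2.
  move=> ca; have -> : rho h c * t - t * rho h a = t * (rho h c - rho h a) by ring.
  rewrite normrM -[t ^+ 2]ger0_norm ?sqr_ge0// normrX expr2 mulrCA ler_wpM2l//.
  by apply: (le_trans (HL _ _)); rewrite ler_wpM2l.
have [t0|t0] := leP 0 t.
  have le : a - t <= a by rewrite gerBl.
  have [c] := MVT_segment le (fun x _ => is_derive_rho_prim h x) (cP _).
  rewrite in_itv /= => /andP[c1 c2] ->.
  rewrite opprB addrCA subrr addr0; apply: H; rewrite distrC !ger0_norm ?subr_ge0//.
  by rewrite lerBlDr addrC -lerBlDr.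
have le : a <= a - t by rewrite lerDl oppr_ge0 ltW.
have [c] := MVT_segment le (fun x _ => is_derive_rho_prim h x) (cP _).
rewrite in_itv /= => /andP[c1 c2] E.
have -> : rho_prim h a - rho_prim h (a - t) = rho h c * t.
  by rewrite -opprB E; ring.
apply: H; rewrite ger0_norm ?subr_ge0// ltr0_norm// lerBlDr addrC.
by [].
Qed.

End mollifier.

(** * Monotonicity from local estimates *)

Section straddle.
Context {R : realType}.

Lemma segment_norm_lt (a b t r : R) : `|a| < r -> `|a + b| < r -> 0 <= t <= 1 ->
  `|a + t * b| < r.
Proof.
move=> ar br /andP[t0 t1]; have -> : a + t * b = (1 - t) * a + t * (a + b) by ring.
have mr : Num.max `|a| `|a + b| < r by rewrite gt_max ar br.
apply: le_lt_trans mr; apply: (le_trans (ler_normD _ _)).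
have u0 : 0 <= 1 - t by rewrite subr_ge0.
have -> : Num.max `|a| `|a + b| = (1 - t) * Num.max `|a| `|a + b| + t * Num.max `|a| `|a + b| by ring.
by rewrite !normrM (ger0_norm t0) (ger0_norm u0) lerD// ler_wpM2l// le_max lexx ?orbT.
Qed.

(** Supremum argument on the set of [t] with [k 0 <= k t + e * t]: the left estimate shows that the
    supremum belongs to it, the right one that it equals 1. It stands in for the sign of a
    derivative: no differentiability of [k] is assumed, only that the slopes seen from each point
    are nearly nonnegative. *)
Lemma straddle (k : R -> R) :
  (forall t : R, 0 <= t <= 1 -> forall e : R, 0 < e -> exists2 d : R, 0 < d &
     forall s : R, 0 <= s <= 1 -> `|s - t| < d ->
       (t <= s -> k t - e * (s - t) <= k s) /\ (s <= t -> k s - e * (t - s) <= k t)) ->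
  k 0 <= k 1.
Proof.
move=> H; apply/ler_addgt0Pr => e e0.
pose S := [set t : R | 0 <= t <= 1 /\ k 0 <= k t + e * t].
have S0 : S 0 by split; rewrite ?lexx ?ler01// mulr0 addr0.
have hS : has_sup S by split; [exists 0|exists 1 => t [/andP[]]].
have s01 : 0 <= sup S <= 1.
  apply/andP; split; first exact: (ub_le_sup hS.2 S0).
  by apply: ge_sup; [exists 0|move=> t [/andP[]]].
have [d d0 Hd] := H _ s01 _ e0.
have [t [/andP[t0 t1] kt] dt] := sup_adherent d0 hS.
have ts : t <= sup S by apply: (ub_le_sup hS.2); split=> //; rewrite t0.
have ks : k 0 <= k (sup S) + e * sup S.
  have t01 : 0 <= t <= 1 by rewrite t0.
  have td : `|t - sup S| < d by rewrite ltr_norml; apply/andP; split; lra.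
  have [_ /(_ ts)] := Hd t t01 td; nra.
have [s1|s1] := eqVneq (sup S) 1; first by move: ks; rewrite s1 mulr1.
have s1' : sup S < 1 by rewrite lt_neqAle s1; case/andP: s01.
pose u := Num.min 1 (sup S + d / 2).
have su : sup S < u by rewrite lt_min s1' ltrDl divr_gt0.
have : S u.
  have u01 : 0 <= u <= 1.
    by rewrite ge_min lexx /= andbT; apply: (le_trans _ (ltW su)); case/andP: s01.
  have uS : u <= sup S + d / 2 by rewrite /u ge_min lexx orbT.
  have ud : `|u - sup S| < d by rewrite gtr0_norm ?subr_gt0//; lra.
  split=> //; have [/(_ (ltW su)) + _] := Hd u u01 ud; nra.
by move/(ub_le_sup hS.2); rewrite leNgt su.
Qed.

End straddle.

(** * Vanishing and comparison of planar integrals *)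

Section continuous_integral.
Context {R : realType}.
Local Notation T2 := (measurableTypeR R * measurableTypeR R)%type.

Lemma null2_open (O : set (R * R)) : open O -> lam2.-negligible (O : set T2) -> O = set0.
Proof.
move=> oO [B [mB B0 OB]]; apply/seteqP; split=> // x Ox.
have /nbhs_ballP[r /= r0 rO] : nbhs x O by exact: open_nbhs_nbhs.
have : (lam2 (ball x r) <= lam2 B)%E.
  apply: (le_measure (lam2 : {measure set T2 -> \bar R})); rewrite ?inE//.
    exact: measurable_ball2.
  exact: subset_trans rO OB.
rewrite (lam2_ball x (ltW r0)) [leRHS]B0.
by rewrite lee_fin leNgt mulr_gt0// mulrn_wgt0.
Qed.

(** The set where [f] does not vanish is open and negligible, hence empty. *)
Lemma continuous_Rintegral_eq0 (f : R * R -> R) : continuous f ->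
  lam2.-integrable setT (EFin \o f) -> (forall x, 0 <= f x) ->
  Rintegral lam2 setT f <= 0 -> forall x, f x = 0.
Proof.
move=> cf if_ f0 int0 x.
have Z : (\int[lam2]_x `|(EFin \o f) x| = 0)%E.
  transitivity (\int[lam2]_x (EFin \o f) x)%E.
    by apply: eq_integral => y _ /=; rewrite ger0_norm.
  rewrite -[LHS]fineK; last exact: (integrable_fin_num measurableT if_).
  congr EFin; apply/eqP; rewrite eq_le int0 /=.
  by apply: Rintegral_ge0 => y _.
have N : lam2.-negligible ([set x | f x != 0] : set T2).
  have := (@ae_eq_integral_abs _ T2 R lam2 setT measurableT (EFin \o f) (measurable_int _ if_)).1 Z.
  by apply: null2S => y /= fy h; have := h I => /= -[fy0]; rewrite fy0 eqxx in fy.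
apply/eqP; apply: contrapT => /negP fx.
have oO : open [set x | f x != 0].
  have -> : [set x | f x != 0] = f @^-1` (~` [set 0]) by apply/seteqP; split=> y /= /eqP.
  by move/continuousP: cf; apply; exact/closed_openC/closed_eq.
by have : [set x | f x != 0] x by []; rewrite (null2_open oO N).
Qed.

Lemma ae_le_Rintegral2 (f g : R * R -> R) : lam2.-integrable setT (EFin \o f) ->
  lam2.-integrable setT (EFin \o g) ->
  lam2.-negligible ([set x | ~ (f x <= g x)] : set T2) ->
  Rintegral lam2 setT f <= Rintegral lam2 setT g.
Proof.
move=> if_ ig n.
(* The minimum is below [g] everywhere and equals [f] almost everywhere. *)
pose m x := Num.min (f x) (g x).
have im : lam2.-integrable setT (EFin \o m).
  pose d x := Num.max 0 (f x - g x).
  have E : EFin \o m = (fun x => (EFin \o f) x - (EFin \o d) x)%E.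
    apply/funext => x /=; rewrite -EFinB; congr EFin.
    by rewrite /m /d minEle maxEle subr_ge0; have [a|a] := leP (f x) (g x); have [b|b] := leP (g x) (f x); lra.
  rewrite E; apply: integrableB => //.
  have id_ := integrableB (@measurableT _ T2) if_ ig.
  apply: (le_integrable (@measurableT _ T2) _ _ id_).
    apply/measurable_EFinP; apply: measurable_maxr => //.
    by apply: measurable_funB; apply/measurable_EFinP; [exact: measurable_int if_|exact: measurable_int ig].
  move=> x _ /=; rewrite lee_fin /d maxEle; case: ifP => // _.
  by rewrite normr0.
have -> : Rintegral lam2 setT f = Rintegral lam2 setT m.
  rewrite /Rintegral; congr fine; apply: ae_eq_integral => //.
  - exact: measurable_int if_.
  - exact: measurable_int im.
  - apply: null2S n => x /= nx fg; apply: nx => _; congr EFin.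
    by rewrite /m; case: leP fg.
apply: (@le_Rintegral _ T2 R lam2 setT m g (@measurableT _ T2) im ig) => x _.
by rewrite /m ge_min lexx orbT.
Qed.

End continuous_integral.

(** * Pairing of an integrable function with bounded continuous kernels *)

Section kernels.
Context {R : realType}.
Local Notation T2 := (measurableTypeR R * measurableTypeR R)%type.
Implicit Types (g k : R * R -> R).

Definition bkernel k := continuous k /\ exists C : R, forall x, `|k x| <= C.

Definition pair2 g k : R := Rintegral lam2 setT (fun x => g x * k x).

Definition tens (a b : R -> R) (x : R * R) : R := a x.1 * b x.2.

Lemma bkernel_integrable g k : lam2.-integrable setT (EFin \o g) -> bkernel k ->
  lam2.-integrable setT (EFin \o (fun x => g x * k x)).
Proof.
by move=> ig [ck [C kC]]; exact: integrableM_bounded ig (continuous_measurable2 ck) kC.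
Qed.

Lemma bkernelD k l : bkernel k -> bkernel l -> bkernel (fun x => k x + l x).
Proof.
move=> [ck [C kC]] [cl [D lD]]; split; first by move=> x; apply: cvgD; [exact: ck|exact: cl].
by exists (C + D) => x; rewrite (le_trans (ler_normD _ _))// lerD.
Qed.

Lemma bkernelZ (c : R) k : bkernel k -> bkernel (fun x => c * k x).
Proof.
move=> [ck [C kC]]; split; first by move=> x; apply: cvgM; [exact: cvg_cst|exact: ck].
by exists (`|c| * C) => x; rewrite normrM ler_wpM2l.
Qed.

Lemma bkernelB k l : bkernel k -> bkernel l -> bkernel (fun x => k x - l x).
Proof.
move=> bk bl; have := bkernelD bk (bkernelZ (-1) bl).
by congr bkernel; apply/funext => x; rewrite mulN1r.
Qed.

Lemma pair2D g k l : lam2.-integrable setT (EFin \o g) -> bkernel k -> bkernel l ->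
  pair2 g (fun x => k x + l x) = pair2 g k + pair2 g l.
Proof.
move=> ig bk bl; rewrite /pair2 -[RHS](Rint2D (bkernel_integrable ig bk) (bkernel_integrable ig bl)).
by apply: eq_Rintegral => x _; rewrite mulrDr.
Qed.

Lemma pair2Z g (c : R) k : lam2.-integrable setT (EFin \o g) -> bkernel k ->
  pair2 g (fun x => c * k x) = c * pair2 g k.
Proof.
move=> ig bk; rewrite /pair2 -[RHS](Rint2Z c (bkernel_integrable ig bk)).
by apply: eq_Rintegral => x _; rewrite mulrCA.
Qed.

Lemma pair2B g k l : lam2.-integrable setT (EFin \o g) -> bkernel k -> bkernel l ->
  pair2 g (fun x => k x - l x) = pair2 g k - pair2 g l.
Proof.
move=> ig bk bl; rewrite /pair2 -[RHS](Rint2B (bkernel_integrable ig bk) (bkernel_integrable ig bl)).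
by apply: eq_Rintegral => x _; rewrite mulrBr.
Qed.

Lemma pair2_le g k (C : R) : lam2.-integrable setT (EFin \o g) -> bkernel k ->
  (forall x, `|k x| <= C) -> `|pair2 g k| <= C * Rintegral lam2 setT (fun x => `|g x|).
Proof.
move=> ig bk kC; have igk := bkernel_integrable ig bk.
have ign : lam2.-integrable setT (EFin \o (fun x => `|g x|)) by exact: integrable_norm.
apply: (le_trans (le_normr_Rintegral (@measurableT _ T2) igk)).
rewrite -[leRHS](Rint2Z C ign).
apply: (@le_Rintegral _ T2 R lam2 setT (fun x => `|g x * k x|) (fun x => C * `|g x|) (@measurableT _ T2)).
- exact: integrable_norm.
- exact: (integrableZl (@measurableT _ T2) C ign).
- by move=> x _; rewrite normrM mulrC ler_wpM2r.
Qed.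

Lemma bkernel_tens (a b : R -> R) (A B : R) : continuous a -> continuous b ->
  (forall s, `|a s| <= A) -> (forall t, `|b t| <= B) -> bkernel (tens a b).
Proof.
move=> ca cb aA bB; split.
  move=> x; apply: cvgM; apply: continuous_comp; [exact: cvg_fst|exact: ca|exact: cvg_snd|exact: cb].
exists (A * B) => x; rewrite normrM ler_pM//.
Qed.

End kernels.

(** * Real identities and inequalities for the estimates of the potential *)

Section linear_identities.
Context {R : realType}.
Implicit Types A B C D E F m k e s t : R.

Lemma path_identity A B C D E F : C - A = D - E -> A + B + (F + D) - (C + F) = B + E.
Proof. by lra. Qed.

Lemma taylor_regroup A B m k e s t :
  A + B - t * (e * m + s * k) = A - t * e * m + (B - t * s * k).
Proof. by ring. Qed.

Lemma slope_le A B m : A - m * 0 <= B - m * 1 -> m <= B - A.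
Proof. by lra. Qed.

Lemma straddle_right A B m D k e s t : t <= s -> m <= D -> k <= e * (s - t) ->
  - k <= A - B - (s - t) * D -> B - m * t - e * (s - t) <= A - m * s.
Proof.
move=> ts mD; have : 0 <= (s - t) * (D - m) by rewrite mulr_ge0// subr_ge0.
by lra.
Qed.

Lemma straddle_left A B m D k e s t : s <= t -> m <= D -> k <= e * (t - s) ->
  A - B - (s - t) * D <= k -> A - m * s - e * (t - s) <= B - m * t.
Proof.
move=> ts mD; have : 0 <= (t - s) * (D - m) by rewrite mulr_ge0// subr_ge0.
by lra.
Qed.

End linear_identities.

(** * Potential of the mollified field *)

Section potential_h.
Context {R : realType}.
Local Notation T2 := (measurableTypeR R * measurableTypeR R)%type.
Variables (g1 g2 : R * R -> R) (p : R * R) (r h : R).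
Hypotheses (ig1 : lam2.-integrable setT (EFin \o g1))
  (ig2 : lam2.-integrable setT (EFin \o g2)) (h0 : 0 < h) (hr : h < r).
Hypothesis curl : forall psi, test_on (ball p (2 * r)) psi -> (forall x, 0 <= psi x) ->
  pair2 g1 ('D_e2 psi) = pair2 g2 ('D_e1 psi).

Let P (a s : R) : R := rho_prim h (s - a).
Let Q (a s : R) : R := rho h (s - a).
(** The integral of [Q c] over [c] from [a] to [b]. Pairing with [tens (dP a b) (Q c)] therefore
    integrates the mollified function along a horizontal segment at height [c]. *)
Let dP (a b s : R) : R := P a s - P b s.
Let dQ (a b s : R) : R := Q a s - Q b s.

Let cshift (f : R -> R) a : continuous f -> continuous (fun s => f (s - a)).
Proof.
move=> cf s; apply: (@continuous_comp _ _ _ (fun s => s - a) f); last exact: cf.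
by apply: cvgB; [|exact: cvg_cst].
Qed.

Let cP a : continuous (P a).
Proof. by apply: cshift; exact: continuous_rho_prim. Qed.

Let cQ a : continuous (Q a).
Proof. by apply: cshift; exact: continuous_rho. Qed.

Let cdP a b : continuous (dP a b).
Proof. by move=> s; apply: cvgB; exact: cP. Qed.

Let cdQ a b : continuous (dQ a b).
Proof. by move=> s; apply: cvgB; exact: cQ. Qed.

Let bQ a s : `|Q a s| <= 1.
Proof. exact: rho_norm_le1. Qed.

Let bdQ a b s : `|dQ a b s| <= 2.
Proof. by apply: (le_trans (ler_normB _ _)); rewrite -[leRHS]/(1 + 1); apply: lerD; exact: bQ. Qed.

Let bdP : exists C : R, forall a b s, `|dP a b s| <= C.
Proof.
have [C C0 HC] := rho_prim_bounded h; exists (C + C) => a b s.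
by apply: (le_trans (ler_normB _ _)); apply: lerD; exact: HC.
Qed.

Let bk_PQ a b c : bkernel (tens (dP a b) (Q c)).
Proof. by have [C HC] := bdP; apply: bkernel_tens (HC a b) (bQ c). Qed.

Let bk_QP a c d : bkernel (tens (Q a) (dP c d)).
Proof. by have [C HC] := bdP; apply: bkernel_tens (bQ a) (HC c d). Qed.

Let bk_QQ a b : bkernel (tens (Q a) (Q b)).
Proof. exact: bkernel_tens (bQ a) (bQ b). Qed.

Let smooth_Q1 a : smooth (fun x : R * R => Q a x.1).
Proof.
apply: smoothM.
  apply: smooth_flat; apply: smoothD; [exact: smooth_fst|exact: smooth_cst].
apply: smooth_flat.
rewrite (_ : (fun x => _) = (fun x : R * R => h + (-1) * (x.1 + (- a)))).
  by apply: smoothD; [exact: smooth_cst|exact: smooth_affine1].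
by apply/funext => x; rewrite mulN1r.
Qed.

Let smooth_Q2 a : smooth (fun x : R * R => Q a x.2).
Proof.
apply: smoothM.
  apply: smooth_flat; apply: smoothD; [exact: smooth_snd|exact: smooth_cst].
apply: smooth_flat.
rewrite (_ : (fun x => _) = (fun x : R * R => h + (-1) * (x.2 + (- a)))).
  by apply: smoothD; [exact: smooth_cst|exact: smooth_affine2].
by apply/funext => x; rewrite mulN1r.
Qed.

Let dP1 a (x v : R * R) : is_derive x v (fun x : R * R => P a x.1) (Q a x.1 * v.1).
Proof.
apply: (is_derive_comp1 (q := fun x : R * R => x.1 - a) (F := rho_prim h)).
  have := is_deriveB (is_derive_fst x v) (is_derive_cst a x v).
  by rewrite subr0.
exact: is_derive_rho_prim.
Qed.

Let dP2 a (x v : R * R) : is_derive x v (fun x : R * R => P a x.2) (Q a x.2 * v.2).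
Proof.
apply: (is_derive_comp1 (q := fun x : R * R => x.2 - a) (F := rho_prim h)).
  have := is_deriveB (is_derive_snd x v) (is_derive_cst a x v).
  by rewrite subr0.
exact: is_derive_rho_prim.
Qed.

Let smooth_P1 a : smooth (fun x : R * R => P a x.1).
Proof.
case=> [|n].
  by move=> x; apply: (@continuous_comp _ _ _ fst (P a)); [exact: cvg_fst|exact: cP].
apply: (smooth_kS (fun x => dP1 a x e1) (fun x => dP1 a x e2)).
  by apply: smoothM; [exact: smooth_Q1|exact: smooth_cst].
by apply: smoothM; [exact: smooth_Q1|exact: smooth_cst].
Qed.

Let smooth_P2 a : smooth (fun x : R * R => P a x.2).
Proof.
case=> [|n].
  by move=> x; apply: (@continuous_comp _ _ _ snd (P a)); [exact: cvg_snd|exact: cP].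
apply: (smooth_kS (fun x => dP2 a x e1) (fun x => dP2 a x e2)).
  by apply: smoothM; [exact: smooth_Q2|exact: smooth_cst].
by apply: smoothM; [exact: smooth_Q2|exact: smooth_cst].
Qed.

Let smoothB (u w : R * R -> R) : smooth u -> smooth w -> smooth (fun x => u x - w x).
Proof.
move=> su sw; have := smoothD su (smoothM (smooth_cst (-1)) sw).
by congr smooth; apply/funext => x; rewrite mulN1r.
Qed.

Let PP a b c d := tens (dP a b) (dP c d).

Let dPP a b c d (x v : R * R) : is_derive x v (PP a b c d)
  (dP a b x.1 * (dQ c d x.2 * v.2) + dP c d x.2 * (dQ a b x.1 * v.1)).
Proof.
have h1 := is_deriveB (dP1 a x v) (dP1 b x v).
have h2 := is_deriveB (dP2 c x v) (dP2 d x v).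
have := is_deriveM h1 h2.
by rewrite /GRing.scale /= -!mulrBl.
Qed.

Let dPP1 a b c d : 'D_e1 (PP a b c d) = tens (dQ a b) (dP c d).
Proof.
apply/funext => x; have [_ ->] := dPP a b c d x e1.
by rewrite /= /tens; ring.
Qed.

Let dPP2 a b c d : 'D_e2 (PP a b c d) = tens (dP a b) (dQ c d).
Proof.
apply/funext => x; have [_ ->] := dPP a b c d x e2.
by rewrite /= /tens; ring.
Qed.

Let dP_neq0 a b s : a <= b -> dP a b s != 0 -> a <= s <= b + h.
Proof.
move=> ab; apply: contraR; rewrite negb_and -!ltNge => /orP[sa|sb]; apply/eqP.
  by rewrite /dP /P !rho_prim_le0 ?subrr// subr_le0 ltW// (lt_le_trans sa).
by rewrite /dP /P (rho_prim_ge (t := s - a)) ?(rho_prim_ge (t := s - b)) ?subrr//; lra.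
Qed.

(** The curl identity is granted for nonnegative test functions; [PP a b c d] is one under these
    orderings. Its support lies in [[a, b + h]] times [[c, d + h]], inside [ball p (2 * r)] because
    [h < r]. *)
Let curl_le a b c d : `|a - p.1| < r -> `|b - p.1| < r -> `|c - p.2| < r -> `|d - p.2| < r ->
  a <= b -> c <= d -> pair2 g1 (tens (dP a b) (dQ c d)) = pair2 g2 (tens (dQ a b) (dP c d)).
Proof.
move=> ha hb hc hd ab cd; rewrite -dPP1 -dPP2; apply: curl.
  apply: (@test_onW _ _ (`[a, b + h]%classic `*` `[c, d + h]%classic)).
  - by apply: smoothM; apply: smoothB.
  - by apply: compact_setX; exact: segment_compact.
  - move=> x; rewrite /= !in_itv /= => -[h1 h2]; apply/ball2P.
    by move: h0 hr ha hb hc hd; rewrite !ltr_norml; lra.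
  - move=> x; rewrite /PP /tens mulf_eq0 negb_or => /andP[/(dP_neq0 ab) h1 /(dP_neq0 cd) h2].
    by split; rewrite /= in_itv.
move=> x; rewrite /PP /tens mulr_ge0// subr_ge0 rho_prim_ndecr//; lra.
Qed.

(** The mollified field has no circulation around the rectangle with opposite corners [(a, c)] and
    [(b, d)]. Both sides change sign when [a] and [b], or [c] and [d], are exchanged, which removes
    the orderings. *)
Let curl_id a b c d : `|a - p.1| < r -> `|b - p.1| < r -> `|c - p.2| < r -> `|d - p.2| < r ->
  pair2 g1 (tens (dP a b) (dQ c d)) = pair2 g2 (tens (dQ a b) (dP c d)).
Proof.
have bk1 a' b' c' d' : bkernel (tens (dP a' b') (dQ c' d')).
  by have [C HC] := bdP; apply: bkernel_tens (HC a' b') (bdQ c' d').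
have bk2 a' b' c' d' : bkernel (tens (dQ a' b') (dP c' d')).
  by have [C HC] := bdP; apply: bkernel_tens (bdQ a' b') (HC c' d').
have N1 a' b' c' d' : pair2 g1 (tens (dP a' b') (dQ c' d')) =
    - pair2 g1 (tens (dP b' a') (dQ c' d')).
  rewrite -mulN1r -pair2Z//; congr pair2; apply/funext => x; rewrite /tens /dP; ring.
have N2 a' b' c' d' : pair2 g1 (tens (dP a' b') (dQ c' d')) =
    - pair2 g1 (tens (dP a' b') (dQ d' c')).
  rewrite -mulN1r -pair2Z//; congr pair2; apply/funext => x; rewrite /tens /dQ; ring.
have N3 a' b' c' d' : pair2 g2 (tens (dQ a' b') (dP c' d')) =
    - pair2 g2 (tens (dQ b' a') (dP c' d')).
  rewrite -mulN1r -pair2Z//; congr pair2; apply/funext => x; rewrite /tens /dQ; ring.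
have N4 a' b' c' d' : pair2 g2 (tens (dQ a' b') (dP c' d')) =
    - pair2 g2 (tens (dQ a' b') (dP d' c')).
  rewrite -mulN1r -pair2Z//; congr pair2; apply/funext => x; rewrite /tens /dP; ring.
move=> ha hb hc hd.
have [ab|/ltW ba] := leP a b; have [cd|/ltW dc] := leP c d.
- exact: curl_le.
- by rewrite N2 N4 curl_le.
- by rewrite N1 N3 curl_le.
- by rewrite N1 N2 N3 N4 curl_le.
Qed.

(** Line integral of the mollified field from [p] vertically to [(p.1, z.2)], then horizontally to
    [z]. Integration along each leg is moved into the kernel, where it turns [rho] into a difference
    of values of [rho_prim]. *)
Definition potential_h (z : R * R) : R :=
  pair2 g1 (tens (fun s => rho_prim h (s - p.1) - rho_prim h (s - z.1)) (fun t => rho h (t - z.2))) +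
  pair2 g2 (tens (fun s => rho h (s - p.1)) (fun t => rho_prim h (t - p.2) - rho_prim h (t - z.2))).

Lemma potential_h_center : potential_h p = 0.
Proof.
have z g (k : R * R -> R) : (forall x, k x = 0) -> pair2 g k = 0.
  move=> k0; rewrite /pair2; have -> : (fun x => g x * k x) = cst 0.
    by apply/funext => x; rewrite k0 mulr0.
  by rewrite (Rintegral_cst (lam2 : {measure set T2 -> \bar R}) (@measurableT _ T2)) mul0r.
by rewrite /potential_h !z ?addr0// => x; rewrite /tens subrr ?mul0r ?mulr0.
Qed.

(** Path independence: the rectangle with corners [(p.1, z.2)] and [(z.1, w.2)] carries no
    circulation, so the path from [z] to [w] may also go vertically first, then horizontally. *)
Let potential_inc (z w : R * R) : ball p r z -> ball p r w ->
  potential_h w - potential_h z = pair2 g1 (tens (dP z.1 w.1) (Q w.2)) +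
    pair2 g2 (tens (Q z.1) (dP z.2 w.2)).
Proof.
move=> /ball2P[z1 z2] /ball2P[w1 w2].
have r0 : 0 < r by exact: lt_trans hr.
have p1 : `|p.1 - p.1| < r by rewrite subrr normr0.
have p2 : `|p.2 - p.2| < r by rewrite subrr normr0.
have C := curl_id p1 z1 z2 w2.
have E1 : pair2 g1 (tens (dP p.1 w.1) (Q w.2)) =
    pair2 g1 (tens (dP p.1 z.1) (Q w.2)) + pair2 g1 (tens (dP z.1 w.1) (Q w.2)).
  rewrite -[RHS](pair2D ig1 (bk_PQ _ _ _) (bk_PQ _ _ _)); congr pair2; apply/funext => x; rewrite /tens /dP; ring.
have E2 : pair2 g1 (tens (dP p.1 z.1) (dQ z.2 w.2)) =
    pair2 g1 (tens (dP p.1 z.1) (Q z.2)) - pair2 g1 (tens (dP p.1 z.1) (Q w.2)).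
  rewrite -[RHS](pair2B ig1 (bk_PQ _ _ _) (bk_PQ _ _ _)); congr pair2; apply/funext => x; rewrite /tens /dQ; ring.
have E3 : pair2 g2 (tens (Q p.1) (dP p.2 w.2)) =
    pair2 g2 (tens (Q p.1) (dP p.2 z.2)) + pair2 g2 (tens (Q p.1) (dP z.2 w.2)).
  rewrite -[RHS](pair2D ig2 (bk_QP _ _ _) (bk_QP _ _ _)); congr pair2; apply/funext => x; rewrite /tens /dP; ring.
have E4 : pair2 g2 (tens (dQ p.1 z.1) (dP z.2 w.2)) =
    pair2 g2 (tens (Q p.1) (dP z.2 w.2)) - pair2 g2 (tens (Q z.1) (dP z.2 w.2)).
  rewrite -[RHS](pair2B ig2 (bk_QP _ _ _) (bk_QP _ _ _)); congr pair2; apply/funext => x; rewrite /tens /dQ; ring.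
rewrite /potential_h -!/(dP _ _ _).
rewrite [pair2 g1 (tens _ (fun t => rho h (t - w.2)))]E1.
rewrite [pair2 g2 (tens _ (fun t => rho_prim h (t - p.2) - rho_prim h (t - w.2)))]E3.
by apply: path_identity; move: C; rewrite E2 E4.
Qed.

Definition mollify (g : R * R -> R) (z : R * R) : R :=
  pair2 g (tens (fun s => rho h (s - z.1)) (fun t => rho h (t - z.2))).

(** The gradient of the potential is the mollified field, with a remainder uniform in [z]. The
    primitive is expanded by [rho_prim_taylor]; the Lipschitz bound on [rho] replaces the height
    [w.2] of the horizontal leg by [z.2]. *)
Let potential_taylor (e : R * R) : exists2 K : R, 0 <= K & forall z t,
  ball p r z -> ball p r (z + t *: e) ->
  `|potential_h (z + t *: e) - potential_h z -
    t * (e.1 * mollify g1 z + e.2 * mollify g2 z)| <= K * t ^+ 2.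
Proof.
have [L1 L10 H1] := rho_prim_taylor h; have [L2 L20 H2] := rho_lipschitz h.
set G1 := Rintegral lam2 setT (fun x => `|g1 x|).
set G2 := Rintegral lam2 setT (fun x => `|g2 x|).
have G10 : 0 <= G1 by apply: Rintegral_ge0 => x _.
have G20 : 0 <= G2 by apply: Rintegral_ge0 => x _.
pose K1 := L1 * e.1 ^+ 2 + L2 * (`|e.1| * `|e.2|).
pose K2 := L1 * e.2 ^+ 2.
have K10 : 0 <= K1 by rewrite /K1 addr_ge0// mulr_ge0 ?sqr_ge0 ?mulr_ge0.
have K20 : 0 <= K2 by rewrite mulr_ge0 ?sqr_ge0.
exists (K1 * G1 + K2 * G2) => [|z t zb wb].
  by apply: addr_ge0; apply: mulr_ge0.
rewrite potential_inc//; set w := z + t *: e.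
have w1 : w.1 = z.1 + t * e.1 by [].
have w2 : w.2 = z.2 + t * e.2 by [].
have -> : pair2 g1 (tens (dP z.1 w.1) (Q w.2)) + pair2 g2 (tens (Q z.1) (dP z.2 w.2)) -
   t * (e.1 * mollify g1 z + e.2 * mollify g2 z) =
   pair2 g1 (fun x => tens (dP z.1 w.1) (Q w.2) x - t * e.1 * tens (Q z.1) (Q z.2) x) +
   pair2 g2 (fun x => tens (Q z.1) (dP z.2 w.2) x - t * e.2 * tens (Q z.1) (Q z.2) x).
  rewrite (pair2B ig1 (bk_PQ _ _ _) (bkernelZ _ (bk_QQ _ _))) (pair2Z _ ig1 (bk_QQ _ _)).
  rewrite (pair2B ig2 (bk_QP _ _ _) (bkernelZ _ (bk_QQ _ _))) (pair2Z _ ig2 (bk_QQ _ _)).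
  exact: taylor_regroup.
apply: (le_trans (ler_normD _ _)); rewrite [leRHS]mulrDl; apply: lerD.
  rewrite mulrAC; apply: (pair2_le ig1 (bkernelB (bk_PQ _ _ _) (bkernelZ _ (bk_QQ _ _)))).
  move=> x; rewrite /tens.
  have -> : dP z.1 w.1 x.1 * Q w.2 x.2 - t * e.1 * (Q z.1 x.1 * Q z.2 x.2) =
    (dP z.1 w.1 x.1 - t * e.1 * Q z.1 x.1) * Q w.2 x.2 +
    t * e.1 * Q z.1 x.1 * (Q w.2 x.2 - Q z.2 x.2) by ring.
  apply: (le_trans (ler_normD _ _)); rewrite [leRHS]mulrDl; apply: lerD.
    rewrite normrM -[leRHS]mulr1 ler_pM//.
    have := H1 (x.1 - z.1) (t * e.1).
    have -> : x.1 - z.1 - t * e.1 = x.1 - w.1 by rewrite w1; ring.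
    by rewrite (_ : L1 * (t * _) ^+ 2 = L1 * e.1 ^+ 2 * t ^+ 2)// exprMn [t ^+ 2 * _]mulrC mulrA.
  rewrite 3!normrM.
  have hQ : `|Q w.2 x.2 - Q z.2 x.2| <= L2 * (`|t| * `|e.2|).
    apply: (le_trans (H2 _ _)); rewrite -normrM ler_wpM2l// w2.
    by rewrite -normrN (_ : - _ = t * e.2)//; ring.
  have -> : L2 * (`|e.1| * `|e.2|) * t ^+ 2 = `|t| * `|e.1| * 1 * (L2 * (`|t| * `|e.2|)).
    by rewrite -[t ^+ 2]ger0_norm ?sqr_ge0// normrX; ring.
  apply: ler_pM => //.
  by apply: ler_wpM2l; [rewrite mulr_ge0|exact: bQ].
rewrite mulrAC; apply: (pair2_le ig2 (bkernelB (bk_QP _ _ _) (bkernelZ _ (bk_QQ _ _)))).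
move=> x; rewrite /tens.
have -> : Q z.1 x.1 * dP z.2 w.2 x.2 - t * e.2 * (Q z.1 x.1 * Q z.2 x.2) =
  Q z.1 x.1 * (dP z.2 w.2 x.2 - t * e.2 * Q z.2 x.2) by ring.
rewrite normrM -[leRHS]mul1r ler_pM//.
have := H1 (x.2 - z.2) (t * e.2).
have -> : x.2 - z.2 - t * e.2 = x.2 - w.2 by rewrite w2; ring.
by rewrite (_ : L1 * (t * _) ^+ 2 = L1 * e.2 ^+ 2 * t ^+ 2)// exprMn [t ^+ 2 * _]mulrC mulrA.
Qed.

Definition moll_mass : R :=
  Rintegral lam2 setT (tens (fun s => rho h s) (fun t => rho h t)).

Let kern_int z : lam2.-integrable setT (EFin \o (tens (Q z.1) (Q z.2))).
Proof.
have [ck _] := bk_QQ z.1 z.2.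
apply: (@bounded_support_integrable _ _ z h 1 (ltW h0) (continuous_measurable2 ck)).
  by move=> x; rewrite normrM mulr_ile1.
move=> x nb; apply/eqP; apply: contrapT => /negP; rewrite mulf_eq0 negb_or.
move=> /andP[/rho_neq0 h1 /rho_neq0 h2]; apply: nb; apply/ball2P.
by move: h0 h1 h2; rewrite !ltr_norml; lra.
Qed.

Let moll_massE z : Rintegral lam2 setT (tens (Q z.1) (Q z.2)) = moll_mass.
Proof.
have [_] := integral_shift z (kern_int z).
move=> <-; apply: eq_Rintegral => x _; rewrite /tens /Q /=.
by rewrite !addrK.
Qed.

Lemma moll_mass_gt0 : 0 < moll_mass.
Proof.
have i0 := kern_int 0; have m0 := moll_massE 0.
rewrite ltNge -m0; apply/negP => le0.
have [ck _] := bk_QQ (0 : R * R).1 (0 : R * R).2.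
have k0 x : 0 <= tens (Q (0 : R * R).1) (Q (0 : R * R).2) x.
  by apply: mulr_ge0; exact: rho_ge0.
have := continuous_Rintegral_eq0 ck i0 k0 le0 (h / 2, h / 2).
move/eqP; apply/negP; rewrite gt_eqF//.
have b : 0 < bump0 (h / 2) by apply: bump0_gt0; rewrite divr_gt0.
have b' : 0 < bump0 (h - h / 2) by apply: bump0_gt0; move: h0; lra.
by rewrite /tens /Q /= !subr0; apply: mulr_gt0; apply: mulr_gt0.
Qed.

(** The derivative of the potential along [e] at a point of the segment is the integral of
    [e.1 * g1 + e.2 * g2] against a kernel living on the square of side [h] to its upper right. [W]
    contains these squares, so each such derivative is at least [b * moll_mass], and [straddle]
    passes to the increment. *)
Lemma potential_h_inc (W : set (R * R)) (z e : R * R) (b : R) :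
  ball p r z -> ball p r (z + e) ->
  lam2.-negligible (W `&` [set x | e.1 * g1 x + e.2 * g2 x < b]) ->
  (forall t, 0 <= t <= 1 -> forall x, 0 < x.1 - (z + t *: e).1 < h ->
    0 < x.2 - (z + t *: e).2 < h -> W x) ->
  b * moll_mass <= potential_h (z + e) - potential_h z.
Proof.
move=> zb wb nW kW.
have seg t : 0 <= t <= 1 -> ball p r (z + t *: e).
  move=> t01; apply/ball2P; move: zb wb => /ball2P[z1 z2] /ball2P[w1 w2].
  rewrite /= /GRing.scale /= ![_ + t * _ - _]addrAC.
  by split; apply: segment_norm_lt => //; rewrite addrAC.
have low t : 0 <= t <= 1 ->
    b * moll_mass <= e.1 * mollify g1 (z + t *: e) + e.2 * mollify g2 (z + t *: e).
  move=> t01; set w := z + t *: e.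
  have bk := bk_QQ w.1 w.2.
  have i1 := bkernel_integrable ig1 bk; have i2 := bkernel_integrable ig2 bk.
  have i1' : lam2.-integrable setT (EFin \o (fun x => e.1 * (g1 x * tens (Q w.1) (Q w.2) x))).
    exact: (integrableZl (@measurableT _ T2) e.1 i1).
  have i2' : lam2.-integrable setT (EFin \o (fun x => e.2 * (g2 x * tens (Q w.1) (Q w.2) x))).
    exact: (integrableZl (@measurableT _ T2) e.2 i2).
  have iK := kern_int w.
  have iK' : lam2.-integrable setT (EFin \o (fun x => b * tens (Q w.1) (Q w.2) x)).
    exact: (integrableZl (@measurableT _ T2) b iK).
  rewrite -(moll_massE w) -[leLHS](Rint2Z b iK).
  rewrite -[X in X + _](Rint2Z e.1 i1) -[X in _ + X](Rint2Z e.2 i2) -[leRHS](Rint2D i1' i2').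
  apply: ae_le_Rintegral2 => //; first exact: (integrableD (@measurableT _ T2) i1' i2').
  apply: null2S nW => x /=.
  move/negP; rewrite -ltNge.
  set k := tens _ _ x => hlt.
  have k0 : 0 <= k by apply: mulr_ge0; exact: rho_ge0.
  have E : e.1 * (g1 x * k) + e.2 * (g2 x * k) = (e.1 * g1 x + e.2 * g2 x) * k by ring.
  rewrite E in hlt.
  have kn : k != 0 by apply: contraTneq hlt => ->; rewrite !mulr0 ltxx.
  have kp : 0 < k by rewrite lt_neqAle eq_sym kn.
  split; last by rewrite ltr_pM2r in hlt.
  move: kn; rewrite /k /tens mulf_eq0 negb_or => /andP[/rho_neq0 q1 /rho_neq0 q2].
  exact: kW t01 x q1 q2.
have [K K0 HK] := potential_taylor e.
pose k t := potential_h (z + t *: e) - b * moll_mass * t.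
suff : k 0 <= k 1 by rewrite /k scale0r scale1r addr0; exact: slope_le.
(* Within this radius the quadratic remainder is at most [eps] times the step. *)
apply: straddle => t t01 eps eps0; exists (eps / (K + 1)); first by rewrite divr_gt0// ltr_wpDl.
move=> s s01 st.
have zs : z + s *: e = (z + t *: e) + (s - t) *: e.
  by rewrite -addrA -scalerDl addrCA subrr addr0.
have bs := seg s s01; rewrite zs in bs.
have := HK _ (s - t) (seg t t01) bs; rewrite -zs => H.
have lt := low t t01; move: H.
have Kst : K * (s - t) ^+ 2 <= eps * `|s - t|.
  rewrite -[(s - t) ^+ 2]ger0_norm ?sqr_ge0// normrX expr2 mulrA ler_wpM2r//.
  have K1 : 0 < K + 1 by rewrite ltr_wpDl.
  have := ler_wpM2l (ltW K1) (ltW st); rewrite mulrCA mulfV ?mulr1 ?gt_eqF//.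
  by apply: le_trans; rewrite ler_wpM2r// lerDl.
rewrite ler_norml => /andP[H1 H2]; split=> ts.
  rewrite ger0_norm ?subr_ge0// in Kst.
  exact: straddle_right ts lt Kst H1.
rewrite ler0_norm ?subr_le0// opprB in Kst.
exact: straddle_left ts lt Kst H2.
Qed.

End potential_h.

(** * Limit of the mollified potentials *)

Section potential.
Context {R : realType}.
Local Notation T2 := (measurableTypeR R * measurableTypeR R)%type.

(** Pointwise limit along an ultrafilter refining the filter at infinity. It exists as soon as the
    sequence is pointwise bounded, and keeps every lower bound on an increment that holds
    eventually. *)
Lemma ultra_limit (u : nat -> R * R -> R) (A : set (R * R)) (B : R * R -> R) :
  (forall n z, A z -> `|u n z| <= B z) ->
  exists phi : R * R -> R, forall z w (c : R), A z -> A w ->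
    (\forall n \near \oo, c <= u n w - u n z) -> c <= phi w - phi z.
Proof.
move=> uB; have [F [UF sF]] := ultraFilterLemma (F := \oo%classic) (@eventually_filter).
have PF : ProperFilter F := @ultra_proper _ F UF.
have cv z : A z -> exists l : R, u n z @[n --> F] --> l.
  move=> Az; have UG : UltraFilter (u n z @[n --> F]).
    split=> [|G PG FG]; first exact: fmap_proper_filter.
    apply/seteqP; split=> // X GX.
    have [//|FX] := in_ultra_setVsetC ((u ^~ z) @^-1` X) UF.
    have GX' : G (~` X) by apply: FG; exact: FX.
    by exfalso; apply: (@filter_not_empty _ G _); rewrite -(setICr X); exact: filterI.
  have := @segment_compact R (- B z) (B z); rewrite compact_ultra => /(_ _ UG)[].
    by apply: (@filterE _ F _) => n /=; rewrite in_itv /= -ler_norml uB.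
  by move=> l [_ h]; exists l.
pose phi z := if pselect (A z) is left Az then sval (cid (cv z Az)) else 0.
have phiP z : A z -> u n z @[n --> F] --> phi z.
  by move=> Az; rewrite /phi; case: pselect => // Az'; case: cid.
exists phi => z w c Az Aw h.
have L : u n w - u n z @[n --> F] --> phi w - phi z by apply: cvgB; exact: phiP.
rewrite -(cvg_lim (@Rhausdorff R) L); apply: limr_ge; first exact: cvgP L.
by apply: sF; exact: h.
Qed.

(** The inequality in the conclusion is all that is retained of [phi]. The square [ball c d] makes
    it local. *)
Lemma potential_exists (g1 g2 : R * R -> R) (p : R * R) (r C : R) :
  0 < r -> lam2.-integrable setT (EFin \o g1) -> lam2.-integrable setT (EFin \o g2) ->
  (forall psi, test_on (ball p (2 * r)) psi -> (forall x, 0 <= psi x) ->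
     pair2 g1 ('D_e2 psi) = pair2 g2 ('D_e1 psi)) ->
  lam2.-negligible (ball p (2 * r) `&` [set x | ~ (`|g1 x| <= C /\ `|g2 x| <= C)]) ->
  exists phi : R * R -> R, forall (c z e : R * R) (d b : R),
    ball p r z -> ball p r (z + e) -> ball c d z -> ball c d (z + e) ->
    lam2.-negligible (ball c d `&` [set x | e.1 * g1 x + e.2 * g2 x < b]) ->
    b <= phi (z + e) - phi z.
Proof.
move=> r0 ig1 ig2 curl gC.
(* [n.+2] keeps the width strictly below [r] already for [n = 0]. *)
pose h n : R := r / n.+2%:R.
have h0 n : 0 < h n by rewrite divr_gt0.
have hr n : h n < r by rewrite ltr_pdivrMr// ltr_pMr// ltr1n.
have m0 n : 0 < moll_mass (h n) := moll_mass_gt0 (h0 n).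
pose u n z := potential_h g1 g2 p (h n) z / moll_mass (h n).
have inc n (W : set (R * R)) (z e : R * R) (b : R) : ball p r z -> ball p r (z + e) ->
    lam2.-negligible (W `&` [set x | e.1 * g1 x + e.2 * g2 x < b]) ->
    (forall t, 0 <= t <= 1 -> forall x, 0 < x.1 - (z + t *: e).1 < h n ->
      0 < x.2 - (z + t *: e).2 < h n -> W x) -> b <= u n (z + e) - u n z.
  move=> zb wb nW kW; rewrite /u -mulrBl ler_pdivlMr//.
  exact: (potential_h_inc ig1 ig2 (h0 n) (hr n) curl zb wb nW kW).
have seg z e t : ball p r z -> ball p r (z + e) -> 0 <= t <= 1 -> ball p r (z + t *: e).
  move=> /ball2P[z1 z2] /ball2P[w1 w2] t01; apply/ball2P.
  rewrite /= /GRing.scale /= ![_ + t * _ - _]addrAC.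
  by split; apply: segment_norm_lt => //; rewrite addrAC.
have C0 : 0 <= `|C| by [].
(* With the whole ball as [W] this is a Lipschitz bound uniform in [n]. It gives the pointwise
   boundedness that the limit requires, the potentials being 0 at [p]. *)
have bnd n z w : ball p r z -> ball p r w -> - (2 * (`|C| * `|w - z|)) <= u n w - u n z.
  move=> zb wb; have E : w = z + (w - z) by rewrite addrCA subrr addr0.
  rewrite {2}E; apply: (inc n (ball p (2 * r))); rewrite -?E//.
    apply: null2S gC => x [xb /= lt]; split=> // -[c1 c2]; move: lt; apply/negP; rewrite -leNgt.
    have [n1 n2] := norm2_ge (w - z).
    have a1 : `|(w - z).1 * g1 x| <= `|C| * `|w - z|.
      by rewrite normrM mulrC ler_pM// (le_trans c1)// ler_norm.
    have a2 : `|(w - z).2 * g2 x| <= `|C| * `|w - z|.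
      by rewrite normrM mulrC ler_pM// (le_trans c2)// ler_norm.
    move: a1 a2; move: (_ * g1 x) (_ * g2 x) (_ * `|w - z|) => a1 a2 a3.
    by rewrite !ler_norml; lra.
  move=> t t01 x; have := seg z (w - z) t zb; rewrite -E => /(_ wb t01)/ball2P.
  move: (z + t *: (w - z)) => y [y1 y2] h1 h2; apply/ball2P.
  by move: (hr n) h1 h2 y1 y2; rewrite !ltr_norml; lra.
have u0 n : u n p = 0 by rewrite /u potential_h_center mul0r.
have pb : ball p r p by exact: ballxx.
have uB n z : ball p r z -> `|u n z| <= 2 * (`|C| * `|z - p|).
  move=> zb; have := bnd n p z pb zb; have := bnd n z p zb pb.
  by rewrite u0 distrC ler_norml subr0 sub0r; lra.
have [phi phiP] := ultra_limit uB.
exists phi => c z e d b zb wb zc wc nW; apply: phiP => //.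
(* The segment stays within [M < d] of [c]; once [h n < d - M], the mollifier squares along it stay
   in [ball c d]. *)
pose M := Num.max (Num.max `|z.1 - c.1| `|z.1 + e.1 - c.1|) (Num.max `|z.2 - c.2| `|z.2 + e.2 - c.2|).
have Md : M < d by move: zc wc => /ball2P[z1 z2] /ball2P[w1 w2]; rewrite !gt_max z1 z2 w1 w2.
have dMr : 0 < (d - M) / r by rewrite divr_gt0// subr_gt0.
have := @near_infty_natSinv_lt R (PosNum dMr); apply: filterS => n /= hn.
have hM : h n < d - M.
  rewrite /h -[ltRHS](divfK (lt0r_neq0 r0)) mulrC ltr_pM2r//.
  apply: le_lt_trans hn; rewrite lef_pV2 ?posrE// ler_nat//.
apply: (inc n (ball c d)) => // t /andP[t0 t1] x h1 h2.
have cv (a b' : R) : `|a| <= M -> `|a + b'| <= M -> `|a + t * b'| <= M.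
  move=> aM bM; have -> : a + t * b' = (1 - t) * a + t * (a + b') by ring.
  apply: (le_trans (ler_normD _ _)); have t1' : 0 <= 1 - t by rewrite subr_ge0.
  have -> : M = (1 - t) * M + t * M by ring.
  by rewrite !normrM (ger0_norm t0) (ger0_norm t1') lerD// ler_wpM2l.
have y1 : `|(z + t *: e).1 - c.1| <= M.
  rewrite /= addrAC; apply: cv; rewrite /M ?[_ - _ + _]addrAC !le_max !lexx ?orbT//.
have y2 : `|(z + t *: e).2 - c.2| <= M.
  rewrite /= addrAC; apply: cv; rewrite /M ?[_ - _ + _]addrAC !le_max !lexx ?orbT//.
apply/ball2P; move: h1 h2 y1 y2 hM; move: (z + t *: e) => y.
by rewrite !ltr_norml !ler_norml; lra.
Qed.

End potential.

(** * Gordan's alternative in the plane *)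

Section gordan.
Context {R : realType}.

Lemma fst_scale (t : R) (a : R * R) : (t *: a).1 = t * a.1.
Proof. by []. Qed.

Lemma snd_scale (t : R) (a : R * R) : (t *: a).2 = t * a.2.
Proof. by []. Qed.

Lemma fst_add (a b : R * R) : (a + b).1 = a.1 + b.1.
Proof. by []. Qed.

Lemma snd_add (a b : R * R) : (a + b).2 = a.2 + b.2.
Proof. by []. Qed.

Definition pairE := (fst_scale, snd_scale, fst_add, snd_add).

Definition dot (a b : R * R) : R := a.1 * b.1 + a.2 * b.2.

Lemma seq_small_eps (I : eqType) (s : seq I) (a b : I -> R) :
  (forall j, j \in s -> 0 < a j) ->
  exists2 e : R, 0 < e & forall j, j \in s -> 0 < a j + e * b j.
Proof.
elim: s => [|i s IH] H; first by exists 1.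
have [|e e0 He] := IH; first by move=> j js; apply: H; rewrite in_cons js orbT.
have ai : 0 < a i by apply: H; rewrite mem_head.
pose e' := Num.min e (a i / (`|b i| + 1)).
have b1 : 0 < `|b i| + 1 by rewrite ltr_wpDl.
have e'0 : 0 < e' by rewrite lt_min e0 divr_gt0.
exists e' => // j; rewrite in_cons => /predU1P[->|js].
  have h : e' * (`|b i| + 1) <= a i.
    by rewrite -ler_pdivlMr// /e' ge_min lexx orbT.
  have h' : - (e' * `|b i|) <= e' * b i.
    by rewrite -mulrN ler_wpM2l ?(ltW e'0)// lerNl -normrN ler_norm.
  by rewrite mulrDr mulr1 in h; lra.
have aj : 0 < a j by apply: H; rewrite in_cons js orbT.
have := He j js; have ee : e' <= e by rewrite /e' ge_min lexx.
have [bj|bj] := leP 0 (b j).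
  by move=> _; rewrite ltr_pwDl// mulr_ge0// ltW.
have : e * b j <= e' * b j by rewrite ler_wnM2r// ltW.
by lra.
Qed.

(** Induction on the list. If the direction [e] found for [s] fails at the new vector [w i], all
    other vectors lie strictly on one side of the line spanned by [w i], since otherwise a
    nontrivial nonnegative combination vanishes. The normal to that line, tilted slightly towards
    [w i], is then a common direction. *)
Lemma gordan_seq (I : eqType) (w : I -> R * R) (s : seq I) : uniq s ->
  (forall th : I -> R, (forall j, 0 <= th j) -> 0 < \sum_(j <- s) th j ->
     \sum_(j <- s) th j *: w j != 0) ->
  exists e : R * R, forall j, j \in s -> 0 < dot e (w j).
Proof.
elim: s => [|i s IH] /=; first by exists 0.
move=> /andP[ins us] H.
have [|e He] := IH us.
  move=> th th0 sth; have := H (fun j => if j == i then 0 else th j).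
  have E j : j \in s -> (if j == i then 0 else th j) = th j.
    by move=> js; rewrite ifF//; apply: contraNF ins => /eqP <-.
  have E1 : \sum_(j <- s) (if j == i then 0 else th j) = \sum_(j <- s) th j.
    by apply: eq_big_seq => j js; rewrite E.
  have E2 : \sum_(j <- s) (if j == i then 0 else th j) *: w j = \sum_(j <- s) th j *: w j.
    by apply: eq_big_seq => j js; rewrite E.
  rewrite !big_cons eqxx scale0r !add0r E1 E2.
  by apply=> // j; case: ifP.
have [ei|ei] := ltP 0 (dot e (w i)).
  by exists e => j; rewrite in_cons => /predU1P[->|/He].
pose a := - dot e (w i); have a0 : 0 <= a by rewrite oppr_ge0.
have sumd (c : R) j : j \in s -> \sum_(x <- s) (if x == j then c else 0) = c.
  move=> js; rewrite (bigD1_seq j)//= eqxx big1 ?addr0// => x /negbTE xj.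
  by rewrite xj.
have sumw (c : R) j : j \in s -> \sum_(x <- s) (if x == j then c else 0) *: w x = c *: w j.
  move=> js; rewrite (bigD1_seq j)//= eqxx big1 ?addr0// => x /negbTE xj.
  by rewrite xj scale0r.
have comb (c d d' : R) j k : j \in s -> k \in s -> 0 < c -> 0 <= d -> 0 <= d' ->
    c *: w i + d *: w j + d' *: w k != 0.
  move=> js ks c0 d0 d'0.
  pose th x := (if x == i then c else 0) + (if x == j then d else 0) + (if x == k then d' else 0).
  have ij : (i == j) = false by apply: contraNF ins => /eqP ->.
  have ik : (i == k) = false by apply: contraNF ins => /eqP ->.
  have z x : x \in s -> (x == i) = false by move=> xs; apply: contraNF ins => /eqP <-.
  have := H th; rewrite !big_cons /th eqxx ij ik !addr0.
  have -> : \sum_(x <- s) ((if x == i then c else 0) + (if x == j then d else 0) +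
      (if x == k then d' else 0)) = d + d'.
    rewrite !big_split /= (sumd d j js) (sumd d' k ks) big_seq big1 ?add0r//.
    by move=> x /z ->.
  have -> : \sum_(x <- s) ((if x == i then c else 0) + (if x == j then d else 0) +
      (if x == k then d' else 0)) *: w x = d *: w j + d' *: w k.
    rewrite (eq_bigr (fun x => (if x == i then c else 0) *: w x +
      (if x == j then d else 0) *: w x + (if x == k then d' else 0) *: w x)); last first.
      by move=> x _; rewrite !scalerDl.
    rewrite !big_split /= (sumw d j js) (sumw d' k ks) big_seq big1 ?add0r//.
    by move=> x /z ->; rewrite scale0r.
  rewrite -[_ + d *: _ + _]addrA; apply; last by rewrite ltr_pwDl// addr_ge0.
  move=> x; rewrite !addr_ge0//; by case: ifP => // _; exact: ltW.
have wi0 : w i != 0.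
  have := H (fun j => if j == i then 1 else 0); rewrite !big_cons eqxx scale1r.
  rewrite big_seq big1 ?addr0; last by move=> x xs; rewrite ifF//; apply: contraNF ins => /eqP <-.
  rewrite big_seq big1 ?addr0; last first.
    by move=> x xs; rewrite ifF ?scale0r//; apply: contraNF ins => /eqP <-.
  by apply=> // j; case: ifP.
have wi2 : 0 < dot (w i) (w i).
  rewrite lt_neqAle addr_ge0 -?expr2 ?sqr_ge0// andbT eq_sym.
  apply: contra wi0; rewrite /dot -!expr2 paddr_eq0 ?sqr_ge0// !sqrf_eq0 => /andP[/eqP h1 /eqP h2].
  by apply/eqP; rewrite [w i]surjective_pairing h1 h2.
pose f : R * R := (- e.2, e.1).
(* Up to the factor [- dot e e], this is the determinant of [w i] and [w j]; its sign tells the side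
   of the line through [w i]. *)
pose v j := dot f (w i) * dot e (w j) + a * dot f (w j).
have v0 j : j \in s -> v j != 0.
  move=> js; apply/eqP => vj; have := comb (dot e (w j)) a 0 j j js js (He j js) a0 (lexx 0).
  move/eqP; apply; rewrite scale0r addr0.
  have ee : 0 < dot e e.
    rewrite lt_neqAle addr_ge0 -?expr2 ?sqr_ge0// andbT eq_sym; apply/negP.
    rewrite /dot -!expr2 paddr_eq0 ?sqr_ge0// !sqrf_eq0 => /andP[/eqP h1 /eqP h2].
    by have := He j js; rewrite /dot h1 h2 !mul0r addr0 ltxx.
  have E1 : dot e (w j) * (w i).1 + a * (w j).1 = - e.2 * v j / dot e e.
    apply: (mulIf (lt0r_neq0 ee)); rewrite divfK ?lt0r_neq0//.
    by rewrite /v /a /dot /f /=; ring.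
  have E2 : dot e (w j) * (w i).2 + a * (w j).2 = e.1 * v j / dot e e.
    apply: (mulIf (lt0r_neq0 ee)); rewrite divfK ?lt0r_neq0//.
    by rewrite /v /a /dot /f /=; ring.
  rewrite vj !mulr0 !mul0r in E1 E2.
  by rewrite [LHS]surjective_pairing ?pairE E1 E2.
have opp j k : j \in s -> k \in s -> 0 < v j -> v k < 0 -> False.
  move=> js ks vj vk.
  (* A multiple of Cramer's linear relation between three plane vectors; the signs of [v j] and
     [v k] make its coefficients nonnegative. *)
  have c0 : 0 < - v k * dot e (w j) + v j * dot e (w k).
    by rewrite addr_gt0// mulr_gt0// ?oppr_gt0// He.
  have := comb _ (- v k * a) (v j * a) j k js ks c0.
  rewrite !mulr_ge0 ?oppr_ge0 ?(ltW vj) ?(ltW vk)// => /(_ isT isT)/eqP; apply.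
  have ee : 0 < dot e e.
    rewrite lt_neqAle addr_ge0 -?expr2 ?sqr_ge0// andbT eq_sym; apply/negP.
    rewrite /dot -!expr2 paddr_eq0 ?sqr_ge0// !sqrf_eq0 => /andP[/eqP h1 /eqP h2].
    by have := He j js; rewrite /dot h1 h2 !mul0r addr0 ltxx.
  rewrite [LHS]surjective_pairing ?pairE; congr pair; apply: (mulIf (lt0r_neq0 ee)); rewrite mul0r.
    by rewrite /v /a /dot ?pairE /f /=; ring.
  by rewrite /v /a /dot ?pairE /f /=; ring.
have [sg Hsg] : exists2 sg : R, True & forall j, j \in s -> 0 < sg * v j.
  have [/hasP[j js vj]|/hasPn H0] := boolP (has (fun j => 0 < v j) s).
    exists 1 => // k ks; rewrite mul1r ltNge le_eqVlt (negbTE (v0 k ks)) /=.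
    by apply/negP => vk; exact: opp js ks vj vk.
  exists (-1) => // k ks; rewrite mulN1r oppr_gt0 lt_neqAle v0//= leNgt.
  exact: H0.
move=> Hv.
have [eps eps0 Heps] := seq_small_eps (fun j => dot (w i) (w j)) Hv.
(* The first two terms form a vector orthogonal to [w i] whose product with [w j] is [sg * v j]; the
   last term is the tilt. *)
exists ((sg * dot f (w i)) *: e + (sg * a) *: f + eps *: w i) => j.
rewrite in_cons => /predU1P[->|js].
  have -> : dot ((sg * dot f (w i)) *: e + (sg * a) *: f + eps *: w i) (w i) =
      eps * dot (w i) (w i).
    by rewrite /a /dot ?pairE /f /=; ring.
  exact: mulr_gt0.
have -> : dot ((sg * dot f (w i)) *: e + (sg * a) *: f + eps *: w i) (w j) =
    sg * v j + eps * dot (w i) (w j).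
  by rewrite /v /a /dot ?pairE /f /=; ring.
exact: Heps.
Qed.

(** Rescaling makes the finitely many positive products at least 1, a definite gap that can be
    followed by continuity to nearby points. *)
Lemma gordan (I : finType) (A : {set I}) (w : I -> R * R) :
  (forall th : I -> R, (forall j, 0 <= th j) -> 0 < \sum_(j in A) th j ->
     0 <> \sum_(j in A) th j *: w j) ->
  exists e : R * R, forall j, j \in A -> 1 <= dot e (w j).
Proof.
move=> H; have [|e He] := @gordan_seq I w (enum A) (enum_uniq _).
  move=> th th0; rewrite !big_enum /= => sth; apply/eqP => E.
  by apply: (H th th0 sth); rewrite E.
have [eps eps0 Heps] := seq_small_eps (fun=> -1) He.
exists (eps^-1 *: e) => j jA; have := Heps j; rewrite mem_enum => /(_ jA).
have -> : dot (eps^-1 *: e) (w j) = eps^-1 * dot e (w j).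
  by rewrite /dot ?pairE; ring.
by rewrite -ler_pdivrMl ?invr_gt0// invrK mulr1 mulrN1 subr_gt0 => /ltW.
Qed.

End gordan.

(** * Complex derivatives in real coordinates *)

Section holomorphic.
Context {R : realType}.
Implicit Types (f A : R * R -> R * R) (z l e : R * R).

Lemma cabs_ge z : `|z.1| <= cabs z /\ `|z.2| <= cabs z.
Proof.
by split; rewrite /cabs -sqrtr_sqr ler_wsqrtr// ?lerDl ?lerDr sqr_ge0.
Qed.

Lemma cabs_le z : cabs z <= 2 * `|z|.
Proof.
have [h1 h2] := norm2_ge z.
have n0 : 0 <= `|z| by [].
rewrite /cabs -[leRHS]ger0_norm ?mulr_ge0// -sqrtr_sqr ler_wsqrtr//.
have a1 : z.1 ^+ 2 <= `|z| ^+ 2 by rewrite -[z.1 ^+ 2]ger0_norm ?sqr_ge0// normrX lerXn2r// nnegrE.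
have a2 : z.2 ^+ 2 <= `|z| ^+ 2 by rewrite -[z.2 ^+ 2]ger0_norm ?sqr_ge0// normrX lerXn2r// nnegrE.
have a3 : 0 <= `|z| ^+ 2 by rewrite sqr_ge0.
by rewrite exprMn; lra.
Qed.

(** [reC] and [imC] are the components of the complex product; for [a = f'(z)] they are the
    differentials at [z] of the real and imaginary parts of [f]. *)
Definition reC (a e : R * R) : R := e.1 * a.1 - e.2 * a.2.
Definition imC (a e : R * R) : R := e.1 * a.2 + e.2 * a.1.

(** Passes from the Euclidean modulus [cabs] to the maximum norm of [R * R]; halving [eps] pays for
    the factor 2 between them. *)
Lemma holo_estimate f z l : holo_at f z l -> forall eps : R, 0 < eps ->
  exists2 d : R, 0 < d & forall w, ball z d w ->
    `|(f w).1 - (f z).1 - reC l (w - z)| <= eps * `|w - z| /\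
    `|(f w).2 - (f z).2 - imC l (w - z)| <= eps * `|w - z|.
Proof.
move=> hf eps eps0; have /nbhs_ballP[d /= d0 Hd] := hf _ (divr_gt0 eps0 (ltr0Sn R 1)).
exists d => // w /Hd H.
have H' : cabs (f w - f z - cmul l (w - z)) <= eps * `|w - z|.
  apply: (le_trans H); rewrite -mulrA ler_wpM2l ?(ltW eps0)// mulrC ler_pdivrMr// mulrC.
  exact: cabs_le.
have [c1 c2] := cabs_ge (f w - f z - cmul l (w - z)).
split.
  have -> : (f w).1 - (f z).1 - reC l (w - z) = (f w - f z - cmul l (w - z)).1.
    by rewrite /cmul /reC /=; ring.
  exact: le_trans c1 H'.
have -> : (f w).2 - (f z).2 - imC l (w - z) = (f w - f z - cmul l (w - z)).2.
  by rewrite /cmul /imC /=; ring.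
exact: le_trans c2 H'.
Qed.

Lemma reC_le l e : `|reC l e| <= 2 * (`|l| * `|e|).
Proof.
have [l1 l2] := norm2_ge l; have [e1 e2] := norm2_ge e.
have a1 : `|e.1 * l.1| <= `|l| * `|e| by rewrite normrM mulrC ler_pM.
have a2 : `|e.2 * l.2| <= `|l| * `|e| by rewrite normrM mulrC ler_pM.
by apply: (le_trans (ler_normB _ _)); rewrite mulr2n mulrDl !mul1r lerD.
Qed.

Lemma imC_le l e : `|imC l e| <= 2 * (`|l| * `|e|).
Proof.
have [l1 l2] := norm2_ge l; have [e1 e2] := norm2_ge e.
have a1 : `|e.1 * l.2| <= `|l| * `|e| by rewrite normrM mulrC ler_pM.
have a2 : `|e.2 * l.1| <= `|l| * `|e| by rewrite normrM mulrC ler_pM.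
by apply: (le_trans (ler_normD _ _)); rewrite mulr2n mulrDl !mul1r lerD.
Qed.

Lemma holo_continuous f z l : holo_at f z l -> {for z, continuous f}.
Proof.
move=> hf; apply/cvgrPdist_le => eps eps0.
suff : nbhs z [set w | `|f z - f w| <= eps] by [].
have [d d0 Hd] := holo_estimate hf ltr01.
pose K := 1 + 2 * `|l|; have K0 : 0 < K by rewrite /K ltr_pwDl// mulr_ge0.
apply/nbhs_ballP; exists (Num.min d (eps / K)) => /=; first by rewrite lt_min d0 divr_gt0.
move=> w wb; have wd : ball z d w by apply: le_ball wb; rewrite ge_min lexx.
have we : K * `|w - z| <= eps.
  move: wb; rewrite -ball_normE /ball_ /= distrC lt_min => /andP[_ /ltW].
  by rewrite ler_pdivlMr// mulrC.
have [h1 h2] := Hd w wd; rewrite /= distrC.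
apply: le_trans we; have r1 := reC_le l (w - z); have r2 := imC_le l (w - z).
apply: norm2_le => /=.
  rewrite -[(f w).1 - _](subrK (reC l (w - z))); apply: (le_trans (ler_normD _ _)).
  by rewrite /K mulrDl -mulrA lerD.
rewrite -[(f w).2 - _](subrK (imC l (w - z))); apply: (le_trans (ler_normD _ _)).
by rewrite /K mulrDl -mulrA lerD.
Qed.

Lemma is_derive_of_estimate (u : R * R -> R) (L : R * R -> R) z e :
  (forall t : R, L (t *: e) = t * L e) ->
  (forall eps : R, 0 < eps -> exists2 d : R, 0 < d & forall w, ball z d w ->
     `|u w - u z - L (w - z)| <= eps * `|w - z|) ->
  is_derive z e u (L e).
Proof.
move=> LZ H.
have lim : (fun h : R => h^-1 *: ((u \o shift z) (h *: e) - u z)) @ 0^' --> (L e : R).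
  apply/cvgrPdist_le => eps eps0.
  have e1 : 0 < `|e| + 1 by rewrite ltr_wpDl.
  have [d d0 Hd] := H _ (divr_gt0 eps0 e1).
  have dd : 0 < d / (`|e| + 1) by rewrite divr_gt0.
  near=> h.
  have h0 : h != 0 by near: h; exact: nbhs_dnbhs_neq.
  have hd : `|h| < d / (`|e| + 1) by near: h; exact: dnbhs0_lt.
  have hb : ball z d (h *: e + z).
    rewrite -ball_normE /ball_ /= distrC addrK normrZ.
    rewrite ltr_pdivlMr// in hd; apply: le_lt_trans hd.
    by rewrite ler_wpM2l// lerDl.
  have := Hd _ hb; rewrite addrK LZ normrZ => H'.
  have -> : L e - h^-1 *: ((u \o shift z) (h *: e) - u z) =
     - (h^-1 * (u (h *: e + z) - u z - h * L e)).
    transitivity (L e - h^-1 * (u (h *: e + z) - u z)); first by [].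
    by field.
  rewrite normrN normrM normfV ler_pdivrMl ?normr_gt0//; apply: (le_trans H').
  rewrite mulrCA ler_wpM2l// -mulrA ler_piMr ?(ltW eps0)//.
  by rewrite mulrC ler_pdivrMr// mul1r lerDl.
by split; [apply/cvg_ex; exists (L e)|exact/cvg_lim].
Unshelve. all: by end_near. Qed.

Lemma holo_is_derive f z l e : holo_at f z l ->
  is_derive z e (fun x => (f x).1) (reC l e) /\ is_derive z e (fun x => (f x).2) (imC l e).
Proof.
move=> hf; split; apply: is_derive_of_estimate.
- by move=> t; rewrite /reC ?pairE; ring.
- by move=> eps /(holo_estimate hf)[d d0 Hd]; exists d => // w /Hd[].
- by move=> t; rewrite /imC ?pairE; ring.
- by move=> eps /(holo_estimate hf)[d d0 Hd]; exists d => // w /Hd[].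
Qed.

End holomorphic.

(** * Comparison of the potential with real parts of holomorphic functions *)

Section potential_compare.
Context {R : realType}.
Local Notation T2 := (measurableTypeR R * measurableTypeR R)%type.

Lemma eps_weight (eps a n : R) : 0 < eps -> 0 <= a -> 0 <= n ->
  eps / (n + 1) * (a * n) <= eps * a.
Proof.
move=> eps0 a0 n0; have n1 : 0 < n + 1 by rewrite ltr_wpDl.
have -> : eps / (n + 1) * (a * n) = eps * a * (n / (n + 1)) by ring.
by rewrite ler_piMr ?mulr_ge0 ?(ltW eps0)// ler_pdivrMr// mul1r lerDl.
Qed.

Lemma ball_segment (p z e : R * R) (r t : R) : ball p r z -> ball p r (z + e) ->
  0 <= t <= 1 -> ball p r (z + t *: e).
Proof.
move=> /ball2P[z1 z2] /ball2P[w1 w2] t01; apply/ball2P.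
rewrite ?pairE ![_ + t * _ - _]addrAC.
by split; apply: segment_norm_lt => //; rewrite addrAC.
Qed.

(** [straddle] along the segment, after adding a linear term of slope [2 * C] times the length to
    either component; differentiability at each point and the bound on [A] suffice. *)
Lemma holo_lipschitz (f A : R * R -> R * R) (p : R * R) (r C : R) :
  (forall z, ball p r z -> holo_at f z (A z)) -> (forall z, ball p r z -> `|A z| <= C) ->
  forall z w, ball p r z -> ball p r w ->
    `|(f w).1 - (f z).1| <= 2 * C * `|w - z| /\ `|(f w).2 - (f z).2| <= 2 * C * `|w - z|.
Proof.
move=> hf AC.
have key (u : R * R -> R) (L : R * R -> R * R -> R) :
    (forall x, ball p r x -> forall eps : R, 0 < eps -> exists2 d : R, 0 < d &
      forall y, ball x d y -> `|u y - u x - L (A x) (y - x)| <= eps * `|y - x|) ->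
    (forall x y, `|L x y| <= 2 * (`|x| * `|y|)) ->
    forall z w, ball p r z -> ball p r w -> u z - u w <= 2 * C * `|w - z|.
  move=> Hu HL z w zb wb.
  have E : w = z + (w - z) by rewrite addrCA subrr addr0.
  set e := w - z in E *.
  pose k t := u (z + t *: e) + 2 * C * `|e| * t.
  suff : k 0 <= k 1 by rewrite /k scale0r scale1r addr0 -E mulr0 mulr1 addr0 lerBlDl.
  apply: straddle => t t01 eps eps0.
  have xb : ball p r (z + t *: e) by apply: ball_segment => //; rewrite -E.
  have e1 : 0 < `|e| + 1 by rewrite ltr_wpDl.
  have [d d0 Hd] := Hu _ xb _ (divr_gt0 eps0 e1).
  exists (d / (`|e| + 1)) => [|s s01 st]; first by rewrite divr_gt0.
  have sE : (z + s *: e) - (z + t *: e) = (s - t) *: e.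
    by rewrite opprD addrACA subrr add0r -scalerBl.
  have sb : ball (z + t *: e) d (z + s *: e).
    rewrite -ball_normE /ball_ /= distrC sE normrZ.
    rewrite ltr_pdivlMr// in st; apply: le_lt_trans st.
    by rewrite ler_wpM2l// lerDl.
  have := Hd _ sb; rewrite sE normrZ => H1.
  have H2 : `|L (A (z + t *: e)) ((s - t) *: e)| <= 2 * C * `|e| * `|s - t|.
    apply: (le_trans (HL _ _)); rewrite normrZ.
    have -> : 2 * C * `|e| * `|s - t| = 2 * (C * (`|s - t| * `|e|)) by ring.
    by rewrite ler_wpM2l// ler_wpM2r// AC.
  have H3 : eps / (`|e| + 1) * (`|s - t| * `|e|) <= eps * `|s - t|.
    exact: eps_weight.
  have H4 : `|u (z + s *: e) - u (z + t *: e)| <= eps * `|s - t| + 2 * C * `|e| * `|s - t|.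
    rewrite -[u (z + s *: e) - _](subrK (L (A (z + t *: e)) ((s - t) *: e))).
    by apply: (le_trans (ler_normD _ _)); apply: lerD => //; exact: le_trans H1 H3.
  move: H4; rewrite /k ler_norml => /andP[H4 H5]; clear -H4 H5.
  move: (u (z + s *: e)) (u (z + t *: e)) (2 * C * `|e|) H4 H5 => us ut K H4 H5.
  split=> ts.
    move: H4 H5; rewrite ger0_norm ?subr_ge0//; lra.
  move: H4 H5; rewrite ler0_norm ?subr_le0//; lra.
have k1 := key (fun x => (f x).1) reC; have k2 := key (fun x => (f x).2) imC.
have h1 x : ball p r x -> forall eps : R, 0 < eps -> exists2 d : R, 0 < d &
      forall y, ball x d y -> `|(f y).1 - (f x).1 - reC (A x) (y - x)| <= eps * `|y - x|.
  by move=> xb eps /(holo_estimate (hf x xb))[d d0 Hd]; exists d => // w /Hd[].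
have h2 x : ball p r x -> forall eps : R, 0 < eps -> exists2 d : R, 0 < d &
      forall y, ball x d y -> `|(f y).2 - (f x).2 - imC (A x) (y - x)| <= eps * `|y - x|.
  by move=> xb eps /(holo_estimate (hf x xb))[d d0 Hd]; exists d => // w /Hd[].
move=> z w zb wb; rewrite !ler_norml; split; apply/andP; split.
- by rewrite lerNl opprB; exact: k1 h1 reC_le z w zb wb.
- by rewrite [`|w - z|]distrC; exact: k1 h1 reC_le w z wb zb.
- by rewrite lerNl opprB; exact: k2 h2 imC_le z w zb wb.
- by rewrite [`|w - z|]distrC; exact: k2 h2 imC_le w z wb zb.
Qed.

(** The potential accepts constant lower bounds only, while [reC (A x) e] varies with [x]. Near each
    point of the segment, continuity of [A] makes it constant up to [eps / 2] and differentiability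
    makes the increment of [f] linear up to [eps / 2]; [straddle] joins these local comparisons. *)
Lemma potential_ge (g1 g2 phi : R * R -> R) (f A : R * R -> R * R)
    (p : R * R) (r : R) :
  (forall (c z e : R * R) (d b : R),
    ball p r z -> ball p r (z + e) -> ball c d z -> ball c d (z + e) ->
    lam2.-negligible (ball c d `&` [set x | e.1 * g1 x + e.2 * g2 x < b]) ->
    b <= phi (z + e) - phi z) ->
  forall (c z e : R * R) (d : R),
  (forall x, ball c d x -> holo_at f x (A x) /\ {for x, continuous A}) ->
  ball c d `<=` ball p r -> ball c d z -> ball c d (z + e) ->
  lam2.-negligible (ball c d `&` [set x | e.1 * g1 x + e.2 * g2 x < reC (A x) e]) ->
  (f (z + e)).1 - (f z).1 <= phi (z + e) - phi z.
Proof.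
move=> P0 c z e d hf cp zb wb nl.
pose k t := phi (z + t *: e) - (f (z + t *: e)).1.
suff : k 0 <= k 1.
  rewrite /k scale0r scale1r addr0; move: (phi _) (phi _) (f _).1 (f _).1 => a b c' d'.
  by clear; lra.
apply: straddle => t t01 eps eps0.
set x := z + t *: e; have xb : ball c d x by apply: ball_segment.
have [hx cx] := hf x xb.
have e1 : 0 < `|e| + 1 by rewrite ltr_wpDl.
have eps2 : 0 < eps / 2 by rewrite divr_gt0.
have [d1 d10 Hd1] := holo_estimate hx (divr_gt0 eps2 e1).
have [d2 d20 Hd2] : exists2 d2 : R, 0 < d2 & forall y, ball x d2 y ->
    ball c d y /\ reC (A x) e - eps / 2 <= reC (A y) e.
  have nc : nbhs x (ball c d) by apply: open_nbhs_nbhs; split=> //; exact: ball_open.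
  have a0 : 0 < eps / 2 / (2 * (`|e| + 1)) by rewrite divr_gt0// mulr_gt0.
  have nA : nbhs x [set y | `|A x - A y| <= eps / 2 / (2 * (`|e| + 1))].
    by move/cvgrPdist_le : cx => /(_ _ a0).
  have nI : nbhs x (ball c d `&` [set y | `|A x - A y| <= eps / 2 / (2 * (`|e| + 1))]).
    exact: filterI.
  have /nbhs_ballP[d2 /= d20 Hd2] := nI.
  exists d2 => // y /Hd2[yb /= Ay]; split=> //.
  have -> : reC (A y) e = reC (A x) e - reC (A x - A y) e by rewrite /reC /=; ring.
  rewrite lerD2l lerN2; apply: (le_trans (ler_norm _)); apply: (le_trans (reC_le _ _)).
  rewrite ler_pdivlMr ?mulr_gt0// in Ay.
  apply: le_trans Ay; rewrite mulrCA ler_wpM2l// ler_wpM2l// lerDl//.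
pose dd := Num.min d1 d2 / (`|e| + 1).
have dd0 : 0 < dd by rewrite divr_gt0// lt_min d10 d20.
exists dd => // s s01 st.
set y := z + s *: e.
have yx : y - x = (s - t) *: e by rewrite /x /y opprD addrACA subrr add0r -scalerBl.
have yb' : ball x (Num.min d1 d2) y.
  rewrite -ball_normE /ball_ /= distrC yx normrZ.
  rewrite /dd ltr_pdivlMr// in st; apply: le_lt_trans st.
  by rewrite ler_wpM2l// lerDl.
have y1 : ball x d1 y by apply: le_ball yb'; rewrite ge_min lexx.
have y2 : ball x d2 y by apply: le_ball yb'; rewrite ge_min lexx orbT.
have x2 : ball x d2 x by exact: ballxx.
have [yb _] := Hd2 y y2.
have [Hf _] := Hd1 y y1.
have H3 : eps / 2 / (`|e| + 1) * `|y - x| <= eps / 2 * `|s - t|.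
  by rewrite yx normrZ; exact: eps_weight.
have neg (tau : R) : 0 <= tau -> lam2.-negligible (ball x d2 `&`
    [set x0 | (tau *: e).1 * g1 x0 + (tau *: e).2 * g2 x0 < tau * (reC (A x) e - eps / 2)]).
  move=> tau0; apply: null2S nl => y' [y'b /= lt]; have [y'c le] := Hd2 y' y'b; split=> //=.
  rewrite ltNge; apply/negP => le2; move: lt; apply/negP; rewrite -leNgt ?pairE.
  by rewrite -!mulrA -mulrDr ler_wpM2l// (le_trans le).
have Hf' : `|(f y).1 - (f x).1 - (s - t) * reC (A x) e| <= eps / 2 * `|s - t|.
  have := le_trans Hf H3.
  by have -> : reC (A x) (y - x) = (s - t) * reC (A x) e by rewrite yx /reC ?pairE; ring.
move: Hf'; rewrite ler_norml => /andP[Hf1 Hf2]; split=> ts.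
  have s0 : 0 <= s - t by rewrite subr_ge0.
  have yE : y = x + (s - t) *: e by rewrite -yx addrCA subrr addr0.
  have := P0 x x ((s - t) *: e) d2 ((s - t) * (reC (A x) e - eps / 2)).
  rewrite -yE => /(_ (cp _ xb) (cp _ yb) x2 y2 (neg _ s0)) HP.
  rewrite ger0_norm// in Hf1 Hf2.
  move: HP Hf1 Hf2; rewrite /k -/x -/y; clear.
  move: (phi y) (phi x) (f y).1 (f x).1 (reC _ _) => a1 a2 a3 a4 a5; lra.
have s0 : 0 <= t - s by rewrite subr_ge0.
have xE : x = y + (t - s) *: e by rewrite -opprB scaleNr -yx opprB addrCA subrr addr0.
have := P0 x y ((t - s) *: e) d2 ((t - s) * (reC (A x) e - eps / 2)).
rewrite -xE => /(_ (cp _ yb) (cp _ xb) y2 x2 (neg _ s0)) HP.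
rewrite ler0_norm ?subr_le0// in Hf1 Hf2.
move: HP Hf1 Hf2; rewrite /k -/x -/y; clear.
move: (phi y) (phi x) (f y).1 (f x).1 (reC _ _) => a1 a2 a3 a4 a5; lra.
Qed.

End potential_compare.

(** * A radial test function and its Laplacian *)

Section radial_test.
Context {R : realType}.
Variables (x0 : R * R) (b k : R).
Hypothesis k0 : 0 < k.

(** Squared Euclidean distance: [ball] is a square here, whereas the maximum principle works on
    round discs. *)
Definition sqd (c y : R * R) : R := (y.1 - c.1) ^+ 2 + (y.2 - c.2) ^+ 2.

Let q (y : R * R) : R := (b - sqd x0 y) / k.
(** A flat function of [sqd x0], supported in the disc of squared radius [b]. The scale [k] is free,
    and is taken large to make the Laplacian positive away from the centre. *)
Definition rad (P : {poly R}) (y : R * R) : R := flat P ((b - sqd x0 y) / k).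
Let l1 (y : R * R) : R := - (2 * (y.1 - x0.1)) / k.
Let l2 (y : R * R) : R := - (2 * (y.2 - x0.2)) / k.
Let P1 : {poly R} := 'X^2.
Let P2 : {poly R} := 'X^2 * ('X^2 - 'X *+ 2).

Let d1 (y v : R * R) : is_derive y v (fun y : R * R => y.1 - x0.1) v.1.
Proof.
have := is_deriveB (is_derive_fst y v) (is_derive_cst x0.1 y v).
by rewrite subr0.
Qed.

Let d2 (y v : R * R) : is_derive y v (fun y : R * R => y.2 - x0.2) v.2.
Proof.
have := is_deriveB (is_derive_snd y v) (is_derive_cst x0.2 y v).
by rewrite subr0.
Qed.

Let dl1 (y v : R * R) : is_derive y v l1 (- (2 * v.1) / k).
Proof.
have h : is_derive y v (fun y : R * R => (- 2 / k) * (y.1 - x0.1))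
    ((- 2 / k) * v.1 + (y.1 - x0.1) * 0).
  exact: (is_deriveM (is_derive_cst (- 2 / k) y v) (d1 y v)).
have <- : (fun y : R * R => (- 2 / k) * (y.1 - x0.1)) = l1.
  by apply/funext => z; rewrite /l1; ring.
by apply: (is_derive_eq h); ring.
Qed.

Let dl2 (y v : R * R) : is_derive y v l2 (- (2 * v.2) / k).
Proof.
have h : is_derive y v (fun y : R * R => (- 2 / k) * (y.2 - x0.2))
    ((- 2 / k) * v.2 + (y.2 - x0.2) * 0).
  exact: (is_deriveM (is_derive_cst (- 2 / k) y v) (d2 y v)).
have <- : (fun y : R * R => (- 2 / k) * (y.2 - x0.2)) = l2.
  by apply/funext => z; rewrite /l2; ring.
by apply: (is_derive_eq h); ring.
Qed.

Let dq (y v : R * R) : is_derive y v q (v.1 * l1 y + v.2 * l2 y).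
Proof.
have h : is_derive y v (fun y : R * R => (b - ((y.1 - x0.1) * (y.1 - x0.1) +
      (y.2 - x0.2) * (y.2 - x0.2))) * k^-1)
    ((b - ((y.1 - x0.1) * (y.1 - x0.1) + (y.2 - x0.2) * (y.2 - x0.2))) * 0 +
     k^-1 * (0 - ((y.1 - x0.1) * v.1 + (y.1 - x0.1) * v.1 +
       ((y.2 - x0.2) * v.2 + (y.2 - x0.2) * v.2)))).
  exact: (is_deriveM (is_deriveB (is_derive_cst b y v)
    (is_deriveD (is_deriveM (d1 y v) (d1 y v)) (is_deriveM (d2 y v) (d2 y v))))
    (is_derive_cst k^-1 y v)).
have -> : q = (fun y : R * R => (b - ((y.1 - x0.1) * (y.1 - x0.1) +
      (y.2 - x0.2) * (y.2 - x0.2))) * k^-1).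
  by apply/funext => z; rewrite /q /sqd !expr2.
by apply: (is_derive_eq h); rewrite /l1 /l2; ring.
Qed.

Let smooth_q : smooth q.
Proof.
have s1 : smooth (fun y : R * R => y.1 - x0.1) by apply: smoothD; [exact: smooth_fst|exact: smooth_cst].
have s2 : smooth (fun y : R * R => y.2 - x0.2) by apply: smoothD; [exact: smooth_snd|exact: smooth_cst].
have := smoothM (smooth_cst k^-1) (smoothD (smooth_cst b)
  (smoothM (smooth_cst (-1)) (smoothD (smoothM s1 s1) (smoothM s2 s2)))).
by congr smooth; apply/funext => y; rewrite /q /sqd !expr2; ring.
Qed.

Lemma smooth_rad P : smooth (rad P).
Proof. exact: smooth_flat smooth_q. Qed.

Let drad (P : {poly R}) (y v : R * R) : is_derive y v (rad P)
  (rad ('X^2 * (P - P^`())) y * (v.1 * l1 y + v.2 * l2 y)).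
Proof. exact: is_derive_comp1 (dq y v) (is_derive_flat P (q y)). Qed.

Let P1E : 'X^2 * (1 - (1 : {poly R})^`()) = P1.
Proof. by rewrite derivC subr0 mulr1. Qed.

Let P2E : 'X^2 * (P1 - P1^`()) = P2.
Proof. by rewrite /P1 derivXn. Qed.

Lemma rad_D1 : 'D_e1 (rad 1) = fun y => rad 'X^2 y * (- (2 * (y.1 - x0.1)) / k).
Proof.
apply/funext => y; have [_ ->] := drad 1 y e1.
by rewrite P1E /= mul1r mul0r addr0.
Qed.

Lemma rad_D2 : 'D_e2 (rad 1) = fun y => rad 'X^2 y * (- (2 * (y.2 - x0.2)) / k).
Proof.
apply/funext => y; have [_ ->] := drad 1 y e2.
by rewrite P1E /= mul1r mul0r add0r.
Qed.

Let dD1 (y v : R * R) : is_derive y v (fun y => rad P1 y * l1 y)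
  (rad P1 y * (- (2 * v.1) / k) + l1 y * (rad P2 y * (v.1 * l1 y + v.2 * l2 y))).
Proof.
have h := drad P1 y v; rewrite P2E in h.
exact: (is_deriveM h (dl1 y v)).
Qed.

Let dD2 (y v : R * R) : is_derive y v (fun y => rad P1 y * l2 y)
  (rad P1 y * (- (2 * v.2) / k) + l2 y * (rad P2 y * (v.1 * l1 y + v.2 * l2 y))).
Proof.
have h := drad P1 y v; rewrite P2E in h.
exact: (is_deriveM h (dl2 y v)).
Qed.

(** Both sides are read off the explicit first derivatives. The symmetry is what makes [Re f] weakly
    harmonic in [maximum_principle]. *)
Lemma rad_schwarz : 'D_e2 ('D_e1 (rad 1)) = 'D_e1 ('D_e2 (rad 1)).
Proof.
have E1 := rad_D1; have E2 := rad_D2; apply/funext => y.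
transitivity ('D_e2 (fun y => rad P1 y * l1 y) y); first by rewrite E1.
transitivity ('D_e1 (fun y => rad P1 y * l2 y) y); last by rewrite E2.
have [_ ->] := dD1 y e2; have [_ ->] := dD2 y e1.
by rewrite /=; ring.
Qed.

(** For [F = flat 1] and [q = (b - sqd x0 y) / k], this is [F''(q)] times the squared gradient
    [4 * sqd x0 y / k ^+ 2] of [q], plus [F'(q)] times its Laplacian [- 4 / k]. *)
Definition rad_lap (y : R * R) : R :=
  rad ('X^2 * ('X^2 - 'X *+ 2)) y * (4 * sqd x0 y / k ^+ 2) - rad 'X^2 y * (4 / k).

Lemma rad_lapE y : 'D_e1 ('D_e1 (rad 1)) y + 'D_e2 ('D_e2 (rad 1)) y = rad_lap y.
Proof.
have E1 := rad_D1; have E2 := rad_D2.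
transitivity ('D_e1 (fun y => rad P1 y * l1 y) y + 'D_e2 (fun y => rad P1 y * l2 y) y).
  by congr (_ + _); [rewrite E1|rewrite E2].
have [_ ->] := dD1 y e1; have [_ ->] := dD2 y e2.
rewrite /rad_lap /sqd /l1 /l2 /P1 /P2 /= !mul0r !mul1r !add0r !addr0 !mulr1.
by field; rewrite gt_eqF.
Qed.

Lemma rad_out P y : b <= sqd x0 y -> rad P y = 0.
Proof.
move=> by_; rewrite /rad /flat ifF//; apply/negbTE; rewrite -leNgt.
by rewrite pmulr_lle0 ?invr_gt0// subr_le0.
Qed.

Lemma rad_ge0 y : 0 <= rad 1 y.
Proof. exact: bump0_ge0. Qed.

(** With [s = sqd x0 y] and [d = b - s], the Laplacian is a positive factor times
    [s * (k - 2 * d) - d ^+ 2]. *)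
Lemma rad_lap_gt0 y : sqd x0 y < b ->
  (b - sqd x0 y) ^+ 2 < sqd x0 y * (k - 2 * (b - sqd x0 y)) -> 0 < rad_lap y.
Proof.
move=> sb h; set s := sqd x0 y in sb h *; set d := b - s in h.
have d0 : 0 < d by rewrite subr_gt0.
have t0 : 0 < d / k by rewrite divr_gt0.
rewrite /rad_lap /rad -/s -/d /flat t0 hornerM hornerD hornerN hornerXn hornerMn hornerX.
have E : (d / k)^-1 ^+ 2 * ((d / k)^-1 ^+ 2 - (d / k)^-1 *+ 2) *
   expR (- (d / k)^-1) * (4 * s / k ^+ 2) - (d / k)^-1 ^+ 2 * expR (- (d / k)^-1) * (4 / k)
   = expR (- (d / k)^-1) * (4 * k / d ^+ 4) * (s * (k - 2 * d) - d ^+ 2).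
  by field; rewrite !gt_eqF.
have pos : 0 < expR (- (d / k)^-1) * (4 * k / d ^+ 4) * (s * (k - 2 * d) - d ^+ 2).
  by rewrite !mulr_gt0 ?expR_gt0 ?invr_gt0 ?exprn_gt0 ?subr_gt0.
by rewrite E.
Qed.

Lemma continuous_sqd : continuous (sqd x0).
Proof.
move=> y; have c1 : continuous (fun y : R * R => y.1 - x0.1).
  by move=> z; apply: cvgB; [exact: cvg_fst|exact: cvg_cst].
have c2 : continuous (fun y : R * R => y.2 - x0.2).
  by move=> z; apply: cvgB; [exact: cvg_snd|exact: cvg_cst].
rewrite /sqd; apply: cvgD; rewrite /=.
  have -> : (fun y : R * R => (y.1 - x0.1) ^+ 2) = (fun y => (y.1 - x0.1) * (y.1 - x0.1)).
    by apply/funext => z; rewrite expr2.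
  by rewrite expr2; apply: cvgM; exact: c1.
have -> : (fun y : R * R => (y.2 - x0.2) ^+ 2) = (fun y => (y.2 - x0.2) * (y.2 - x0.2)).
  by apply/funext => z; rewrite expr2.
by rewrite expr2; apply: cvgM; exact: c2.
Qed.

Lemma rad_test (N : set (R * R)) : (forall y, sqd x0 y <= b -> N y) -> test_on N (rad 1).
Proof.
(* [a ^+ 2 <= b] forces the absolute value of [a] to be at most 1 or at most [b], so no square root
   is needed. *)
move=> bN; pose B : R := `|b| + 1.
have B0 : 0 <= B by rewrite addr_ge0.
pose K := `[x0.1 - B, x0.1 + B]%classic `*` `[x0.2 - B, x0.2 + B]%classic.
apply: (@test_onW _ _ (K `&` [set y | sqd x0 y <= b])).
- exact: smooth_rad.
- have cK : compact K by apply: compact_setX; exact: segment_compact.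
  apply: (subclosed_compact _ cK); last by move=> y [].
  apply: closedI; first exact: (compact_closed2 cK).
  have -> : [set y | sqd x0 y <= b] = sqd x0 @^-1` [set z | z <= b] by [].
  by apply: preimage_closed => [y _|]; [exact: continuous_sqd|exact: closed_le].
- by move=> y [_ /bN].
- move=> y ry; have sb : sqd x0 y <= b.
    by rewrite leNgt; apply: contra ry => /ltW/rad_out ->.
  split=> //; have h (a : R) : a ^+ 2 <= b -> `|a| <= B.
    move=> ab; have [a1|a1] := leP `|a| 1.
      by apply: (le_trans a1); rewrite /B lerDr.
    apply: (@le_trans _ _ (`|a| ^+ 2)).
      by rewrite expr2 ler_peMl// ltW.
    rewrite -normrX ger0_norm ?sqr_ge0//; apply: (le_trans ab).
    by rewrite /B (le_trans (ler_norm b))// lerDl.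
  have a1 : `|y.1 - x0.1| <= B.
    by apply: h; apply: le_trans sb; rewrite /sqd lerDl sqr_ge0.
  have a2 : `|y.2 - x0.2| <= B.
    by apply: h; apply: le_trans sb; rewrite /sqd lerDr sqr_ge0.
  by move: a1 a2; rewrite /K /= !in_itv /= !ler_norml; lra.
Qed.

End radial_test.

(** * Strong maximum principle on a disc *)

Section maximum_principle.
Context {R : realType}.
Local Notation T2 := (measurableTypeR R * measurableTypeR R)%type.

Lemma test_mul_continuous (N : set (R * R)) (a chi : R * R -> R) :
  (forall x, N x -> {for x, continuous a}) -> test_on N chi ->
  continuous (fun x => a x * chi x).
Proof.
move=> ca tt x; have [Nx|Nx] := pselect (N x).
  by apply: cvgM; [exact: ca|exact: (test_continuous tt)].
rewrite /continuous_at (test_out0 tt Nx) mulr0.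
have := test_out tt Nx => h; apply: cvg_near_cst.
by move: h; apply: filterS => y ->; rewrite mulr0.
Qed.

Lemma test_mul_integrable_bounded (N : set (R * R)) (a chi : R * R -> R) (C : R) :
  (forall x, N x -> {for x, continuous a}) -> (forall x, N x -> `|a x| <= C) ->
  test_on N chi -> lam2.-integrable setT (EFin \o (fun x => a x * chi x)).
Proof.
move=> ca aC tt; have [D D0 HD] := test_bounded tt; have [r r0 Hr] := test_support tt.
apply: (@bounded_support_integrable _ _ 0 r (`|C| * D) r0
  (continuous_measurable2 (test_mul_continuous ca tt))).
  move=> x; have [Nx|Nx] := pselect (N x).
    by rewrite normrM ler_pM// (le_trans (aC _ Nx))// ler_norm.
  by rewrite (test_out0 tt Nx) mulr0 normr0 mulr_ge0.
by move=> x /Hr ->; rewrite mulr0.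
Qed.

Lemma lipschitz_continuous (p : R * R) (r : R) (u : R * R -> R) (L : R) :
  (forall x y, ball p r x -> ball p r y -> `|u x - u y| <= L * `|x - y|) ->
  forall x, ball p r x -> {for x, continuous u}.
Proof.
move=> uL x xb; apply/cvgrPdist_le => e e0.
have /nbhs_ballP[d /= d0 dN] : nbhs x (ball p r).
  by apply: open_nbhs_nbhs; split=> //; exact: ball_open.
have L1 : 0 < `|L| + 1 by rewrite ltr_wpDl.
suff : nbhs x [set y | `|u x - u y| <= e] by [].
apply/nbhs_ballP; exists (Num.min d (e / (`|L| + 1))) => /=.
  by rewrite lt_min d0 divr_gt0.
move=> y yb; have Ny : ball p r y by apply: dN; apply: le_ball yb; rewrite ge_min lexx.
apply: (le_trans (uL _ _ xb Ny)).
have h : `|x - y| <= e / (`|L| + 1).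
  move: yb; rewrite -ball_normE /ball_ /= lt_min => /andP[_ h]; exact: ltW.
have := ler_wpM2l (ltW L1) h; rewrite mulrCA mulfV ?mulr1 ?gt_eqF//.
by apply: le_trans; rewrite ler_wpM2r// (le_trans (ler_norm L))// lerDl.
Qed.

Lemma lipschitz_bounded (p : R * R) (r : R) (u : R * R -> R) (L : R) : 0 < r ->
  (forall x y, ball p r x -> ball p r y -> `|u x - u y| <= L * `|x - y|) ->
  forall x, ball p r x -> `|u x| <= `|u p| + `|L| * r.
Proof.
move=> r0 uL x xb; have pb : ball p r p by exact: ballxx.
rewrite -[u x](subrK (u p)) addrC; apply: (le_trans (ler_normD _ _)); rewrite lerD2l.
apply: (le_trans (uL _ _ xb pb)).
apply: (@le_trans _ _ (`|L| * `|x - p|)); first by rewrite ler_wpM2r// ler_norm.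
by rewrite ler_wpM2l// ltW//; move: xb; rewrite -ball_normE /= distrC.
Qed.

(* With this [k] the bump [rad x0 b k 1] is strictly subharmonic where
   [eta <= sqd x0 y < b]. *)
Lemma subharmonic_gap (eta b s k : R) : 0 < eta -> eta <= s -> s < b ->
  k = 2 * b + b ^+ 2 / eta + 1 ->
  (b - s) ^+ 2 < s * (k - 2 * (b - s)).
Proof.
move=> eta0 es sb ->; have b0 : 0 < b by lra.
have E : b ^+ 2 <= s * (b ^+ 2 / eta).
  rewrite mulrA ler_pdivlMr// mulrC ler_wpM2r ?sqr_ge0//.
have E2 : (b - s) ^+ 2 <= b ^+ 2 by rewrite ler_pXn2r// ?nnegrE; lra.
have s0 : 0 < s by lra.
have -> : s * (2 * b + b ^+ 2 / eta + 1 - 2 * (b - s)) =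
    s * (b ^+ 2 / eta) + (s + 2 * (s * s)) by ring.
apply: (le_lt_trans E2); apply: (le_lt_trans E); rewrite ltrDl.
by rewrite addr_gt0// !mulr_gt0.
Qed.

Lemma weak_laplacian_arith (P1 P2 a1 a2 J1 J2 G1 G2 : R) : G1 = P1 - a1 -> G1 = - J1 ->
  G2 = P2 + a2 -> G2 = - J2 -> a1 = a2 -> P1 + P2 <= 0 -> - 1 * (J1 + J2) <= 0.
Proof. lra. Qed.

(** Put [w = phi - Re f - c]. Testing subharmonicity against [psi = rad x0 b k 1] shows that [- w]
    times the Laplacian of [psi] has integral at most 0. This product is nonnegative: [w] vanishes
    where [sqd x0 y < eta], and elsewhere in the disc [w <= 0] while the Laplacian is positive. By
    continuity it is identically 0, so [w y = 0]. *)
Lemma maximum_principle (phi g1 g2 : R * R -> R) (f A : R * R -> R * R)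
    (p x0 : R * R) (r C L b0 eta c : R) : 0 < r ->
  (forall x, ball p r x -> holo_at f x (A x) /\ {for x, continuous A}) ->
  (forall x, ball p r x -> `|A x| <= C) ->
  (forall x y, ball p r x -> ball p r y -> `|phi x - phi y| <= L * `|x - y|) ->
  lam2.-negligible (ball p r `&`
    [set x | ~ (is_derive x e1 phi (g1 x) /\ is_derive x e2 phi (g2 x))]) ->
  lam2.-integrable setT (EFin \o g1) -> lam2.-integrable setT (EFin \o g2) ->
  (forall psi, test_on (ball p r) psi -> (forall x, 0 <= psi x) ->
     pair2 g1 ('D_e1 psi) + pair2 g2 ('D_e2 psi) <= 0) ->
  (forall y, sqd x0 y < b0 -> ball p r y) -> 0 < eta ->
  (forall y, sqd x0 y < b0 -> phi y - (f y).1 <= c) ->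
  (forall y, sqd x0 y < eta -> phi y - (f y).1 = c) ->
  forall y, sqd x0 y < b0 -> phi y - (f y).1 = c.
Proof.
move=> r0 hf AC phiL nd ig1 ig2 sub disc eta0 wle weq y yb0.
have [/weq//|ey] := ltP (sqd x0 y) eta.
(* A slightly smaller disc that still contains [y] gives [psi] a support inside the open disc. *)
have [b yb bb0] : exists2 b : R, sqd x0 y < b & b < b0.
  by exists ((sqd x0 y + b0) / 2); move: yb0; move: (sqd x0 y) => s; lra.
have b_gt0 : 0 < b by apply: lt_trans yb; apply: lt_le_trans ey.
pose k : R := 2 * b + b ^+ 2 / eta + 1.
have k0 : 0 < k.
  by rewrite /k ltr_wpDl// addr_ge0 ?divr_ge0 ?sqr_ge0 ?(ltW eta0)// mulr_ge0// ltW.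
pose psi := rad x0 b k 1.
have tpsi : test_on (ball p r) psi.
  by apply: rad_test => // z zb; apply: disc; exact: le_lt_trans bb0.
have [t1 t2] := test_derive tpsi.
have [t11 t21] := test_derive t1; have [t12 t22] := test_derive t2.
have s1 := smooth_derive1 tpsi.1; have s2 := smooth_derive2 tpsi.1.
have ob : open (ball p r) by exact: ball_open.
have pb : ball p r p by exact: ballxx.
have hol z : ball p r z -> holo_at f z (A z) by move=> /hf[].
have fL := holo_lipschitz hol AC.
pose w z := phi z - (f z).1 - c.
have w0 z : sqd x0 z < eta -> w z = 0 by move=> /weq; rewrite /w => ->; rewrite subrr.
have wle0 z : sqd x0 z < b -> w z <= 0.
  by move=> zb; rewrite /w subr_le0; apply: wle; exact: lt_trans bb0.
have wL z z' : ball p r z -> ball p r z' -> `|w z - w z'| <= (L + 2 * C) * `|z - z'|.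
  move=> zb zb'; have -> : w z - w z' = (phi z - phi z') - ((f z).1 - (f z').1).
    by rewrite /w; ring.
  rewrite mulrDl; apply: (le_trans (ler_normB _ _)).
  by rewrite lerD ?phiL//; have [] := fL _ _ zb' zb.
have wB := lipschitz_bounded r0 wL.
have iL z z' : ball p r z -> ball p r z' -> `|(f z).2 - (f z').2| <= 2 * C * `|z - z'|.
  by move=> zb zb'; have [] := fL _ _ zb' zb.
have iB := lipschitz_bounded r0 iL.
have cA1 z : ball p r z -> {for z, continuous (fun z => (A z).1)}.
  by move=> /hf[_ cA]; apply: cvg_comp cA _; exact: cvg_fst.
have cA2 z : ball p r z -> {for z, continuous (fun z => (A z).2)}.
  by move=> /hf[_ cA]; apply: cvg_comp cA _; exact: cvg_snd.
have A1C z : ball p r z -> `|(A z).1| <= C.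
  by move=> /AC; apply: le_trans; have [] := norm2_ge (A z).
have A2C z : ball p r z -> `|(A z).2| <= C.
  by move=> /AC; apply: le_trans; have [] := norm2_ge (A z).
have iA1 := test_mul_integrable_bounded cA1 A1C t1.
have iA2 := test_mul_integrable_bounded cA2 A2C t2.
have [D1 D10 HD1] := test_bounded t1; have [D2 D20 HD2] := test_bounded t2.
have ip1 := integrableM_bounded ig1 (continuous_measurable2 (test_continuous t1)) HD1.
have ip2 := integrableM_bounded ig2 (continuous_measurable2 (test_continuous t2)) HD2.
have iw1 : lam2.-integrable setT (EFin \o (fun x => (g1 x - (A x).1) * 'D_e1 psi x)).
  have -> : (fun x => (g1 x - (A x).1) * 'D_e1 psi x) =
      (fun x => g1 x * 'D_e1 psi x - (A x).1 * 'D_e1 psi x).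
    by apply/funext => x; rewrite mulrBl.
  exact: (integrableB (@measurableT _ T2) ip1 iA1).
have iw2 : lam2.-integrable setT (EFin \o (fun x => (g2 x + (A x).2) * 'D_e2 psi x)).
  have -> : (fun x => (g2 x + (A x).2) * 'D_e2 psi x) =
      (fun x => g2 x * 'D_e2 psi x + (A x).2 * 'D_e2 psi x).
    by apply/funext => x; rewrite mulrDl.
  exact: (integrableD (@measurableT _ T2) ip2 iA2).
have dw v z g : ball p r z -> is_derive z v phi g ->
    is_derive z v w (g - reC (A z) v).
  move=> zb hg; have [h _] := holo_is_derive v (hol z zb).
  have := is_deriveB (is_deriveB hg h) (is_derive_cst c z v).
  by rewrite subr0.
have nw1 : lam2.-negligible (ball p r `&` [set x | ~ is_derive x e1 w (g1 x - (A x).1)]).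
  apply: null2S nd => x [xb nx]; split=> // -[h _]; apply: nx.
  by apply: (is_derive_eq (dw _ _ _ xb h)); rewrite /reC /=; ring.
have nw2 : lam2.-negligible (ball p r `&` [set x | ~ is_derive x e2 w (g2 x + (A x).2)]).
  apply: null2S nd => x [xb nx]; split=> // -[_ h]; apply: nx.
  by apply: (is_derive_eq (dw _ _ _ xb h)); rewrite /reC /=; ring.
have ni1 : lam2.-negligible (ball p r `&` [set x | ~ is_derive x e2 (fun x => (f x).2) (A x).1]).
  apply: null2_empty => x [xb]; apply; have [_ h] := holo_is_derive e2 (hol x xb).
  by apply: (is_derive_eq h); rewrite /imC /=; ring.
have ni2 : lam2.-negligible (ball p r `&` [set x | ~ is_derive x e1 (fun x => (f x).2) (A x).2]).
  apply: null2_empty => x [xb]; apply; have [_ h] := holo_is_derive e1 (hol x xb).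
  by apply: (is_derive_eq h); rewrite /imC /=; ring.
have [jw1 E1] := integration_by_parts ob wB wL nw1 t1 t11
  (fun x => (smooth_is_derive x s1).1) iw1.
have [jw2 E2] := integration_by_parts ob wB wL nw2 t2 t22
  (fun x => (smooth_is_derive x s2).2) iw2.
(* [Re f] is weakly harmonic through its conjugate: the components of [A] are partial derivatives of
   [Im f], so both integrals become integrals of [Im f] against a mixed second derivative of
   [psi]. *)
have [_ E3] := integration_by_parts ob iB iL ni1 t1 t21
  (fun x => (smooth_is_derive x s1).2) iA1.
have [_ E4] := integration_by_parts ob iB iL ni2 t2 t12
  (fun x => (smooth_is_derive x s2).1) iA2.
have SC : 'D_e2 ('D_e1 psi) = 'D_e1 ('D_e2 psi) by exact: rad_schwarz.
have {E4}E3 := etrans E3 (etrans (congr1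
  (fun h => - Rintegral lam2 setT (fun x => (f x).2 * h x)) SC) (esym E4)).
have E1' : Rintegral lam2 setT (fun x => (g1 x - (A x).1) * 'D_e1 psi x) =
    pair2 g1 ('D_e1 psi) - Rintegral lam2 setT (fun x => (A x).1 * 'D_e1 psi x).
  rewrite /pair2 -[RHS](Rint2B ip1 iA1); congr (Rintegral _ _ _).
  by apply/funext => x; rewrite mulrBl.
have E2' : Rintegral lam2 setT (fun x => (g2 x + (A x).2) * 'D_e2 psi x) =
    pair2 g2 ('D_e2 psi) + Rintegral lam2 setT (fun x => (A x).2 * 'D_e2 psi x).
  rewrite /pair2 -[RHS](Rint2D ip2 iA2); congr (Rintegral _ _ _).
  by apply/funext => x; rewrite mulrDl.
have S := sub psi tpsi (rad_ge0 x0 b k).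
pose F x := - 1 * (w x * 'D_e1 ('D_e1 psi) x + w x * 'D_e2 ('D_e2 psi) x).
have FE x : F x = - w x * rad_lap x0 b k x.
  by rewrite /F -mulrDr [X in _ * (_ * X)](rad_lapE x0 b k0); ring.
have jw : lam2.-integrable setT
    (EFin \o (fun x => w x * 'D_e1 ('D_e1 psi) x + w x * 'D_e2 ('D_e2 psi) x)).
  exact: (integrableD (@measurableT _ T2) jw1 jw2).
have iF : lam2.-integrable setT (EFin \o F).
  exact: (integrableZl (@measurableT _ T2) (- 1) jw).
have intF : Rintegral lam2 setT F <= 0.
  rewrite [X in X <= _](Rint2Z _ jw) (Rint2D jw1 jw2).
  exact: (weak_laplacian_arith E1' E1 E2' E2 E3 S).
have wc z : ball p r z -> {for z, continuous w}.
  exact: lipschitz_continuous wL z.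
have cF : continuous F.
  have c11 := test_mul_continuous wc t11; have c22 := test_mul_continuous wc t22.
  by move=> z; apply: cvgM; [exact: cvg_cst|apply: cvgD; [exact: c11|exact: c22]].
have lapp z : eta <= sqd x0 z -> sqd x0 z < b -> 0 < rad_lap x0 b k z.
  by move=> ez zb; exact: (rad_lap_gt0 k0 zb (subharmonic_gap eta0 ez zb (erefl k))).
have F0 z : 0 <= F z.
  rewrite FE; have [ze|ez] := ltP (sqd x0 z) eta.
    by rewrite (w0 _ ze) oppr0 mul0r; exact: lexx.
  have [zb|bz] := ltP (sqd x0 z) b.
    have wz := wle0 _ zb; rewrite -oppr_ge0 in wz; exact: mulr_ge0 wz (ltW (lapp _ ez zb)).
  by rewrite /rad_lap !(rad_out k0 _ bz) !mul0r subrr mulr0; exact: lexx.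
have := continuous_Rintegral_eq0 cF iF F0 intF y.
rewrite FE => /eqP; rewrite mulf_eq0 (gt_eqF (lapp _ ey yb)) orbF oppr_eq0 subr_eq0.
by move/eqP => wy; exact: wy.
Qed.

End maximum_principle.

(** * Euclidean discs against squares, and small steps *)

Section squared_distance.
Context {R : realType}.

Lemma sqd_lt_ball (c y : R * R) (eta : R) : 0 < eta -> sqd c y < eta ^+ 2 -> ball c eta y.
Proof.
move=> eta0 h; apply/ball2P; split; rewrite -[ltRHS]gtr0_norm// -ltr_sqr ?nnegrE//;
  rewrite real_normK ?num_real// real_normK ?num_real//.
  by apply: le_lt_trans h; rewrite /sqd lerDl sqr_ge0.
by apply: le_lt_trans h; rewrite /sqd lerDr sqr_ge0.
Qed.

Lemma sqd_small_step (E : R * R) (h : R) : 0 < h ->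
  exists n : nat, sqd 0 (n.+1%:R^-1 *: E) < h.
Proof.
move=> h0; pose s := sqd 0 E; have s0 : 0 <= s by rewrite addr_ge0 ?sqr_ge0.
exists (Num.truncn (s / h)); set n := (Num.truncn (s / h)).+1.
have n1 : s / h < n%:R by exact: truncnS_gt.
have E1 : sqd 0 (n%:R^-1 *: E) = s / n%:R ^+ 2.
  by rewrite /s /sqd ?pairE /=; field; rewrite pnatr_eq0.
rewrite E1 ltr_pdivrMr ?exprn_gt0// mulrC -ltr_pdivrMr//.
apply: (lt_le_trans n1); rewrite expr2 ler_peMl//.
by rewrite ler1n.
Qed.

End squared_distance.

(** * Propagation of the maximum along a cone *)

Section propagation.
Context {R : realType}.
Local Notation T2 := (measurableTypeR R * measurableTypeR R)%type.
Variables (phi g1 g2 : R * R -> R) (f A : R * R -> R * R) (p : R * R) (r C L : R).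
Hypothesis r0 : 0 < r.
Hypothesis hf : forall x, ball p r x -> holo_at f x (A x) /\ {for x, continuous A}.
Hypothesis AC : forall x, ball p r x -> `|A x| <= C.
Hypothesis phiL : forall x y, ball p r x -> ball p r y -> `|phi x - phi y| <= L * `|x - y|.
Hypothesis nd : lam2.-negligible (ball p r `&`
  [set x | ~ (is_derive x e1 phi (g1 x) /\ is_derive x e2 phi (g2 x))]).
Hypothesis ig1 : lam2.-integrable setT (EFin \o g1).
Hypothesis ig2 : lam2.-integrable setT (EFin \o g2).
Hypothesis sub : forall psi, test_on (ball p r) psi -> (forall x, 0 <= psi x) ->
  pair2 g1 ('D_e1 psi) + pair2 g2 ('D_e2 psi) <= 0.

Let u z := phi z - (f z).1.

(** A disc of squared radius [h] is moved from [q] to [q - E] in steps so short that each centre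
    lies in the previous disc. On the new disc [u <= c], because one step forward leads into the
    previous disc, where [u = c]; near the new centre [u = c] already; the maximum principle does
    the rest. *)
Lemma maximum_propagates (q E : R * R) (h c : R) : 0 < h ->
  (forall t y, 0 <= t <= 1 -> ball p r y -> ball p r (y + t *: E) -> u y <= u (y + t *: E)) ->
  (forall t y, 0 <= t <= 1 -> sqd (q - t *: E) y < h -> ball p r y) ->
  (forall y, sqd q y < h -> u y = c) -> u (q - E) = c.
Proof.
move=> h0 mono inb uq; have [n0 nE] := sqd_small_step E h0.
pose n := n0.+1; have np : 0 < n%:R :> R by rewrite ltr0n.
have tm m : (m <= n)%N -> 0 <= (m%:R / n%:R : R) <= 1.
  by move=> mn; rewrite divr_ge0//= ler_pdivrMr// mul1r ler_nat.
suff H m : (m <= n)%N -> forall y, sqd (q - (m%:R / n%:R) *: E) y < h -> u y = c.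
  have := H n (leqnn n) (q - E); rewrite divff ?gt_eqF// scale1r; apply.
  by rewrite /sqd !subrr !expr0n addr0.
elim: m => [_ y|m IH mn]; first by rewrite mul0r scale0r subr0; exact: uq.
pose x0 := q - (m.+1%:R / n%:R) *: E; pose x1 := q - (m%:R / n%:R) *: E.
have x01 : x1 = x0 + n%:R^-1 *: E.
  rewrite /x0 /x1 -natr1 mulrDl mul1r scalerDl opprD -!addrA; congr (_ + _).
  by rewrite addNr addr0.
have shift y : sqd x1 (y + n%:R^-1 *: E) = sqd x0 y.
  by rewrite x01 /sqd ?pairE; congr (_ ^+ 2 + _ ^+ 2); ring.
have x0h : sqd x1 x0 < h.
  apply: le_lt_trans nE; rewrite x01 /sqd ?pairE /= !subr0 le_eqVlt; apply/orP; left; apply/eqP.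
  by ring.
have oD : open [set y | sqd x1 y < h].
  have -> : [set y | sqd x1 y < h] = sqd x1 @^-1` [set z | z < h] by [].
  by move/continuousP: (@continuous_sqd R x1); apply; exact: open_lt.
have /nbhs_ballP[d /= d0 dD] : nbhs x0 [set y | sqd x1 y < h] by exact: open_nbhs_nbhs.
(* The Euclidean disc of radius [d] around [x0] lies in [ball x0 d], hence in the previous disc. *)
apply: (maximum_principle (eta := d ^+ 2) r0 hf AC phiL nd ig1 ig2 sub).
- by move=> y; apply: inb; exact: tm.
- by rewrite exprn_gt0.
- move=> y yh; have yh' : sqd x1 (y + n%:R^-1 *: E) < h by rewrite shift.
  rewrite -(IH (ltnW mn) _ yh'); apply: mono.
  + by rewrite invr_ge0 ler0n/= invf_le1// ler1n.
  + exact: (inb _ _ (tm _ mn) yh).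
  + exact: (inb _ _ (tm _ (ltnW mn)) yh').
- move=> y /(sqd_lt_ball d0)/dD yh; exact: (IH (ltnW mn) _ yh).
Qed.

(* Moving along the cone around [e0] increases [u]; in the opposite direction the
   maximum principle propagates the value that [u] takes near a point of [M]. *)
Lemma cone_minimum (M : set (R * R)) (e0 : R * R) (delta : R) : 0 < delta ->
  (forall s z e, 0 <= s -> ball p r z -> ball p r (z + e) -> `|e - s *: e0| <= s * delta ->
     u z <= u (z + e)) ->
  (forall q, M q -> ball p r q -> exists2 d : R, 0 < d & forall z, ball q d z -> u z = u q) ->
  closure M p ->
  exists2 d : R, 0 < d & forall z, ball p d z -> u p <= u z /\ (M z -> u z = u p).
Proof.
move=> delta0 mono loc clM.
(* Small enough for [w = p - T *: e0] to stay in [ball p (r / 2)]; the [+ 1] covers [e0 = 0]. *)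
pose T : R := r / (4 * (`|e0| + 1)).
have e01 : 0 < `|e0| + 1 by rewrite ltr_wpDl.
have T0 : 0 < T by rewrite divr_gt0// mulr_gt0.
have Te : T * `|e0| < r / 2.
  have : T * (4 * (`|e0| + 1)) = r by rewrite /T divfK// gt_eqF// mulr_gt0.
  by move: T0 (normr_ge0 e0) r0; move: `|e0| T r => a b c ? ? ?; nra.
pose w := p - T *: e0.
have r20 : 0 < r / 2 by rewrite divr_gt0.
have wb2 : ball p (r / 2) w.
  by rewrite -ball_normE /ball_ /= /w opprB addrCA subrr addr0 normrZ gtr0_norm.
have half z : ball p (r / 2) z -> ball p r z.
  by apply: le_ball; move: r0; lra.
(* For [z] this close to [p], the vector [z - w] differs from [T *: e0] by at most [T * delta], so
   it lies in the cone. *)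
pose d : R := Num.min (T * delta) (r / 2).
have d0 : 0 < d by rewrite lt_min mulr_gt0.
have dE z : ball p d z -> ball p (r / 2) z /\ `|z - p| <= T * delta.
  move=> zd; split; first by apply: le_ball zd; rewrite ge_min lexx orbT.
  by move: zd; rewrite -ball_normE /ball_ /= distrC lt_min => /andP[/ltW].
have wz z : z - w = (z - p) + T *: e0 by rewrite /w opprB addrA addrAC.
have low z : ball p d z -> u w <= u z.
  move=> /dE[zb zp]; have {1}-> : z = w + (z - w) by rewrite addrCA subrr addr0.
  apply: (mono T) => //; [exact: ltW|exact: half| |].
    by rewrite addrCA subrr addr0; exact: half.
  by rewrite wz addrK.
have eqM q : M q -> ball p d q -> u q = u w.
  move=> Mq /dE[qb qp]; have [d1 d10 Hd1] := loc q Mq (half _ qb).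
  (* [u] is constant on the starting disc, and since the centres stay in [ball p (r / 2)], the
     moving discs stay in [ball p r]. *)
  pose eta : R := Num.min d1 (r / 2).
  have eta0 : 0 < eta by rewrite lt_min d10 r20.
  have qw : w = q - (q - w) by rewrite opprB addrCA subrr addr0.
  rewrite [in RHS]qw; apply/esym; apply: (@maximum_propagates _ _ (eta ^+ 2)).
  - by rewrite exprn_gt0.
  - move=> t y /andP[t0 t1] yb ytb; apply: (mono (t * T)) => //.
      by rewrite mulr_ge0// ltW.
    rewrite -scalerA -scalerBr wz addrK normrZ ger0_norm// -mulrA.
    by rewrite ler_wpM2l.
  - move=> t y t01 /(sqd_lt_ball eta0) yb.
    have cb : ball p (r / 2) (q + t *: (w - q)).
      by apply: ball_segment => //; rewrite addrCA subrr addr0.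
    have yb' : ball (q + t *: (w - q)) (r / 2) y.
      have -> : q + t *: (w - q) = q - t *: (q - w) by rewrite -scalerN opprB.
      by apply: le_ball yb; rewrite ge_min lexx orbT.
    by have := ball_triangle cb yb'; rewrite -splitr.
  - move=> y /(sqd_lt_ball eta0) yb; apply: Hd1; apply: le_ball yb.
    by rewrite ge_min lexx.
(* Otherwise [u > u w] on a neighbourhood of [p], which contains points of [M], where [u = u w]. *)
have upw : u p = u w.
  apply/eqP; rewrite eq_le low ?andbT; last exact: ballxx.
  rewrite leNgt; apply/negP => lt.
  have cu : {for p, continuous u}.
    have pb := ballxx p r0; apply: cvgB; first exact: (lipschitz_continuous phiL).
    have cf := holo_continuous (hf pb).1; by apply: cvg_comp cf _; exact: cvg_fst.
  have nu : nbhs p [set z | u w < u z].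
    have n1 : nbhs (u p) [set t | u w < t].
      by apply: open_nbhs_nbhs; split=> //; exact: open_gt.
    exact: (cu _ n1).
  have nb : nbhs p (ball p d) by exact: nbhsx_ballx.
  have [z [Mz [/= uz zd]]] := clM _ (filterI nu nb).
  by move: uz; rewrite (eqM z Mz zd) ltxx.
exists d => // z zd; rewrite upw; split; first exact: low.
by move=> Mz; exact: eqM.
Qed.

End propagation.

(** * Local integrability, local negligibility, and local properties of the potential *)

Section local_facts.
Context {R : realType}.
Local Notation T2 := (measurableTypeR R * measurableTypeR R)%type.

Lemma continuous_in_measurable2 (U : set (R * R)) (f : R * R -> R) : open U ->
  (forall x, U x -> {for x, continuous f}) -> measurable_fun (U : set T2) f.
Proof.
move=> oU cf; apply: (measurability _ (RGenOpens.measurableE R)).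
move=> _ [_ [a [b ->] <-]]; apply: open_measurable2; rewrite openE => x [Ux fx].
have nU : nbhs x U by exact: open_nbhs_nbhs.
have nf : nbhs x (f @^-1` `]a, b[%classic).
  by apply: (cf x Ux); apply: open_nbhs_nbhs; split=> //; exact: interval_open.
exact: (filterI nU nf).
Qed.

Lemma continuous_in_compact_integrable (U K : set (R * R)) (f : R * R -> R) : open U ->
  (forall x, U x -> {for x, continuous f}) -> compact K -> K `<=` U ->
  lam2.-integrable K (EFin \o f).
Proof.
move=> oU cf cK KU; have mK : measurable (K : set T2).
  by apply: closed_measurable2; exact: compact_closed2.
apply: measurable_bounded_integrable => //.
- have [B [_ HB]] := compact_bounded cK.
  have B0 : 0 <= `|B| + 2 by rewrite addr_ge0.
  have KB : K `<=` ball (0 : R * R) (`|B| + 2).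
    move=> x Kx; rewrite -ball_normE /ball_ /= sub0r normrN.
    have h := HB (`|B| + 1) _ x Kx; apply: (le_lt_trans (h _)).
      by rewrite ltr_pwDr// ler_norm.
    by rewrite ltrD2l ltr1n.
  have le : (lam2 K <= lam2 (ball (0%R : R * R) (`|B| + 2)))%E.
    apply: (le_measure (lam2 : {measure set T2 -> \bar R})); rewrite ?inE//.
    exact: measurable_ball2.
  apply: (le_lt_trans le).
  exact: (eq_ind_r (fun x => (x < +oo)%E) (ltry _) (lam2_ball 0 B0)).
- apply: measurable_funS (continuous_in_measurable2 oU cf) => //.
  exact: open_measurable2.
- have cfK : compact (f @` K).
    apply: continuous_compact cK; apply: continuous_in_subspaceT => x.
    by rewrite inE => /KU; exact: cf.
  have [B [Br HB]] := compact_bounded cfK.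
  by exists B; split=> // N BN x Kx; apply: HB BN _ _; exists x.
Qed.

(** Lindelof argument: countably many basis squares with negligible trace on [S] cover [O]. *)
Lemma null2_local (O S : set (R * R)) :
  (forall x, O x -> exists N, open N /\ N x /\ lam2.-negligible (N `&` S : set T2)) ->
  lam2.-negligible (O `&` S : set T2).
Proof.
move=> H; have [c [e [e0 ce]]] := @countable_ball_base R.
pose F n : set (R * R) :=
  [set x | lam2.-negligible (ball (c n) (e n) `&` S : set T2) /\ (ball (c n) (e n) `&` S) x].
apply: (@null2S _ _ (\bigcup_n F n)).
  move=> x [Ox Sx]; have [N [oN [Nx nN]]] := H x Ox.
  have [n [xn nN']] := ce _ _ oN Nx; exists n => //; split=> //.
  by apply: null2S nN => y [/nN' Ny Sy].
apply: null2_bigcup => n.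
have [h|h] := pselect (lam2.-negligible (ball (c n) (e n) `&` S : set T2)).
  by apply: null2S h => x [].
by apply: null2_empty => x [].
Qed.

Variables (g1 g2 phi : R * R -> R) (p : R * R) (r : R).
Hypothesis P0 : forall (c z e : R * R) (d b : R),
  ball p r z -> ball p r (z + e) -> ball c d z -> ball c d (z + e) ->
  lam2.-negligible (ball c d `&` [set x | e.1 * g1 x + e.2 * g2 x < b]) ->
  b <= phi (z + e) - phi z.

Lemma potential_lipschitz (C : R) :
  lam2.-negligible (ball p r `&` [set x | ~ (`|g1 x| <= C /\ `|g2 x| <= C)]) ->
  forall x y, ball p r x -> ball p r y -> `|phi x - phi y| <= 2 * C * `|x - y|.
Proof.
move=> gC; have H x y : ball p r x -> ball p r y -> - (2 * C * `|y - x|) <= phi y - phi x.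
  move=> xb yb; have E : y = x + (y - x) by rewrite addrCA subrr addr0.
  rewrite [in leRHS]E; apply: (P0 (c := p) (d := r)) => //; rewrite -?E//.
  apply: null2S gC => z [zb /= lt]; split=> // -[g1C g2C]; move: lt.
  have [n1 n2] := norm2_ge (y - x); apply/negP; rewrite -leNgt.
  have h1 : `|(y - x).1 * g1 z| <= `|y - x| * C by rewrite normrM ler_pM.
  have h2 : `|(y - x).2 * g2 z| <= `|y - x| * C by rewrite normrM ler_pM.
  move: h1 h2; rewrite !ler_norml; clear.
  by move: (_ * g1 z) (_ * g2 z) `|_| => a b n /andP[? ?] /andP[? ?]; lra.
move=> x y xb yb; rewrite ler_norml; apply/andP; split.
  exact: H.
by have := H x y xb yb; rewrite distrC => h; rewrite -lerN2 opprB.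
Qed.

(** When the field is the gradient of [Re f], [potential_ge] applies to the segment in both
    directions and gives equality of the increments. *)
Lemma potential_of_gradient (f A : R * R -> R * R) (q : R * R) (O : set (R * R)) :
  open O -> O q -> O `<=` ball p r ->
  (forall x, O x -> holo_at f x (A x) /\ {for x, continuous A}) ->
  lam2.-negligible (O `&` [set x | ~ (g1 x = (A x).1 /\ g2 x = - (A x).2)]) ->
  exists2 d : R, 0 < d & forall z, ball q d z -> phi z - (f z).1 = phi q - (f q).1.
Proof.
move=> oO Oq Op hf nA.
have /nbhs_ballP[d /= d0 dO] : nbhs q O by exact: open_nbhs_nbhs.
exists d => // z zb; have qb : ball q d q by exact: ballxx.
have hd x : ball q d x -> holo_at f x (A x) /\ {for x, continuous A} by move=> /dO/hf.
have dp : ball q d `<=` ball p r by exact: subset_trans dO Op.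
have neg e : lam2.-negligible (ball q d `&`
    [set x | e.1 * g1 x + e.2 * g2 x < reC (A x) e]).
  apply: null2S nA => x [/dO Ox /= lt]; split=> // -[E1 E2]; move: lt.
  by rewrite E1 E2 /reC mulrN ltxx.
have Ez : q + (z - q) = z by rewrite addrCA subrr addr0.
have Eq : z + (q - z) = q by rewrite addrCA subrr addr0.
have h1 := @potential_ge _ g1 g2 phi f A p r P0 q q (z - q) d hd dp qb.
rewrite Ez in h1; have {}h1 := h1 zb (neg _).
have h2 := @potential_ge _ g1 g2 phi f A p r P0 q z (q - z) d hd dp zb.
rewrite Eq in h2; have {}h2 := h2 qb (neg _).
by move: h1 h2; clear; move: (phi z) (phi q) (f z).1 (f q).1 => *; lra.
Qed.

Lemma potential_is_derive (f A : R * R -> R * R) (q e : R * R) (d : R) : 0 < d ->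
  holo_at f q (A q) ->
  (forall z, ball q d z -> phi z - (f z).1 = phi q - (f q).1) ->
  is_derive q e phi (reC (A q) e).
Proof.
move=> d0 hq H; have [hd _] := holo_is_derive e hq.
have h := is_deriveD hd (is_derive_cst (phi q - (f q).1) q e); rewrite addr0 in h.
apply: near_eq_is_derive h.
have nb : nbhs q (ball q d) by exact: nbhsx_ballx.
apply: filterS nb => z /H.
have -> : ((fun x => (f x).1) + cst (phi q - (f q).1)) z = (f z).1 + (phi q - (f q).1) by [].
clear.
by move: (phi z) (phi q) (f z).1 (f q).1 => *; lra.
Qed.

End local_facts.

(** * Stability of a positive direction under perturbation *)

Section cone.
Context {R : realType}.

(** The main term is at least [s / 2]; the deviation contributes at most
    [2 * (2 * C) * s / (8 * (C + 1))], which does not exceed [s / 2]. *)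
Lemma cone_stable (a e0 e : R * R) (s C : R) : 0 <= s -> 0 <= C -> `|a| <= 2 * C ->
  2^-1 <= reC a e0 -> `|e - s *: e0| <= s * (8 * (C + 1))^-1 -> 0 <= reC a e.
Proof.
move=> s0 C0 aC ge le.
have E : reC a e = s * reC a e0 + reC a (e - s *: e0) by rewrite /reC /= /GRing.scale /=; ring.
have h := reC_le a (e - s *: e0).
have h2 : `|a| * `|e - s *: e0| <= s / 4.
  apply: (@le_trans _ _ (2 * C * (s * (8 * (C + 1))^-1))); first by rewrite ler_pM.
  have C1 : 0 < 8 * (C + 1) by lra.
  have -> : 2 * C * (s * (8 * (C + 1))^-1) = 2 * C * s / (8 * (C + 1)) by ring.
  by rewrite ler_pdivrMr//; nra.
have h3 : s * 2^-1 <= s * reC a e0 by rewrite ler_wpM2l.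
move: h h2 h3; rewrite E ler_norml; clear.
move: (reC _ _) (reC _ _) (_ * `|_|) => x y n /andP[h _] *; lra.
Qed.

End cone.

(** * Consequences of the piecewise analytic structure and of the hypotheses at [p] *)

Section piecewise.
Context {R : realType}.
Local Notation T2 := (measurableTypeR R * measurableTypeR R)%type.

(** [phi_p] takes its maximum in the extended reals from the default [-oo]; an attained bound makes
    the result finite. *)
Lemma bigmaxe_attained (I : finType) (S : {set I}) (a : I -> R) (m : R) :
  (forall j, j \in S -> a j <= m) -> (exists2 j, j \in S & a j = m) ->
  fine (\big[maxe/-oo%E]_(j in S) (a j)%:E) = m.
Proof.
move=> am [j jS aj]; rewrite (_ : \big[maxe/-oo%E]_(j in S) (a j)%:E = m%:E)//.
apply/eqP; rewrite eq_le; apply/andP; split.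
  by apply: bigmax_le => [|i /am ?]; rewrite ?leNye// lee_fin.
by rewrite -aj; exact: (@le_bigmax_cond _ _ _ -oo%E j [in S] (fun j => (a j)%:E) jS).
Qed.

Lemma region_open (U : set (R * R)) (n : nat) Phi (A : 'I_n -> R * R -> R * R) M :
  piecewise_analytic U Phi A M -> forall k, open (M k).
Proof.
move=> [_ [_ [_ [ME _]]]] k; rewrite ME openE => x [Ux nx].
have [N [oN [Nx [NU Nt]]]] : exists N, open N /\ N x /\ N `<=` U /\
    forall psi, test_on N psi -> pairing (fun z => Phi z - A k z) psi = 0.
  by apply: contrapT => h; apply: nx.
have nN : nbhs x N by exact: open_nbhs_nbhs.
apply: filterS nN => y Ny; split; first exact: NU.
by move=> [_ +]; apply; exists N.
Qed.

Lemma analytic_continuous (U : set (R * R)) f : analytic_on U f ->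
  forall x, U x -> {for x, continuous f}.
Proof. by move=> [_ hf] x /hf[l hl]; exact: holo_continuous hl. Qed.

(** Each point of [M k] has a neighbourhood on which [Phi - A k] annihilates all test functions; the
    fundamental lemma applies to both components there. *)
Lemma region_ae (U : set (R * R)) (n : nat) Phi (A : 'I_n -> R * R -> R * R) M :
  piecewise_analytic U Phi A M -> forall k,
  lam2.-negligible (M k `&` [set x | Phi x <> A k x]).
Proof.
move=> [LU [anA [_ [ME _]]]] k; apply: null2_local => x; rewrite ME => -[Ux nx].
have [N [oN [Nx [NU Nt]]]] : exists N, open N /\ N x /\ N `<=` U /\
    forall psi, test_on N psi -> pairing (fun z => Phi z - A k z) psi = 0.
  by apply: contrapT => h; apply: nx.
exists N; split => //; split => //.
have oU := (anA k).1; have cA := analytic_continuous (anA k).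
have cA1 z : U z -> {for z, continuous (fun z => (A k z).1)}.
  by move=> /cA h; apply: cvg_comp h _; exact: cvg_fst.
have cA2 z : U z -> {for z, continuous (fun z => (A k z).2)}.
  by move=> /cA h; apply: cvg_comp h _; exact: cvg_snd.
have n1 : lam2.-negligible (N `&` [set z | (Phi z - A k z).1 != 0]).
  apply: (fundamental_lemma (g := fun z => (Phi z - A k z).1)) => //.
    move=> K cK KN; have KU := subset_trans KN NU.
    have [i1 _] := LU K cK KU.
    have mK : measurable (K : set T2) by apply: closed_measurable2; exact: compact_closed2.
    exact: (integrableB mK i1 (continuous_in_compact_integrable oU cA1 cK KU)).
  move=> psi /Nt/(congr1 fst) /= <-; congr (Rintegral _ _ _).
  by apply/funext => z /=; rewrite mulrC.
have n2 : lam2.-negligible (N `&` [set z | (Phi z - A k z).2 != 0]).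
  apply: (fundamental_lemma (g := fun z => (Phi z - A k z).2)) => //.
    move=> K cK KN; have KU := subset_trans KN NU.
    have [_ i2] := LU K cK KU.
    have mK : measurable (K : set T2) by apply: closed_measurable2; exact: compact_closed2.
    exact: (integrableB mK i2 (continuous_in_compact_integrable oU cA2 cK KU)).
  move=> psi /Nt/(congr1 snd) /= <-; congr (Rintegral _ _ _).
  by apply/funext => z /=; rewrite mulrC.
apply: null2S (null2U n1 n2) => z [Nz /= PA].
have [h1|h1] := eqVneq (Phi z - A k z).1 0; last by left; split.
have [h2|h2] := eqVneq (Phi z - A k z).2 0; last by right; split.
exfalso; apply: PA; apply/eqP; rewrite -subr_eq0; apply/eqP.
by rewrite [LHS]surjective_pairing h1 h2.
Qed.

Lemma cutoff_integrable (K : set (R * R)) (g : R * R -> R) : compact K ->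
  lam2.-integrable K (EFin \o g) ->
  lam2.-integrable setT (EFin \o (fun x => g x * (x \in K)%:R)).
Proof.
move=> cK; have mK : measurable (K : set T2).
  by apply: closed_measurable2; exact: compact_closed2.
move/(integrable_mkcond (T := T2) (EFin \o g) mK).
have -> : (EFin \o g) \_ K = EFin \o (fun x => g x * (x \in K)%:R) => //.
by apply/funext => x /=; rewrite patchE; case: ifPn; rewrite /= ?mulr1 ?mulr0.
Qed.

(** Twice [Phi] times the [zbar]-derivative of [psi] has real part [g1 * 'D_e1 psi + g2 * 'D_e2 psi]
    and imaginary part [g1 * 'D_e2 psi - g2 * 'D_e1 psi]. Positivity of the distribution thus says
    that the field [(g1, g2)] has nonnegative divergence and no curl. *)
Lemma sigma_pairings (U W : set (R * R)) Phi (g1 g2 psi : R * R -> R) :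
  in_Sigma U Phi -> W `<=` U ->
  (forall x, W x -> g1 x = (Phi x).1 /\ g2 x = - (Phi x).2) ->
  lam2.-integrable setT (EFin \o g1) -> lam2.-integrable setT (EFin \o g2) ->
  test_on W psi -> (forall x, 0 <= psi x) ->
  pair2 g1 ('D_e2 psi) = pair2 g2 ('D_e1 psi) /\
  pair2 g1 ('D_e1 psi) + pair2 g2 ('D_e2 psi) <= 0.
Proof.
move=> [_ sg] WU gE ig1 ig2 tp p0; have [v2 v1] := sg _ (test_on_sub WU tp) p0.
have [t1 t2] := test_derive tp.
have [D1 D10 HD1] := test_bounded t1; have [D2 D20 HD2] := test_bounded t2.
have m1 := continuous_measurable2 (test_continuous t1).
have m2 := continuous_measurable2 (test_continuous t2).
have i11 := integrableM_bounded ig1 m1 HD1; have i12 := integrableM_bounded ig1 m2 HD2.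
have i21 := integrableM_bounded ig2 m1 HD1; have i22 := integrableM_bounded ig2 m2 HD2.
have E2 : Rintegral lam2 setT (fun x => (cmul (Phi x) (dzbar psi x)).2) =
    2^-1 * (pair2 g1 ('D_e2 psi) - pair2 g2 ('D_e1 psi)).
  rewrite /pair2 -(Rint2B i12 i21).
  rewrite -[RHS](Rint2Z 2^-1 (integrableB (@measurableT _ T2) i12 i21)).
  congr (Rintegral _ _ _); apply/funext => x; rewrite /cmul /dzbar /=.
  have [Wx|Wx] := pselect (W x); first by have [-> ->] := gE x Wx; ring.
  by rewrite (test_out0 t1 Wx) (test_out0 t2 Wx); ring.
have E1 : Rintegral lam2 setT (fun x => (cmul (Phi x) (dzbar psi x)).1) =
    2^-1 * (pair2 g1 ('D_e1 psi) + pair2 g2 ('D_e2 psi)).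
  rewrite /pair2 -(Rint2D i11 i22).
  rewrite -[RHS](Rint2Z 2^-1 (integrableD (@measurableT _ T2) i11 i22)).
  congr (Rintegral _ _ _); apply/funext => x; rewrite /cmul /dzbar /=.
  have [Wx|Wx] := pselect (W x); first by have [-> ->] := gE x Wx; ring.
  by rewrite (test_out0 t1 Wx) (test_out0 t2 Wx); ring.
move: v2 v1; rewrite /= E1 E2; clear.
move: (pair2 _ _) (pair2 _ _) (pair2 _ _) (pair2 _ _) => a b c d h1 h2.
by split; [clear h2; lra|clear h1; lra].
Qed.

(** Gordan's alternative for the vectors [A k p - A j p]. If [k] is the only index at [p], the
    family is empty and the weights cannot have a positive sum. *)
Lemma separating_directions (n : nat) (A : 'I_n -> R * R -> R * R) M p :
  ((1 < #|Iset M p|)%N -> forall k, k \in Iset M p -> ~ Vset A M k p 0) ->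
  exists e : 'I_n -> R * R, forall k j, k \in Iset M p -> j \in Iset M p -> j != k ->
    1 <= reC (A j p - A k p) (e k).
Proof.
move=> Vh; suff H k : exists e : R * R, k \in Iset M p -> forall j, j \in Iset M p -> j != k ->
    1 <= reC (A j p - A k p) e.
  have [e He] := choice H; exists e => k j kI jI jk; exact: He.
have [kI|kI] := boolP (k \in Iset M p); last by exists 0.
have [|e He] := @gordan _ _ (Iset M p :\ k) (fun j => A k p - A j p).
  move=> th th0 sth E; have [c1|c1] := ltnP 1 #|Iset M p|.
    by apply: (Vh c1 k kI); exists th.
  have : (#|Iset M p :\ k| <= 0)%N by move: c1; rewrite (cardsD1 k) kI.
  by rewrite leqn0 cards_eq0 => /eqP D0; move: sth; rewrite D0 big_set0 ltxx.
(* Minus the complex conjugate: conjugation turns [dot] into [reC], and the sign exchanges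
   [A k - A j] for [A j - A k]. *)
exists (- e.1, e.2) => _ j jI jk; apply: (le_trans (He j _)); first by rewrite in_setD1 jk jI.
by rewrite /dot /reC /= le_eqVlt; apply/orP; left; apply/eqP; ring.
Qed.

End piecewise.

Lemma subr_le_exchange (R : realType) (a b c d : R) : a - b <= c - d -> d - b <= c - a.
Proof. lra. Qed.

Lemma subr_eq_exchange (R : realType) (a b c d : R) : a - b = c - d -> d - b = c - a.
Proof. lra. Qed.

Lemma nbhs2I (R : realType) (x : R * R) (P Q : set (R * R)) : nbhs x P -> nbhs x Q ->
  exists2 d : R, 0 < d & forall y, ball x d y -> P y /\ Q y.
Proof.
move=> /nbhs_ballP[d /= d0 dP] /nbhs_ballP[d' /= d'0 dQ].
exists (Num.min d d') => [|y yb]; first by rewrite lt_min d0 d'0.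
by split; [apply: dP|apply: dQ]; apply: le_ball yb; rewrite ge_min lexx ?orbT.
Qed.

(** * The potential near [p] as a maximum of real parts *)

Section local_formula.
Context {R : realType}.
Local Notation T2 := (measurableTypeR R * measurableTypeR R)%type.
Variables (U : set (R * R)) (n : nat) (Phi : R * R -> R * R).
Variables (A f : 'I_n -> R * R -> R * R) (M : 'I_n -> set (R * R)) (p : R * R).
Hypothesis pwa : piecewise_analytic U Phi A M.
Hypothesis oU : open U.
Hypothesis Up : U p.

(** By continuity at [p], half of the gap 1 persists nearby. A region whose closure avoids [p]
    avoids a neighbourhood of it, so only indices of [Iset M p] occur there. *)
Lemma good_ball (e : 'I_n -> R * R) :
  (forall k j, k \in Iset M p -> j \in Iset M p -> j != k -> 1 <= reC (A j p - A k p) (e k)) ->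
  exists C rho : R, [/\ 0 <= C, 0 < rho & forall x, ball p rho x ->
    [/\ U x, forall j, `|A j x| <= C, forall j, M j x -> j \in Iset M p &
      forall k j, k \in Iset M p -> j \in Iset M p -> j != k ->
        2^-1 <= reC (A j x - A k x) (e k)]].
Proof.
move=> He; have [_ [anA _]] := pwa.
(* One bound for all [j]: near [p], [A j] is within 1 of [A j p]. *)
pose C : R := \sum_(j < n) (`|A j p| + 1).
have C0 : 0 <= C by apply: sumr_ge0 => j _; rewrite addr_ge0.
have CJ j : `|A j p| + 1 <= C.
  by rewrite /C (bigD1 j)//= lerDl; apply: sumr_ge0 => i _; rewrite addr_ge0.
have cA j : {for p, continuous (A j)} := analytic_continuous (anA j) Up.
have n0 : nbhs p U by exact: open_nbhs_nbhs.
have n1 : nbhs p [set x | forall j, `|A j x| <= C].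
  apply: (@filter_forall _ _ (fun j => [set x | `|A j x| <= C]) (nbhs p)) => j.
  have /cvgrPdist_le/(_ _ ltr01) h : A j x @[x --> p] --> A j p by exact: cA.
  have {}h : nbhs p [set x | `|A j p - A j x| <= 1] by exact: h.
  apply: filterS h => x /= h; apply: le_trans (CJ j).
  rewrite -[A j x](subKr (A j p)); apply: (le_trans (ler_normB _ _)).
  by rewrite lerD2l.
have n2 : nbhs p [set x | forall j, M j x -> j \in Iset M p].
  apply: (@filter_forall _ _ (fun j => [set x | M j x -> j \in Iset M p]) (nbhs p)) => j.
  have [cl|cl] := pselect (closure (M j) p).
    by apply: filterE => x _; rewrite inE; apply/asboolP.
  have h : nbhs p (~` closure (M j)).
    by apply: open_nbhs_nbhs; split=> //; apply: closed_openC; exact: closed_closure.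
  by apply: filterS h => x nx Mx; exfalso; apply: nx; exact: subset_closure.
have n3 : nbhs p [set x | forall k j, k \in Iset M p -> j \in Iset M p -> j != k ->
    2^-1 <= reC (A j x - A k x) (e k)].
  apply: (@filter_forall _ _ (fun k => [set x | forall j, k \in Iset M p ->
    j \in Iset M p -> j != k -> 2^-1 <= reC (A j x - A k x) (e k)]) (nbhs p)) => k.
  apply: (@filter_forall _ _ (fun j => [set x | k \in Iset M p ->
    j \in Iset M p -> j != k -> 2^-1 <= reC (A j x - A k x) (e k)]) (nbhs p)) => j.
  (* Chosen so that replacing [p] by [x] in each of the two values [A j] and [A k] costs at most
     1/4. *)
  pose eps : R := (8 * (`|e k| + 1))^-1.
  have ek : 0 < 8 * (`|e k| + 1) by rewrite mulr_gt0// ltr_wpDl.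
  have eps0 : 0 < eps by rewrite invr_gt0.
  have h i : nbhs p [set x | `|A i p - A i x| <= eps].
    have /cvgrPdist_le/(_ _ eps0) h : A i x @[x --> p] --> A i p by exact: cA.
    exact: h.
  have hI : nbhs p ([set x | `|A j p - A j x| <= eps] `&` [set x | `|A k p - A k x| <= eps]).
    exact: filterI.
  apply: filterS hI => x [/= hj hk] kI jI jk; have H1 := He k j kI jI jk.
  have b i : `|A i p - A i x| <= eps -> `|reC (A i p - A i x) (e k)| <= 4^-1.
    move=> h'; apply: (le_trans (reC_le _ _)).
    apply: (@le_trans _ _ (2 * (eps * (`|e k| + 1)))).
      by rewrite ler_wpM2l// ler_pM// lerDl.
    have -> : 2 * (eps * (`|e k| + 1)) = 4^-1.
      by rewrite /eps; field; rewrite gt_eqF// ltr_wpDl.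
    by [].
  have bj := b j hj; have bk := b k hk.
  have E : reC (A j x - A k x) (e k) = reC (A j p - A k p) (e k) -
      reC (A j p - A j x) (e k) + reC (A k p - A k x) (e k) by rewrite /reC /=; ring.
  rewrite E; move: H1 bj bk; rewrite !ler_norml; clear.
  by move: (reC _ _) (reC _ _) (reC _ _) => a b c ? /andP[? ?] /andP[? ?]; lra.
have nA : nbhs p (U `&` [set x | forall j, `|A j x| <= C] `&`
    ([set x | forall j, M j x -> j \in Iset M p] `&`
    [set x | forall k j, k \in Iset M p -> j \in Iset M p -> j != k ->
    2^-1 <= reC (A j x - A k x) (e k)])).
  by apply: filterI; apply: filterI.
have /nbhs_ballP[rho /= rho0 Hrho] := nA.
by exists C, rho; split=> // x /Hrho[[? ?] [? ?]].
Qed.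

Hypothesis sg : in_Sigma U Phi.
Hypothesis hf : forall i z, U z -> holo_at (f i) z (A i z).

Lemma pieces_ae (W : set (R * R)) : W `<=` U ->
  lam2.-negligible (W `&` [set x | ~ exists k, M k x /\ Phi x = A k x]).
Proof.
move=> WU; have [_ [_ [_ [_ nU]]]] := pwa; have nM := region_ae pwa.
apply: null2S (null2U nU (null2_fin nM)) => x [/WU Ux nx].
have [[k _ Mk]|nM'] := pselect ((\bigcup_i M i) x); last by left.
by right; exists k => //; split=> // PA; apply: nx; exists k.
Qed.

Lemma local_potential :
  ((1 < #|Iset M p|)%N -> forall k, k \in Iset M p -> ~ Vset A M k p 0) ->
  exists (phi : R * R -> R) (d L : R), [/\ 0 < d, ball p d `<=` U,
    forall x y, ball p d x -> ball p d y -> `|phi x - phi y| <= L * `|x - y|,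
    lam2.-negligible (ball p d `&` [set x | ~ (is_derive x e1 phi (Phi x).1 /\
      is_derive x e2 phi (- (Phi x).2))]) &
    forall z, ball p d z -> phi z - phi p = phi_p M f p z].
Proof.
move=> /separating_directions[e He].
have [C [rho [C0 rho0 good]]] := good_ball He; have [LU [anA _]] := pwa.
(* The construction on [ball p r] uses test functions on [ball p (2 * r)], and the closed square of
   half-side [2 * r] has to lie in [ball p rho]. *)
pose r : R := rho / 3.
have r0 : 0 < r by rewrite divr_gt0.
have rE : rho = 3 * r by rewrite /r mulrC divfK// pnatr_eq0.
have r2 x : ball p (2 * r) x -> ball p rho x by apply: le_ball; rewrite rE; move: r0; lra.
have r1 x : ball p r x -> ball p (2 * r) x by apply: le_ball; move: r0; lra.
pose K : set (R * R) := `[p.1 - 2 * r, p.1 + 2 * r]%classic `*` `[p.2 - 2 * r, p.2 + 2 * r]%classic.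
have cK : compact K by apply: compact_setX; exact: segment_compact.
have KU : K `<=` U.
  move=> x; rewrite /K /= !in_itv /= => -[h1 h2].
  suff /good[] : ball p rho x by [].
  by apply/ball2P; rewrite rE !ltr_norml; move: r0 h1 h2; lra.
have inK x : ball p (2 * r) x -> x \in K.
  move=> /ball2P; rewrite !ltr_norml => h; rewrite inE /K /= !in_itv /=.
  by move: h; lra.
have [iP1 iP2] := LU K cK KU.
(* Extension by zero outside [K] makes the field integrable on the whole plane and leaves it
   unchanged on [ball p (2 * r)]. *)
pose g1 x : R := (Phi x).1 * (x \in K)%:R; pose g2 x : R := - (Phi x).2 * (x \in K)%:R.
have ig1 : lam2.-integrable setT (EFin \o g1) := cutoff_integrable cK iP1.
have ig2 : lam2.-integrable setT (EFin \o g2).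
  apply: (cutoff_integrable (g := fun x => - (Phi x).2) cK).
  have mK : measurable (K : set T2) by apply: closed_measurable2; exact: compact_closed2.
  exact: (integrableN iP2).
have gE x : ball p (2 * r) x -> g1 x = (Phi x).1 /\ g2 x = - (Phi x).2.
  by move=> /inK xK; rewrite /g1 /g2 xK !mulr1.
have U2 : ball p (2 * r) `<=` U by move=> x /r2/good[].
have nae := pieces_ae U2.
have gC : lam2.-negligible (ball p (2 * r) `&` [set x | ~ (`|g1 x| <= C /\ `|g2 x| <= C)]).
  apply: null2S nae => x [xb nx]; split=> // -[k [_ PA]]; apply: nx.
  have [-> ->] := gE x xb; rewrite normrN PA; have [_ AC _ _] := good x (r2 x xb).
  by have [h1 h2] := norm2_ge (A k x); split; exact: le_trans (AC k).
have curl psi : test_on (ball p (2 * r)) psi -> (forall x, 0 <= psi x) ->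
    pair2 g1 ('D_e2 psi) = pair2 g2 ('D_e1 psi).
  by move=> tp p0; have [] := sigma_pairings sg U2 gE ig1 ig2 tp p0.
have sub psi : test_on (ball p r) psi -> (forall x, 0 <= psi x) ->
    pair2 g1 ('D_e1 psi) + pair2 g2 ('D_e2 psi) <= 0.
  by move=> tp p0; have [] := sigma_pairings sg U2 gE ig1 ig2 (test_on_sub r1 tp) p0.
have [phi P0] := potential_exists r0 ig1 ig2 curl gC.
have rU : ball p r `<=` U by move=> x /r1/U2.
have nae1 : lam2.-negligible (ball p r `&` [set x | ~ exists k, M k x /\ Phi x = A k x]).
  exact: pieces_ae.
have gE1 x : ball p r x -> g1 x = (Phi x).1 /\ g2 x = - (Phi x).2 by move=> /r1/gE.
have phiL : forall x y, ball p r x -> ball p r y -> `|phi x - phi y| <= 2 * C * `|x - y|.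
  by apply: (potential_lipschitz P0); apply: null2S gC => x [/r1 xb nx].
have hfA k x : U x -> holo_at (f k) x (A k x) /\ {for x, continuous (A k)}.
  by move=> Ux; split; [exact: hf|exact: analytic_continuous (anA k) _ Ux].
have loc k q : M k q -> ball p r q -> exists2 d : R, 0 < d &
    forall z, ball q d z -> phi z - (f k z).1 = phi q - (f k q).1.
  move=> Mq qb; apply: (potential_of_gradient P0 (A := A k) (O := M k `&` ball p r)).
  - by apply: openI; [exact: region_open pwa k|exact: ball_open].
  - by split.
  - by move=> x [].
  - by move=> x [_ /rU]; exact: hfA.
  - apply: null2S (region_ae pwa k) => x [[Mx xb] nx]; split=> // PA; apply: nx.
    by have [-> ->] := gE1 x xb; rewrite PA.
(* On the open sets [M k] the potential is locally [Re f_k] plus a constant, so it is differentiable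
   there, and these sets have full measure. *)
have nd : lam2.-negligible (ball p r `&`
    [set x | ~ (is_derive x e1 phi (g1 x) /\ is_derive x e2 phi (g2 x))]).
  apply: null2S nae1 => x [xb nx]; split=> // -[k [Mx PA]]; apply: nx.
  have [d d0 Hd] := loc k x Mx xb; have [-> ->] := gE1 x xb.
  have hx := hf k (rU x xb); have h e := potential_is_derive e d0 hx Hd.
  by split; [apply: (is_derive_eq (h e1))|apply: (is_derive_eq (h e2))];
    rewrite /reC PA /=; ring.
have AC k x : ball p r x -> `|A k x| <= C by move=> /r1/r2/good[].
have min k : k \in Iset M p -> exists2 d : R, 0 < d & forall z, ball p d z ->
    phi p - (f k p).1 <= phi z - (f k z).1 /\
    (M k z -> phi z - (f k z).1 = phi p - (f k p).1).
  move=> kI; have clM : closure (M k) p by move: (kI); rewrite inE => /asboolP.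
  have delta0 : 0 < (8 * (C + 1))^-1 by rewrite invr_gt0 mulr_gt0// ltr_wpDl.
  have hfk x : ball p r x -> holo_at (f k) x (A k x) /\ {for x, continuous (A k)}.
    by move=> /rU; exact: hfA.
  apply: (cone_minimum (e0 := e k) r0 hfk (AC k) phiL nd ig1 ig2 sub delta0 _ (loc k) clM).
  move=> s z v s0 zb vb sv.
  have := @potential_ge _ g1 g2 phi (f k) (A k) p r P0 p z v r hfk (fun x xb => xb) zb vb.
  move=> H; suff /H : lam2.-negligible (ball p r `&`
      [set x | v.1 * g1 x + v.2 * g2 x < reC (A k x) v]).
    exact: subr_le_exchange.
  apply: null2S nae1 => x [xb /= lt]; split=> // -[j [Mx PA]]; move: lt; apply/negP.
  have [Ux _ Mj gap] := good x (r2 _ (r1 _ xb)).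
  have [-> ->] := gE1 x xb; rewrite -leNgt PA.
  (* Where [Phi = A j], the field exceeds the gradient of [Re f_k] along [v] by
     [reC (A j x - A k x) v], which is nonnegative for [v] in the cone. *)
  have -> : v.1 * (A j x).1 + v.2 * - (A j x).2 = reC (A k x) v + reC (A j x - A k x) v.
    by rewrite /reC /=; ring.
  rewrite lerDl; have [->|jk] := eqVneq j k; first by rewrite subrr /reC /= !mulr0 subrr.
  apply: (cone_stable s0 C0 _ (gap k j kI (Mj j Mx) jk) sv).
  by apply: (le_trans (ler_normB _ _)); rewrite mulr2n mulrDl !mul1r lerD// AC.
have nmin : nbhs p [set z | forall k, k \in Iset M p ->
    phi p - (f k p).1 <= phi z - (f k z).1 /\
    (M k z -> phi z - (f k z).1 = phi p - (f k p).1)].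
  apply: (@filter_forall _ _ (fun k => [set z | k \in Iset M p ->
    phi p - (f k p).1 <= phi z - (f k z).1 /\
    (M k z -> phi z - (f k z).1 = phi p - (f k p).1)]) (nbhs p)) => k.
  have [kI|kI] := boolP (k \in Iset M p); last by apply: filterE.
  have [d d0 Hd] := min k kI; apply/nbhs_ballP; exists d => // z zb _; exact: Hd.
have nr : nbhs p (ball p r) by exact: nbhsx_ballx.
have [d d0 Hd] := nbhs2I nmin nr.
have dr : ball p d `<=` ball p r by move=> z /Hd[].
exists phi, d, (2 * C); split=> //.
- exact: subset_trans dr rU.
- by move=> x y /dr xb /dr yb; exact: phiL.
- apply: null2S nd => x [/dr xb nx]; split=> //.
  by rewrite /=; have [-> ->] := gE1 x xb.
move=> z zd; have [/= Hz zr] := Hd z zd; apply/esym; apply: bigmaxe_attained.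
  move=> k /Hz[h _]; have -> : (f k z - f k p).1 = (f k z).1 - (f k p).1 by [].
  exact: subr_le_exchange.
(* If no index attained the maximum at [z], all the inequalities would be strict on a square around
   [z]. The regions would all miss it, although they cover almost every point. *)
apply: contrapT => nk.
have lt k : k \in Iset M p -> phi p - (f k p).1 < phi z - (f k z).1.
  move=> kI; have [le _] := Hz k kI; rewrite lt_neqAle le andbT; apply/negP => /eqP E.
  apply: nk; exists k => //; have -> : (f k z - f k p).1 = (f k z).1 - (f k p).1 by [].
  exact: subr_eq_exchange.
have nlt : nbhs z [set y | forall k, k \in Iset M p -> phi p - (f k p).1 < phi y - (f k y).1].
  apply: (@filter_forall _ _ (fun k => [set y | k \in Iset M p ->
    phi p - (f k p).1 < phi y - (f k y).1]) (nbhs z)) => k.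
  have [kI|kI] := boolP (k \in Iset M p); last by apply: filterE.
  have cu : {for z, continuous (fun y => phi y - (f k y).1)}.
    apply: cvgB; first exact: (lipschitz_continuous phiL zr).
    by have cf := holo_continuous (hf k (rU z zr)); apply: cvg_comp cf _; exact: cvg_fst.
  have n1 : nbhs (phi z - (f k z).1) [set t | phi p - (f k p).1 < t].
    by apply: open_nbhs_nbhs; split; [exact: open_gt|exact: lt].
  have n2 : nbhs z [set y | phi p - (f k p).1 < phi y - (f k y).1] := cu _ n1.
  by apply: filterS n2 => y ? _.
have nd' : nbhs z (ball p d) by apply: open_nbhs_nbhs; split=> //; exact: ball_open.
have [eta eta0 Heta] := nbhs2I nlt nd'.
suff E0 : ball z eta = set0 by have := ballxx z eta0; rewrite E0.
apply: null2_open; first exact: ball_open.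
apply: null2S nae1 => y /Heta[/= ylt yd]; split; first exact: dr.
move=> [k [Mk _]]; have [Hy yr] := Hd y yd.
have [_ _ Mj _] := good y (r2 _ (r1 _ yr)); have kI := Mj k Mk.
by have [_ /(_ Mk) E] := Hy k kI; have := ylt k kI; rewrite E ltxx.
Qed.

End local_formula.

(** For a real function, [2 d/dz] has as components the derivative along [e1] and minus the
    derivative along [e2]; a potential with gradient [(Re Phi, - Im Phi)] therefore satisfies
    [Phi = 2 d phi/dz] almost everywhere. Integration by parts puts this in its distributional
    form. *)
Theorem theorem3 (R : realType) (U : set (R * R)) (r : nat)
    (Phi : R * R -> R * R) (A f : 'I_r -> R * R -> R * R)
    (M : 'I_r -> set (R * R)) :
  domain U -> simply_connected U ->
  piecewise_analytic U Phi A M ->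
  in_Sigma U Phi ->
  (forall i, analytic_on U (f i)) ->
  (forall i z, U z -> holo_at (f i) z (A i z)) ->
  (forall j k l : 'I_r, (j < k)%N -> (k < l)%N ->
     H1_null (bdry_in U (M j) `&` bdry_in U (M k) `&` bdry_in U (M l))) ->
  (forall p, U p -> (1 < #|Iset M p|)%N ->
     forall k, k \in Iset M p -> ~ Vset A M k p 0) ->
  forall p, U p ->
    exists N : set (R * R), open N /\ N p /\ N `<=` U /\
      forall psi, test_on N psi ->
        pairing Phi psi = - (2 : R) *: cint (fun x => phi_p M f p x *: dz psi x).
Proof.
move=> [oU _] _ pwa sg _ hf _ Vh p Up; have [LU _] := pwa.
have [phi [d [L [d0 dU phiL nd phiE]]]] := local_potential pwa oU Up sg hf (Vh p Up).
exists (ball p d); split; first exact: ball_open.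
split; first exact: ballxx.
split=> // psi tp; have [t1 t2] := test_derive tp.
have half1 (a : R) : - a = - 2 * (2^-1 * a) by lra.
have half2 (a : R) : - 1 * - a = - 2 * (- 2^-1 * a) by lra.
(* On the ball this is [phi_p]; elsewhere the derivatives of [psi] vanish. *)
pose w z := phi z - phi p.
have wL x y : ball p d x -> ball p d y -> `|w x - w y| <= L * `|x - y|.
  by move=> xb yb; rewrite /w opprB addrA subrK; exact: phiL.
have wB := lipschitz_bounded d0 wL.
have dw v x l : is_derive x v phi l -> is_derive x v w l.
  by move=> h; have := is_deriveB h (is_derive_cst (phi p) x v); rewrite subr0.
have iP1 : lam2.-integrable setT (EFin \o (fun x => (Phi x).1 * psi x)).
  apply: (test_mul_integrable (g := fun x => (Phi x).1) tp) => K cK Kd.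
  by have [] := LU K cK (subset_trans Kd dU).
have iP2 : lam2.-integrable setT (EFin \o (fun x => - (Phi x).2 * psi x)).
  apply: (test_mul_integrable (g := fun x => - (Phi x).2) tp) => K cK Kd.
  by have [_ h] := LU K cK (subset_trans Kd dU); exact: (integrableN h).
have n1 : lam2.-negligible (ball p d `&` [set x | ~ is_derive x e1 w (Phi x).1]).
  by apply: null2S nd => x [xb nx]; split=> // -[h _]; apply: nx; exact: dw.
have n2 : lam2.-negligible (ball p d `&` [set x | ~ is_derive x e2 w (- (Phi x).2)]).
  by apply: null2S nd => x [xb nx]; split=> // -[_ h]; apply: nx; exact: dw.
have [j1 E1] := integration_by_parts (ball_open p d) wB wL n1 tp t1
  (fun x => (smooth_is_derive x tp.1).1) iP1.
have [j2 E2] := integration_by_parts (ball_open p d) wB wL n2 tp t2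
  (fun x => (smooth_is_derive x tp.1).2) iP2.
have F1 : Rintegral lam2 setT (fun x => (psi x *: Phi x).1) =
    - (2 : R) * Rintegral lam2 setT (fun x => (phi_p M f p x *: dz psi x).1).
  have -> : (fun x => (psi x *: Phi x).1) = (fun x => (Phi x).1 * psi x).
    by apply/funext => x; rewrite mulrC.
  have -> : (fun x => (phi_p M f p x *: dz psi x).1) = (fun x => 2^-1 * (w x * 'D_e1 psi x)).
    apply/funext => x; rewrite /dz fst_scale /=.
    have [xb|xb] := pselect (ball p d x); last by rewrite (test_out0 t1 xb) !mulr0.
    by rewrite -phiE// /w mulrCA.
  by rewrite [LHS]E1 (Rint2Z 2^-1 j1); exact: half1.
have F2 : Rintegral lam2 setT (fun x => (psi x *: Phi x).2) =
    - (2 : R) * Rintegral lam2 setT (fun x => (phi_p M f p x *: dz psi x).2).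
  have -> : (fun x => (psi x *: Phi x).2) = (fun x => - 1 * (- (Phi x).2 * psi x)).
    by apply/funext => x; rewrite snd_scale mulN1r mulNr opprK mulrC.
  have -> : (fun x => (phi_p M f p x *: dz psi x).2) = (fun x => - 2^-1 * (w x * 'D_e2 psi x)).
    apply/funext => x; rewrite /dz snd_scale /=.
    have [xb|xb] := pselect (ball p d x); last by rewrite (test_out0 t2 xb) !(mulr0, oppr0).
    by rewrite -phiE// /w mulrN mulrCA mulNr.
  by rewrite [LHS](Rint2Z (- 1) iP2) [X in - 1 * X]E2 (Rint2Z (- 2^-1) j2); exact: half2.
by rewrite /pairing /cint F1 F2.
Qed.
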